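(* Let $X$ be a separable complex Banach space, $T>0$, and let $\bigl((A(t),\mathrm{D}(A(t)))\bigr)_{t\in[0,T]}$ be a family of closed and densely defined operators in $X$ with the following three properties. (1) There exist $\theta\in(\frac{\pi}{2},\pi)$ and $M\geq 1$ such that, with $\Sigma_{\theta,0}:=\{z\in\mathbb{C}: |\arg(z)|\leq\theta\}\cup\{0\}$, one has $\Sigma_{\theta,0}\subseteq\rho(A(t))$, $\|R(\lambda,A(t))\|\leq\frac{M}{|\lambda|}$ for all $\lambda\in\Sigma_{\theta,0}\setminus\{0\}$, and $\|A(t)^{-1}\|\leq M$, for all $t\in[0,T]$. (2) $X_{-1}(A(t))\cong X_{-1}(A(0))=:X_{-1}$ for all $t\in[0,T]$, and there exists $\kappa>0$ such that $\frac{1}{\kappa}\|x\|_{X_{-1}}\leq\|x\|_{X_{-1}(A(t))}\leq\kappa\|x\|_{X_{-1}}$ for all $x\in X_{-1}$ and $t\in[0,T]$. (3) There exists $L>0$ such that $\|\mathrm{I}-A_{-1}(t)A_{-1}(s)^{-1}\|\leq L|t-s|$ for all $t,s\in[0,T]$ (operator norm on $X_{-1}$). Assume moreover that the non-autonomous abstract Cauchy problem $$u'(t)=A(t)u(t),\quad T\geq t\geq s\geq 0,\qquad u(s)=x,$$ is solved by an evolution family $(U(t,s))_{0\leq s\leq t\leq T}$ on $X$. If $$B(\cdot)\in\mathrm{L}^{\infty}\bigl([0,T],\mathscr{L}_{\mathrm{s}}(X,F_0)\bigr)\cap\mathrm{Lip}\bigl([0,T],\mathscr{L}_{\mathrm{s}}(X,X_{-1})\bigr),$$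 then there exists an evolution family $(V(t,s))_{0\leq s\leq t\leq T}$ on $X$ satisfying the variation of constants formula $$V(t,s)x=U(t,s)x+\int_s^t U_{-1}(t,\sigma)B(\sigma)V(\sigma,s)x\,\mathrm{d}\sigma,\qquad 0\leq s\leq t\leq T,\ x\in X.$$
   Context: Notation: $R(\lambda,A):=(\lambda-A)^{-1}$ for $\lambda\in\rho(A)$. $\Delta_T:=\{(t,s)\in[0,T]^2: t\geq s\}$. Extrapolation spaces: by (1), each $A(t)$ generates a (strongly continuous, analytic) semigroup $(\mathrm{e}^{\tau A(t)})_{\tau\ge 0}$ on $X$ and is boundedly invertible. For a generator $A$ of a $C_0$-semigroup $(S(\tau))_{\tau\geq0}$ on $X$ with $0\in\rho(A)$, the (first) extrapolation space $X_{-1}(A)$ is the completion of $X$ with respect to the norm $\|x\|_{-1}:=\|A^{-1}x\|$; it contains $X$ as a dense subspace. The operators $S(\tau)$ extend continuously to operators $S_{-1}(\tau)$ on $X_{-1}(A)$ forming a $C_0$-semigroup whose generator $A_{-1}$ has domain $\mathrm{D}(A_{-1})=X$ and is the unique extension of $A:\mathrm{D}(A)\to X$ to an isometry from $X$ to $X_{-1}(A)$. Write $A_{-1}(t):=A(t)_{-1}$. In (2) the isomorphism is the identification of both spaces as completions of the same space $X$ (i.e. the one induced by the identity of $X$); all $A_{-1}(t)$ are then regarded as operators in $X_{-1}$ with domain $X$. Evolution family: a family $(U(t,s))_{0\leq s\leq t\leq T}$ of bounded linear operators on a Banach space $Y$ is an evolution family if $U(s,s)=\mathrm{I}$, $U(t,r)=U(t,s)U(s,r)$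 for $T\geq t\geq s\geq r\geq0$, and $\Delta_T\ni(t,s)\mapsto U(t,s)$ is strongly continuous. It solves the Cauchy problem above if there are dense subspaces $Y_s$ ($s\in[0,T]$) of $X$ with $U(t,s)Y_s\subseteq Y_t\subseteq \mathrm{D}(A(t))$ for $T\geq t\geq s\geq 0$ such that for all $s\in[0,T]$, $x\in Y_s$ the function $u=U(\cdot,s)x$ is a classical solution, i.e. $u\in\mathrm{C}^1([s,T],X)$, $u(t)\in\mathrm{D}(A(t))$, $u'(t)=A(t)u(t)$ for $t\in[s,T]$, and $u(s)=x$. The extrapolated evolution family $U_{-1}$: under (1)–(3), there is a unique evolution family $(U_{-1}(t,s))_{0\leq s\leq t\leq T}$ on $X_{-1}$ associated with $(A_{-1}(t),X)_{t\in[0,T]}$, meaning that $U_{-1}$ is strongly continuous on $\Delta_T$ both as an $\mathscr{L}(X_{-1})$-valued map and (by restriction) as an $\mathscr{L}(X)$-valued map, $\frac{\partial}{\partial t}U_{-1}(t,s)x=A_{-1}(t)U_{-1}(t,s)x$ and $\frac{\partial}{\partial s}U_{-1}(t,s)x=-U_{-1}(t,s)A_{-1}(s)x$ in $X_{-1}$ for $x\in X$, $t\geq s$, and $\|U_{-1}(t,s)\|\leq M'\mathrm{e}^{\omega(t-s)}$ for some $M'\geq1$, $\omega\in\mathbb{R}$. It satisfies $U_{-1}(t,s)|_X=U(t,s)$. Favard class: for a generator $A$ of a $C_0$-semigroup $(S(\tau))_{\tau\ge 0}$ with $[0,\infty)\subseteq\rho(A)$ and $\sup_{\lambda>0}\|\lambda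 R(\lambda,A)\|<\infty$, set $F_0(A):=\{x\in X_{-1}(A): \sup_{\tau>0}\frac1\tau\|S_{-1}(\tau)x-x\|_{-1}<\infty\}$ with norm $\|x\|_{F_0(A)}:=\sup_{\tau>0}\frac1\tau\|S_{-1}(\tau)x-x\|_{-1}$. Under the present assumptions $F_0(A(t))$ equals the real interpolation space $(X_{-1},X)_{1,\infty,K}$ (with equivalent norms), so it does not depend on $t$; $F_0:=F_0(A(0))$. Function classes: $\mathscr{L}_{\mathrm{s}}(Y,Z)$ is the space of bounded linear operators $Y\to Z$ with the strong operator topology. $B(\cdot)\in\mathrm{L}^\infty([0,T],\mathscr{L}_{\mathrm{s}}(X,F_0))$ means $t\mapsto B(t)x$ belongs to $\mathrm{L}^\infty([0,T],F_0)$ for every $x\in X$; $B(\cdot)\in\mathrm{Lip}([0,T],\mathscr{L}_{\mathrm{s}}(X,X_{-1}))$ means $t\mapsto B(t)x$ is Lipschitz continuous from $[0,T]$ to $X_{-1}$ for every $x\in X$. The integral in the formula is understood in $X_{-1}$. *)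

(* Defs.v *)
From HB Require Import structures.
From mathcomp Require Import all_boot all_order all_algebra.
From mathcomp Require Import complex.
From mathcomp Require Import all_classical all_reals all_analysis.

Set Implicit Arguments.
Unset Strict Implicit.
Unset Printing Implicit Defensive.

Import Order.TTheory GRing.Theory Num.Theory.
Import numFieldNormedType.Exports.

Local Open Scope classical_set_scope.
Local Open Scope ring_scope.
Local Open Scope complex_scope.

(* The norm of a normed space over [R[i]] takes its values in [R[i]]; they are
   nonnegative reals, so the real part loses nothing. *)
Definition rnorm (R : realType) (V : normedZmodType R[i]) (x : V) : R :=
  complex.Re `|x|.

Section Operators.
Variable R : realType.
Implicit Types V W : normedModType R[i].

Definition separable_space V := exists2 D : set V, countable D & dense D.

Definition subspace V (D : set V) :=
  D 0 /\ forall (a : R[i]) x y, D x -> D y -> D (a *: x + y).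

Definition bounded_op V W (f : V -> W) := linear f /\ continuous f.

Definition opnorm V W (f : V -> W) : \bar R :=
  ereal_sup [set (rnorm (f x))%:E | x in [set x : V | rnorm x <= 1]].

(* Values of [uop_app] outside [dom] are irrelevant. *)
Record unbounded_op V := UnboundedOp {
  dom : set V;
  uop_app :> V -> V;
  dom_subspace : subspace dom;
  uop_linear : forall (a : R[i]) x y, dom x -> dom y ->
    uop_app (a *: x + y) = a *: uop_app x + uop_app y }.

Definition closed_op V (A : unbounded_op V) :=
  closed [set p : V * V | dom A p.1 /\ A p.1 = p.2].

Definition inverse_on V W (D : set V) (f : V -> W) : W -> V :=
  'pinv_(fun=> 0) D f.

Definition resolvent V (A : unbounded_op V) (l : R[i]) : V -> V :=
  inverse_on (dom A) (fun x => l *: x - A x).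

Definition resolvent_set V (A : unbounded_op V) : set R[i] :=
  [set l | set_bij (dom A) setT (fun x => l *: x - A x) /\
           bounded_op (resolvent A l)].

Definition op_inv V (A : unbounded_op V) : V -> V := inverse_on (dom A) A.

(* The sector [{z | |arg z| <= theta} `|` {0}] in polar coordinates; the value
   [r = 0] contributes the origin. *)
Definition sector (theta : R) : set R[i] :=
  [set z | exists r phi : R,
    [/\ 0 <= r, `|phi| <= theta & z = (r * cos phi) +i* (r * sin phi)]].

Definition sectorial_family V (T : R) (A : R -> unbounded_op V) :=
  exists theta M : R, [/\ pi / 2 < theta, theta < pi, 1 <= M &
    forall t : R, 0 <= t <= T ->
      [/\ sector theta `<=` resolvent_set (A t),
          forall l, sector theta l -> l != 0 ->
            (opnorm (resolvent (A t) l) <= (M / rnorm l)%:E)%E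
        & (opnorm (op_inv (A t)) <= M%:E)%E]].

End Operators.

Section Extrapolation.
Variable R : realType.

Definition C0_semigroup (V : normedModType R[i]) (S : R -> V -> V) :=
  [/\ forall x, S 0 x = x,
      forall a b : R, 0 <= a -> 0 <= b -> forall x, S (a + b) x = S a (S b x),
      forall a : R, 0 <= a -> bounded_op (S a)
    & forall x, {within [set a : R | 0 <= a], continuous (fun a => S a x)}].

Definition generates (V : normedModType R[i]) (A : unbounded_op V)
    (S : R -> V -> V) :=
  forall x y, (dom A x /\ A x = y) <->
    (fun h : R => (h^-1)%:C *: (S h x - x)) @ 0^'+ --> y.

(* [Z], with the embedding [j], is the completion of [V] for the norm
   [|A^-1 x|]. *)
Definition extrapolation_space (V : normedModType R[i]) (A : unbounded_op V)
    (Z : completeNormedModType R[i]) (j : V -> Z) :=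
  [/\ linear j, forall x, rnorm (j x) = rnorm (op_inv A x) & dense (range j)].

Definition extrapolated_generator (V : normedModType R[i])
    (A : unbounded_op V) (Z : completeNormedModType R[i]) (j A1 : V -> Z) :=
  [/\ linear A1, forall x, rnorm (A1 x) = rnorm x
    & forall x, dom A x -> A1 x = j (A x)].

Definition extrapolated_semigroup (V : normedModType R[i])
    (S : R -> V -> V) (Z : completeNormedModType R[i]) (j : V -> Z)
    (S1 : R -> Z -> Z) :=
  forall a : R, 0 <= a ->
    bounded_op (S1 a) /\ forall x, S1 a (j x) = j (S a x).

(* The completion and the continuous extensions are determined by [A] (up to a
   unique isometry that fixes [V]) and are specified rather than built. *)
Definition extrapolation (V : normedModType R[i]) (A : unbounded_op V)
    (S : R -> V -> V) (Z : completeNormedModType R[i]) (j A1 : V -> Z)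
    (S1 : R -> Z -> Z) :=
  [/\ C0_semigroup S /\ generates A S,
      extrapolation_space A j,
      extrapolated_generator A j A1
    & extrapolated_semigroup S j S1].

(* [|1 - A t (A s)^-1| <= L |t - s|] for a family of operators in [Z], each with
   domain the image of [V]. *)
Definition Lip_generators (V Z : normedModType R[i]) (T : R)
    (A : R -> V -> Z) :=
  exists L : R, 0 < L /\
    forall t s : R, 0 <= t <= T -> 0 <= s <= T ->
      let P := fun z : Z => z - A t (inverse_on setT (A s) z) in
      (opnorm P <= (L * `|t - s|)%:E)%E.

Definition favard_norm (Z : normedModType R[i]) (S1 : R -> Z -> Z) (z : Z) :
    \bar R :=
  ereal_sup [set (a^-1 * rnorm (S1 a z - z))%:E | a in [set a : R | 0 < a]].

Definition favard (Z : normedModType R[i]) (S1 : R -> Z -> Z) : set Z :=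
  [set z | (favard_norm S1 z < +oo)%E].

End Extrapolation.

Section Evolution.
Variable R : realType.

Definition Delta (T : R) : set (R * R) :=
  [set p | 0 <= p.2 /\ p.2 <= p.1 <= T].

Definition evolution_family (V : normedModType R[i]) (T : R)
    (U : R -> R -> V -> V) :=
  [/\ forall t s : R, 0 <= s -> s <= t -> t <= T -> bounded_op (U t s),
      forall s x, 0 <= s -> s <= T -> U s s x = x,
      forall t s r x, 0 <= r -> r <= s -> s <= t -> t <= T ->
        U t r x = U t s (U s r x)
    & forall x, {within Delta T, continuous (fun p => U p.1 p.2 x)}].

(* Derivative of [f : D -> V] at [t]: one-sided at the endpoints of an interval
   [D], and no condition when [D] is a single point. *)
Definition derivative_within (V : normedModType R[i]) (D : set R)
    (f : R -> V) (t : R) (y : V) :=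
  (fun h : R => (h^-1)%:C *: (f (t + h) - f t))
    @ within [set h | D (t + h)] 0^' --> y.

Definition classical_solution (V : normedModType R[i]) (T : R)
    (A : R -> unbounded_op V) (s : R) (x : V) (u : R -> V) :=
  (exists du : R -> V,
    [/\ {within `[s, T], continuous u}, {within `[s, T], continuous du}
      & forall t, s <= t <= T ->
          [/\ derivative_within `[s, T] u t (du t), dom (A t) (u t)
            & du t = A t (u t)]]) /\
  u s = x.

Definition solved_by (V : normedModType R[i]) (T : R)
    (A : R -> unbounded_op V) (U : R -> R -> V -> V) :=
  exists Y : R -> set V,
    [/\ forall s : R, 0 <= s <= T -> subspace (Y s) /\ dense (Y s),
        forall t s : R, 0 <= s -> s <= t -> t <= T -> U t s @` Y s `<=` Y t,
        forall t : R, 0 <= t <= T -> Y t `<=` dom (A t)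
      & forall s x, 0 <= s <= T -> Y s x ->
          classical_solution T A s x (fun t => U t s x)].

(* [W] is the restriction of [U1] to [X], seen inside [Z] through [j]; [A1 t]
   is an operator in [Z] with domain [j X]. *)
Definition extrapolated_evolution_family (X Z : normedModType R[i]) (T : R)
    (j : X -> Z) (A1 : R -> X -> Z) (U1 : R -> R -> Z -> Z) :=
  [/\ evolution_family T U1,
      exists W : R -> R -> X -> X,
        [/\ forall t s : R, 0 <= s -> s <= t -> t <= T -> bounded_op (W t s),
            forall t s x, 0 <= s -> s <= t -> t <= T ->
              U1 t s (j x) = j (W t s x),
            forall x, {within Delta T, continuous (fun p => W p.1 p.2 x)}
          & forall t s x, 0 <= s -> s <= t -> t <= T ->
              derivative_within `[s, T] (fun r => U1 r s (j x)) t
                (A1 t (W t s x))],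
      forall t s x, 0 <= s -> s <= t -> t <= T ->
        derivative_within `[0, t] (fun r => U1 t r (j x)) s
          (- U1 t s (A1 s x))
    & exists M omega : R, 1 <= M /\
        forall t s : R, 0 <= s -> s <= t -> t <= T ->
          (opnorm (U1 t s) <= (M * expR (omega * (t - s)))%:E)%E].

End Evolution.

Section Bochner.
Variable R : realType.
Local Notation mu := (@lebesgue_measure R).

Record simple_fun (V : normedModType R[i]) := SimpleFun {
  sf_size : nat;
  sf_set : 'I_sf_size -> set R;
  sf_val : 'I_sf_size -> V;
  sf_meas : forall i, measurable (sf_set i) }.

Definition sf_app (V : normedModType R[i]) (f : simple_fun V) (t : R) : V :=
  \sum_(i < sf_size f) (\1_(sf_set i) t)%:C *: sf_val i.

Definition sf_integral (V : normedModType R[i]) (D : set R)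
    (f : simple_fun V) : V :=
  \sum_(i < sf_size f) (fine (mu (sf_set i `&` D)))%:C *: sf_val i.

Definition has_bochner_integral (V : normedModType R[i]) (D : set R)
    (f : R -> V) (I : V) :=
  exists phi : nat -> simple_fun V,
    [/\ {ae mu, forall t, D t -> (fun n => sf_app (phi n) t) @ \oo --> f t},
        (fun n => \int[mu]_(t in D) (rnorm (f t - sf_app (phi n) t))%:E)%E
          @ \oo --> 0%E
      & (fun n => sf_integral D (phi n)) @ \oo --> I].

(* [f] is Bochner measurable from [D] to the Favard space: an almost everywhere
   limit, in the Favard norm, of simple functions with values in that space. *)
Definition favard_measurable (Z : normedModType R[i]) (S1 : R -> Z -> Z)
    (D : set R) (f : R -> Z) :=
  exists phi : nat -> simple_fun Z,
    (forall n i, favard S1 (@sf_val _ (phi n) i)) /\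
    {ae mu, forall t, D t ->
      (fun n => favard_norm S1 (f t - sf_app (phi n) t)) @ \oo --> 0%E}.

Definition Linfty_favard (Z : normedModType R[i]) (S1 : R -> Z -> Z)
    (D : set R) (f : R -> Z) :=
  [/\ forall t, D t -> favard S1 (f t),
      favard_measurable S1 D f
    & exists C : R,
        {ae mu, forall t, D t -> (favard_norm S1 (f t) <= C%:E)%E}].

(* [B] belongs to [L^oo([0, T], L_s(X, F_0))]. *)
Definition Linfty_strong (X Z : normedModType R[i]) (S1 : R -> Z -> Z) (T : R)
    (B : R -> X -> Z) :=
  (forall t : R, 0 <= t <= T -> linear (B t) /\
     exists C : R, forall x, (favard_norm S1 (B t x) <= (C * rnorm x)%:E)%E) /\
  forall x, Linfty_favard S1 `[0, T] (fun t => B t x).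

(* [B] belongs to [Lip([0, T], L_s(X, Z))]. *)
Definition Lip_strong (X Z : normedModType R[i]) (T : R) (B : R -> X -> Z) :=
  (forall t : R, 0 <= t <= T -> bounded_op (B t)) /\
  forall x, exists C : R, forall t s : R, 0 <= t <= T -> 0 <= s <= T ->
    rnorm (B t x - B s x) <= C * `|t - s|.

End Bochner.

(* Main.v *)
Require Import Defs.
From mathcomp Require Import all_boot all_order all_algebra.
From mathcomp Require Import complex.
From mathcomp Require Import all_classical all_reals all_analysis.
From mathcomp Require Import ring lra zify.

(** Write [Z] for the extrapolation space [X_{-1}].  A perturbation [B t] leads from
[X] to [Z], so the point is that the integrals
[int_s^t U1(t, r) B(r) v(r) dr], computed in [Z], lie in [X] and have a norm there
that is at most a constant times the integral of [|v|].  Given this, the variation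
of constants formula is a Volterra equation in [X].  It is solved by Picard
iteration in an exponentially weighted norm ([perturbation_contraction],
[mild_exists]).  Uniqueness of the solution makes it linear in the initial value
and gives the evolution property, and joint continuity follows from the evolution
property and from [V t s - U t s = O(t - s)] ([perturbed_evolution_family]).

The norm bound.  Let [P n z] be the difference quotient of the semigroup of [A 0],
with step [1/(n+1)], at the preimage of [z] under [A_{-1}(0)].  It belongs to [X],
and the [P n z] converge to [z] in [Z].  The seminorm [sup_n |P n z|_X], written
with [fav], is dominated by the Favard norm ([favard_fav]), is equivalent to the
norm of [X] on [X] ([fav_bound], [fav_norm]), is preserved by [U1] up to a constant
([fav_evol]), and passes under integrals ([fav_integral]).  In particular [X] is
closed for it ([fav_closed]), so it is enough to approximate an integral, in this
seminorm, by elements of [X].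

Membership in [X].  First let the integrand be [U1(t, r) z] with [z] in [Z] fixed,
and let [y r] be the preimage of [z] under [A_{-1}(r)].  Then the integrand is
[U1(t, r) A_{-1}(r) y(r)], and [U1(t, .) A_{-1}(.) y] is the derivative of
[- U1(t, .) y] for each fixed [y] in [X].  As [y r] is Lipschitz in [X],
summation by parts bounds the integral in [X] by the norm of [z] in [Z]
([const_integral_bound]).  If [z] is in [X] the integral clearly is, and [X] is
dense in [Z], so it is in [X] for every [z] ([const_integral_range]).  Next, for
the integrand [U1(t, r) B(r) v(r)] with [v] continuous, strong measurability of [B]
and separability of [X] provide countably many constants, one of which is
Favard-close to [B(r) v(r)] for almost every [r].  By Lusin's theorem the choice of
that constant is locally constant off a set of small measure, on which the crude
bound suffices ([integral_range]).

That [U1] extends [U] holds because [r |-> U1(t, r) u(r)] has derivative zero along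
every classical solution [u] ([evolution_restriction]).

The integrands are continuous in [Z], so their integrals are increments of
antiderivatives; these are estimated by a mean value inequality with a variable
bound ([antideriv_le_gen]), itself a compactness argument on intervals ([cousin]),
and identified with Bochner integrals in [bochner_antideriv]. *)

Import Order.TTheory GRing.Theory Num.Theory.
Import numFieldNormedType.Exports.

Set Implicit Arguments.
Unset Strict Implicit.
Unset Printing Implicit Defensive.

Local Open Scope classical_set_scope.
Local Open Scope ring_scope.
Local Open Scope complex_scope.

(** * Linear combinations and chains of inequalities *)

Section LinearCombinations.
Variables (K : comNzRingType) (V : lmodType K).

(** Two linear combinations of the same vectors are equal as soon as their
coefficients are; the tactic [lcomb_eq] reads the combinations off the goal and
leaves the comparison of coefficients to [ring]. *)
Inductive lcomb : Type :=
  | LAtom of nat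
  | LZero
  | LAdd of lcomb & lcomb
  | LOpp of lcomb
  | LScale of K & lcomb.

Fixpoint lc_eval (env : seq V) (e : lcomb) : V :=
  match e with
  | LAtom n => env`_n
  | LZero => 0
  | LAdd e1 e2 => lc_eval env e1 + lc_eval env e2
  | LOpp e1 => - lc_eval env e1
  | LScale a e1 => a *: lc_eval env e1
  end.

Fixpoint lc_coef (e : lcomb) (n : nat) : K :=
  match e with
  | LAtom m => if m == n then 1 else 0
  | LZero => 0
  | LAdd e1 e2 => lc_coef e1 n + lc_coef e2 n
  | LOpp e1 => - lc_coef e1 n
  | LScale a e1 => a * lc_coef e1 n
  end.

Lemma lc_evalE env e :
  lc_eval env e = \sum_(n < size env) lc_coef e n *: env`_n.
Proof.
elim: e => [m||e1 IH1 e2 IH2|e1 IH|a e1 IH] /=.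
- have [msz|msz] := ltnP m (size env); last first.
    rewrite nth_default // big1 // => n _.
    by case: eqP msz => [->|]; rewrite ?scale0r // leqNgt ltn_ord.
  rewrite (bigD1 (Ordinal msz)) //= eqxx scale1r big1 ?addr0 // => n.
  by rewrite -val_eqE /= eq_sym => /negbTE ->; rewrite scale0r.
- by rewrite big1 // => n _; rewrite scale0r.
- by rewrite IH1 IH2 -big_split; apply: eq_bigr => n _; rewrite scalerDl.
- by rewrite IH -sumrN; apply: eq_bigr => n _; rewrite scaleNr.
- by rewrite IH scaler_sumr; apply: eq_bigr => n _; rewrite scalerA.
Qed.

Fixpoint lc_eq_upto (N : nat) (e1 e2 : lcomb) : Prop :=
  match N with
  | 0%N => True
  | n.+1 => lc_coef e1 n = lc_coef e2 n /\ lc_eq_upto n e1 e2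
  end.

Lemma lc_eval_eq env e1 e2 :
  lc_eq_upto (size env) e1 e2 -> lc_eval env e1 = lc_eval env e2.
Proof.
rewrite !lc_evalE => h; apply: eq_bigr => -[n /= hn] _; congr (_ *: _).
elim: (size env) h hn => //= N IH [hN h]; rewrite ltnS leq_eqVlt.
by case/orP => [/eqP -> //|]; apply: IH.
Qed.

End LinearCombinations.

Ltac lc_index x env :=
  lazymatch env with
  | x :: _ => constr:(0%N)
  | _ :: ?t => let n := lc_index x t in constr:(n.+1)
  end.
Ltac lc_mem x env :=
  lazymatch env with
  | nil => constr:(false)
  | x :: _ => constr:(true)
  | _ :: ?t => lc_mem x t
  end.
Ltac lc_atoms e env :=
  lazymatch e with
  | GRing.add ?a ?b => let env1 := lc_atoms a env in lc_atoms b env1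
  | GRing.opp ?a => lc_atoms a env
  | GRing.scale _ ?a => lc_atoms a env
  | GRing.zero => env
  | ?x => lazymatch lc_mem x env with
          | true => env
          | false => constr:(x :: env)
          end
  end.
Ltac lc_reify K e env :=
  lazymatch e with
  | GRing.add ?a ?b =>
      let r1 := lc_reify K a env in let r2 := lc_reify K b env in
      constr:(@LAdd K r1 r2)
  | GRing.opp ?a => let r := lc_reify K a env in constr:(@LOpp K r)
  | GRing.scale ?c ?a => let r := lc_reify K a env in constr:(@LScale K c r)
  | GRing.zero => constr:(@LZero K)
  | ?x => let n := lc_index x env in constr:(@LAtom K n)
  end.

Ltac lcomb_eq K :=
  lazymatch goal with
  | |- @eq ?T ?x ?y =>
    let env0 := lc_atoms x (@nil T) in
    let env := lc_atoms y env0 in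
    let e1 := lc_reify K x env in
    let e2 := lc_reify K y env in
    refine (@lc_eval_eq K _ env e1 e2 _); cbn [lc_eq_upto lc_coef size eq_op];
    repeat (apply: conj; [simpl; try ring|]); try exact I
  end.

Ltac le_chain n :=
  first
    [ eassumption
    | exact: lexx
    | lazymatch n with
      | S ?m =>
        match goal with
        | H : is_true (@Order.le _ _ ?x _) |- is_true (@Order.le _ _ ?x _) =>
          apply: (le_trans H); le_chain m
        end
      end ].

(** Comparisons that follow from a chain of at most three inequalities; anything
else goes to linear arithmetic. *)
Ltac between :=
  solve
    [ repeat match goal with
      | H : is_true (_ && _) |- _ =>
          pose proof (proj1 (andP H)); pose proof (proj2 (andP H)); clear H
      | H : is_true (@Order.lt _ _ _ _) |- _ => pose proof (ltW H); clear H
      end;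
      rewrite /=; repeat (apply/andP; split); le_chain (S (S O))
    | lra ].

(** * Real-valued norms and epsilon-delta forms *)

Section RealNorm.
Context {R : realType}.

Lemma normr_rnorm (V : normedZmodType R[i]) (x : V) : `|x| = (rnorm x)%:C.
Proof.
have : `|x| \is Num.real by exact: normr_real.
by move/RRe_real => {1}<-.
Qed.

Variable V : normedModType R[i].
Implicit Types (x y : V) (r : R).

Lemma rnorm_ge0 x : 0 <= rnorm x.
Proof. by have := normr_ge0 x; rewrite normr_rnorm lecR. Qed.

Lemma rnorm0 : rnorm (0 : V) = 0.
Proof. by rewrite /rnorm normr0. Qed.

Lemma rnorm_eq0 x : rnorm x = 0 -> x = 0.
Proof. by move=> h; apply/eqP; rewrite -normr_eq0 normr_rnorm h. Qed.

Lemma rnormD x y : rnorm (x + y) <= rnorm x + rnorm y.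
Proof. by have := ler_normD x y; rewrite !normr_rnorm -rmorphD lecR. Qed.

Lemma rnormN x : rnorm (- x) = rnorm x.
Proof. by rewrite /rnorm normrN. Qed.

Lemma rnormBC x y : rnorm (x - y) = rnorm (y - x).
Proof. by rewrite -rnormN opprB. Qed.

Lemma rnormB x y : rnorm (x - y) <= rnorm x + rnorm y.
Proof. by rewrite -(rnormN y) rnormD. Qed.

Lemma rnorm_trans y x z : rnorm (x - z) <= rnorm (x - y) + rnorm (y - z).
Proof. by rewrite -{1}(subrK y x) -addrA rnormD. Qed.

Lemma rnormZ (a : R[i]) x : rnorm (a *: x) = complex.Re `|a| * rnorm x.
Proof.
have ->: complex.Re `|a| = rnorm (a : R[i]^o) by [].
by rewrite {1}/rnorm normrZ !normr_rnorm -rmorphM.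
Qed.

Lemma rnormZr r x : rnorm (r%:C *: x) = `|r| * rnorm x.
Proof. by rewrite rnormZ normc_def expr0n addr0 sqrtr_sqr. Qed.

Lemma rnorm_sum (I : Type) (s : seq I) (P : pred I) (F : I -> V) :
  rnorm (\sum_(i <- s | P i) F i) <= \sum_(i <- s | P i) rnorm (F i).
Proof.
elim/big_rec2: _ => [|i y1 y2 _ h]; first by rewrite rnorm0.
by apply: le_trans (rnormD _ _) _; rewrite lerD2l.
Qed.

Lemma ltr_rnorm x r : (`|x| < r%:C) = (rnorm x < r).
Proof. by rewrite normr_rnorm ltcR. Qed.

Lemma rcvgP {T : Type} (F : set_system T) {FF : Filter F} (f : T -> V) y :
  f @ F --> y <-> forall e : R, 0 < e -> \forall t \near F, rnorm (y - f t) < e.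
Proof.
split=> [/cvgrPdist_lt h e e0|h].
  have := h e%:C; rewrite ltcR => /(_ e0).
  by apply: filterS => t; rewrite ltr_rnorm.
apply/cvgrPdist_lt => e e0.
have eE : e = (complex.Re e)%:C by rewrite RRe_real // gtr0_real.
have Re0 : 0 < complex.Re e by rewrite -ltcR -eE.
by rewrite eE; apply: filterS (h _ Re0) => t; rewrite ltr_rnorm.
Qed.

Lemma rcvg_seqP (u : nat -> V) y :
  (u @ \oo --> y) <->
  forall e : R, 0 < e -> exists N, forall n, (N <= n)%N -> rnorm (u n - y) < e.
Proof.
split=> [/rcvgP h e e0|h]; last apply/rcvgP => e e0.
  by have [N _ hN] := h e e0; exists N => n /hN; rewrite rnormBC.
have [N hN] := h e e0; exists N => //= n Nn; rewrite rnormBC; exact: hN.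
Qed.

Lemma rcvg_unique (u : nat -> V) y z :
  (forall e : R, 0 < e -> exists N, forall n, (N <= n)%N -> rnorm (u n - y) < e) ->
  (forall e : R, 0 < e -> exists N, forall n, (N <= n)%N -> rnorm (u n - z) < e) ->
  y = z.
Proof.
move=> hy hz; apply/eqP; rewrite -subr_eq0; apply/eqP/rnorm_eq0.
apply/eqP; rewrite eq_le rnorm_ge0 andbT; apply/ler_addgt0Pr => e e0.
have e2 : 0 < e / 2 by lra.
have [N hN] := hy _ e2; have [M hM] := hz _ e2.
have := hN (maxn N M) (leq_maxl _ _); have := hM (maxn N M) (leq_maxr _ _).
have := rnorm_trans (u (maxn N M)) y z; rewrite (rnormBC y (u _)); lra.
Qed.

Lemma ball_rnorm x (r : R) : 0 < r -> ball x r%:C = [set y | rnorm (x - y) < r].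
Proof.
by move=> r0; rewrite -ball_normE; apply/seteqP; split=> y /=; rewrite ltr_rnorm.
Qed.

Lemma dense_rnormP (D : set V) :
  dense D <-> forall x (e : R), 0 < e -> exists2 y, D y & rnorm (x - y) < e.
Proof.
split=> [dD x e e0|h O [x Ox] oO].
  have e0' : 0 < e%:C by rewrite ltcR.
  have [||y []] := dD (ball x e%:C).
  - by exists x; apply: ballxx.
  - exact: ball_open.
  by rewrite ball_rnorm // => hy Dy; exists y.
have [e /= e0 he] := (@nbhs_ballP _ _ x O).1 (open_nbhs_nbhs (conj oO Ox)).
have eE : e = (complex.Re e)%:C by rewrite RRe_real // gtr0_real.
have Re0 : 0 < complex.Re e by rewrite -ltcR -eE.
have [y Dy xy] := h x _ Re0; exists y; split=> //.
by apply: he; rewrite eE ball_rnorm.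
Qed.

End RealNorm.

Section Functions.
Context {R : realType}.
Implicit Types V W : normedModType R[i].

Definition cont_on V (D : set R) (f : R -> V) :=
  forall x, D x -> forall e : R, 0 < e -> exists2 d : R, 0 < d &
    forall y, D y -> `|y - x| < d -> rnorm (f y - f x) < e.

Lemma within2_cont V (D : set (R * R)) (f : R * R -> V) :
  {within D, continuous f} <->
  forall t s, D (t, s) -> forall e : R, 0 < e -> exists2 d : R, 0 < d &
    forall t' s', D (t', s') -> `|t' - t| < d -> `|s' - s| < d ->
      rnorm (f (t', s') - f (t, s)) < e.
Proof.
rewrite subspace_continuousP; split=> h.
  move=> t s Dx e e0; have /rcvgP/(_ _ e0) := h (t, s) Dx.
  case/nbhs_ballP => d /= d0 hd; exists d => // t' s' Dy tt ss.
  rewrite rnormBC; apply: hd => //.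
  by split => /=; rewrite -ball_normE /= distrC.
move=> [t s] Dx.
apply/rcvgP => e e0; have [d d0 hd] := h t s Dx e e0.
apply/nbhs_ballP; exists d => //= -[t' s'] [/=].
rewrite -!ball_normE /= ![`|t - _|]distrC ![`|s - _|]distrC => tt ss Dy.
by rewrite rnormBC; apply: hd.
Qed.

Lemma additive_lin V W (f : V -> W) : linear f ->
  [/\ f 0 = 0, {morph f : x y / x + y}, {morph f : x y / x - y},
      forall a x, f (a *: x) = a *: f x & {morph f : x / - x}].
Proof.
move=> lf.
have f0 : f 0 = 0.
  have := lf 1 0 0; rewrite !scale1r addr0 => /eqP.
  by rewrite -subr_eq0 opprD addNKr oppr_eq0 => /eqP.
have fD : {morph f : x y / x + y}.
  by move=> x y; have := lf 1 x y; rewrite !scale1r.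
have fZ a x : f (a *: x) = a *: f x by have := lf a x 0; rewrite f0 !addr0.
have fN : {morph f : x / - x} by move=> x; rewrite -scaleN1r fZ scaleN1r.
by split=> // x y; rewrite fD fN.
Qed.

Lemma lin_sum V W (f : V -> W) (I : Type) (s : seq I) (P : pred I) (F : I -> V) :
  linear f -> f (\sum_(i <- s | P i) F i) = \sum_(i <- s | P i) f (F i).
Proof. by move=> /additive_lin[f0 fD _ _ _]; apply: big_morph. Qed.

Definition rbounded V W (f : V -> W) := linear f /\
  exists2 C : R, 0 <= C & forall x, rnorm (f x) <= C * rnorm x.

Lemma bounded_opP V W (f : V -> W) : bounded_op f <-> rbounded f.
Proof.
split=> -[lf]; have [f0 fD fB fZ fN] := additive_lin lf; last first.
  case=> C C0 hC; split=> // x; apply/rcvgP => e e0.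
  have Ce : 0 < e / (C + 1) by rewrite divr_gt0 //; lra.
  apply/nbhs_ballP; exists (e / (C + 1))%:C; first by rewrite /= ltcR.
  move=> y; rewrite ball_rnorm //= => xy.
  rewrite -fB; apply: le_lt_trans (hC _) _.
  move: xy; rewrite ltr_pdivlMr; last lra.
  move=> h; apply: le_lt_trans h; rewrite mulrC ler_wpM2l ?rnorm_ge0 //; lra.
move=> cf; split=> //.
have /rcvgP/(_ 1 ltr01) := cf 0.
case/nbhs_ballP => d /= d0 hd.
have dE : d = (complex.Re d)%:C by rewrite RRe_real // gtr0_real.
move: d0 hd; rewrite dE; set r := complex.Re d; rewrite ltcR => r0.
rewrite (ball_rnorm _ r0) => hd.
exists (2 / r); first by rewrite divr_ge0 //; between.
move=> x; have [/rnorm_eq0 ->|x0] := eqVneq (rnorm x) 0.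
  by rewrite f0 !rnorm0 mulr0.
have {}x0 : 0 < rnorm x by rewrite lt_neqAle eq_sym x0 rnorm_ge0.
pose c := r / (2 * rnorm x).
have c0 : 0 < c by rewrite divr_gt0 // mulr_gt0.
have := hd (c%:C *: x); rewrite /= sub0r rnormN rnormZr gtr0_norm // => /(_ _).
rewrite f0 sub0r rnormN fZ rnormZr gtr0_norm // => /(_ _).
have cx : c * rnorm x = r / 2 by rewrite /c; field; rewrite gt_eqF.
rewrite cx => /(_ ltac:(lra)) h.
have -> : 2 / r * rnorm x = c^-1 by rewrite /c; field; rewrite !gt_eqF.
by rewrite -[leLHS](mulKf (lt0r_neq0 c0)) ger_pMr ?invr_gt0 // ltW.
Qed.

End Functions.

(** * Completeness and uniform boundedness *)

Lemma small_factor (R : realType) (c e : R) : 0 <= c -> 0 < e ->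
  exists2 d : R, 0 < d & c * d <= e.
Proof.
move=> c0 e0; exists (e / (c + 1)); first by rewrite divr_gt0 //; lra.
by rewrite mulrA ler_pdivrMr; [nra | lra].
Qed.

Lemma ler_mul_len (R : realType) (c x y : R) : 0 <= c -> x <= y -> 0 <= c * (y - x).
Proof. by move=> c0 xy; rewrite mulr_ge0 ?subr_ge0. Qed.

Section Complete.
Context {R : realType}.

Lemma rcauchy_cvg (V : completeNormedModType R[i]) (u : nat -> V) :
  (forall e : R, 0 < e -> exists N, forall n m, (N <= n)%N -> (N <= m)%N ->
     rnorm (u n - u m) < e) ->
  exists l, forall e : R, 0 < e -> exists N, forall n, (N <= n)%N ->
    rnorm (u n - l) < e.
Proof.
move=> cu; suff /cauchy_cvg : cauchy (u @ \oo).
  by move=> /cvg_ex[l /rcvg_seqP ul]; exists l.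
apply: cauchy_exP => e e0.
have eE : e = (complex.Re e)%:C by rewrite RRe_real // gtr0_real.
have Re0 : 0 < complex.Re e by rewrite -ltcR -eE.
have [N hN] := cu _ Re0.
exists (u N); rewrite eE ball_rnorm //.
by exists N => //= n Nn; apply: hN.
Qed.

Lemma half_lt (r e : R) : 0 <= r -> 0 < e -> exists n : nat, r / 2 ^+ n < e.
Proof.
move=> r0 e0; have [n hn] : exists n : nat, r / e < n%:R.
  exists (Num.bound (r / e)); apply: archi_boundP.
  by rewrite divr_ge0 // ltW.
exists n; rewrite ltr_pdivrMr ?exprn_gt0 //.
rewrite ltr_pdivrMr // in hn; apply: (lt_le_trans hn).
by rewrite mulrC ler_pM2l // -natrX ler_nat ltnW // ltn_expl.
Qed.

(** Gliding hump: if the bound failed, balls with fast decreasing radii could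
be nested so that on the [n]-th ball some operator of the family exceeds [n],
and their common point would contradict pointwise boundedness. *)
Lemma uniform_boundedness (V : completeNormedModType R[i])
    (W : normedModType R[i]) (I : Type) (f : I -> V -> W) :
  (forall i, rbounded (f i)) ->
  (forall x, exists C : R, forall i, rnorm (f i x) <= C) ->
  exists2 C : R, 0 <= C & forall i x, rnorm (f i x) <= C * rnorm x.
Proof.
move=> bf pf; apply/not_exists2P => nb.
have step (n : nat) (p : V * R) : exists q : V * R, 0 < p.2 ->
    [/\ 0 < q.2, q.2 <= p.2 / 2, rnorm (q.1 - p.1) <= p.2 &
        exists i, forall y, rnorm (y - q.1) <= 2 * q.2 -> n%:R <= rnorm (f i y)].
  case: p => x r /=; have [r0|] := boolP (0 < r); last by exists 0.
  have C0 : 0 <= (n%:R + 1) / r :> R by rewrite divr_ge0 ?addr_ge0 // ltW.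
  have [//|] := nb ((n%:R + 1) / r).
  move=> /existsNP -[k] /existsNP -[u] /negP; rewrite -ltNge => hu.
  have [lf [D D0 hD]] := bf k; have [f0 fD fB fZ _] := additive_lin lf.
  have u0 : 0 < rnorm u.
    rewrite lt_neqAle rnorm_ge0 andbT eq_sym; apply/eqP => /rnorm_eq0 u0.
    by move: hu; rewrite u0 f0 !rnorm0 mulr0 ltxx.
  pose v := (r / rnorm u)%:C *: u.
  have rv : rnorm v = r.
    by rewrite rnormZr gtr0_norm ?divr_gt0 // divfK // gt_eqF.
  have fv : n%:R + 1 < rnorm (f k v).
    rewrite fZ rnormZr gtr0_norm ?divr_gt0 // mulrAC ltr_pdivlMr //.
    by move: hu; rewrite mulrAC ltr_pdivrMr // [_ * r]mulrC.
  have [w hw hfw] : exists2 w, rnorm (w - x) <= r & n%:R + 1 < rnorm (f k w).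
    have := rnormB (f k (x + v)) (f k (x - v)); rewrite -fB.
    rewrite opprD opprK addrACA subrr add0r fD.
    have -> : f k v + f k v = 2%:C *: f k v.
      by rewrite (_ : 2%:C = 1 + 1) ?scalerDl ?scale1r // -rmorphD.
    rewrite rnormZr ger0_norm // => h.
    have [h1|h1] := ltP (n%:R + 1) (rnorm (f k (x + v))).
      by exists (x + v) => //; rewrite [x + v]addrC addrK rv.
    exists (x - v); last lra.
    by rewrite [x - v]addrC addrK rnormN rv.
  (* The radius is chosen so that [f k] varies by at most [1] on the next ball. *)
  exists (w, Num.min (r / 2) (2 * (D + 1))^-1) => _ /=.
  have D1 : 0 < (2 * (D + 1))^-1 by rewrite invr_gt0; lra.
  split=> //.
  - by rewrite lt_min D1 divr_gt0.
  - by rewrite ge_min lexx.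
  exists k => y hy.
  have {}hy : rnorm (f k y - f k w) <= 1.
    rewrite -fB; apply: le_trans (hD _) _.
    have : rnorm (y - w) <= (D + 1)^-1.
      apply: le_trans hy _; rewrite -ler_pdivlMl // -invfM.
      by rewrite ge_min lexx orbT.
    move=> /(ler_wpM2l D0)/le_trans; apply.
    by rewrite ler_pdivrMr; lra.
  have := rnorm_trans (f k y) (f k w) 0; rewrite !subr0 rnormBC; lra.
have [g hg] := choice (fun np : nat * (V * R) => step np.1 np.2).
pose s := fix s (n : nat) : V * R := if n is m.+1 then g (m, s m) else (0, 1).
have s0 n : 0 < (s n).2.
  by elim: n => [|n IH] //=; have [] := hg (n, s n) IH.
have sS n := hg (n, s n) (s0 n).
have r2 n : (s n).2 <= 1 / 2 ^+ n.
  elim: n => [|n IH]; first by rewrite expr0 divr1.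
  have [_ h _ _] := sS n; apply: le_trans h _ => /=.
  by rewrite exprSr invfM mulrA ler_pM2r.
have near_ n k : rnorm ((s (n + k)%N).1 - (s n).1) <= 2 * (s n).2 - 2 * (s (n + k)%N).2.
  elim: k => [|k IH]; first by rewrite addn0 !subrr rnorm0.
  rewrite addnS; have [_ h1 h2 _] := sS (n + k)%N.
  have := rnorm_trans (s (n + k)%N).1 (s (n + k).+1).1 (s n).1.
  rewrite /= in h1 h2 *; lra.
have cauchy_ n m : (n <= m)%N -> rnorm ((s m).1 - (s n).1) <= 2 * (s n).2.
  move=> /subnKC <-; apply: le_trans (near_ _ _) _.
  by rewrite gerBl mulr_ge0 // ltW.
have [|x hx] := @rcauchy_cvg V (fun n => (s n).1).
  move=> e e0; have [N hN] := half_lt (ler0n R 4) e0.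
  exists N => n m Nn Nm /=.
  have := rnorm_trans (s N).1 (s n).1 (s m).1.
  have := cauchy_ _ _ Nn; have := cauchy_ _ _ Nm.
  rewrite (rnormBC (s N).1); have := r2 N.
  move: hN; set z := (2 ^+ N)^-1; lra.
have xs n : rnorm (x - (s n).1) <= 2 * (s n).2.
  apply/ler_addgt0Pr => e e0; have [N hN] := hx e e0.
  have := rnorm_trans (s (maxn n N)).1 x (s n).1.
  have := hN (maxn n N) (leq_maxr _ _); have := cauchy_ _ _ (leq_maxl n N).
  rewrite (rnormBC x (s (maxn n N)).1); lra.
have [C hC] := pf x.
have [n hn] : exists n : nat, C < n%:R.
  exists (Num.bound (`|C|)); apply: le_lt_trans (ler_norm _) _.
  exact: archi_boundP.
have [_ _ _ [i hi]] := sS n.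
have := hi x (xs n.+1); have := hC i; lra.
Qed.

End Complete.

(** * Antiderivatives and the mean value inequality *)

Section Antiderivative.
Context {R : realType}.
Implicit Types V W : normedModType R[i].

(** Compactness of a segment, for properties of intervals: additive and local
properties are global. *)
Lemma cousin (P : R -> R -> Prop) (a b : R) : a <= b ->
  (forall x y z, a <= x -> x <= y -> y <= z -> z <= b ->
     P x y -> P y z -> P x z) ->
  (forall c, a <= c <= b -> exists2 d : R, 0 < d &
     forall x y, a <= x -> x <= c -> c <= y -> y <= b -> y - x < d -> P x y) ->
  P a b.
Proof.
move=> ab Padd Ploc.
pose E := [set y | a <= y <= b /\ P a y].
have Ea : E a.
  split; first by rewrite lexx.
  have [|d d0 hd] := Ploc a; first by rewrite lexx.
  by apply: hd => //; rewrite subrr.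
have ubE : ubound E b by move=> y [/andP[]].
have supE : has_sup E by split; [exists a | exists b].
set c := sup E.
have ac : a <= c by apply: ub_le_sup => //; exists b.
have cb : c <= b by apply: ge_sup => //; exists a.
have [|d d0 hd] := Ploc c; first by rewrite ac cb.
have [y [/andP[ay yb] Pay] cy] := sup_adherent d0 supE.
have yc : y <= c by apply: ub_le_sup => //; [exists b | split=> //; rewrite ay].
have Pac : P a c.
  by apply: (Padd a y c) => //; apply: hd => //; move: cy; rewrite -/c; lra.
move: cb; rewrite le_eqVlt => /orP[/eqP <- //|cb].
pose z := Num.min b (c + d / 2).
have cz : c < z by rewrite lt_min cb; lra.
have zb : z <= b by rewrite ge_min lexx.
have zd : z <= c + d / 2 by rewrite ge_min lexx orbT.
have Paz : P a z.
  by apply: (Padd a c z) => //; [lra|]; apply: hd => //; lra.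
suff : z <= c by lra.
by apply: ub_le_sup; [exists b|split=> //; apply/andP; split=> //; between].
Qed.

(** For each [e], [cousin] applies to the inequality with the additive error
[e * (y - x)]. *)
Lemma increment_le V (F : R -> V) (k : R -> R -> R) (a b : R) : a <= b ->
  (forall x y z, a <= x -> x <= y -> y <= z -> z <= b ->
     k x y + k y z <= k x z) ->
  (forall c, a <= c <= b -> forall e, 0 < e -> exists2 d : R, 0 < d &
     forall x y, a <= x -> x <= c -> c <= y -> y <= b -> y - x < d ->
       rnorm (F y - F x) <= k x y + e * (y - x)) ->
  rnorm (F b - F a) <= k a b.
Proof.
move=> ab kadd kloc; apply/ler_addgt0Pr => e e0.
have e0' : 0 < e / (b - a + 1) by rewrite divr_gt0 //; lra.
suff : rnorm (F b - F a) <= k a b + e / (b - a + 1) * (b - a).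
  move=> /le_trans; apply; rewrite lerD2l mulrAC ler_pdivrMr; last lra.
  by rewrite ler_pM2l //; lra.
move: (e / _) e0' => {e0}e e0.
apply: (cousin (P := fun x y => rnorm (F y - F x) <= k x y + e * (y - x))) => //.
  move=> x y z ax xy yz zb h1 h2.
  have := rnorm_trans (F y) (F z) (F x); have := kadd x y z ax xy yz zb.
  by have -> : e * (z - x) = e * (y - x) + e * (z - y); [ring | lra].
by move=> c cab; exact: kloc.
Qed.

(** Differentiability within [[a, b]], with a one-sided derivative at the
endpoints, stated without division so that it can be fed to [increment_le]. *)
Definition antideriv V (a b : R) (F f : R -> V) :=
  forall x, a <= x <= b -> forall e : R, 0 < e -> exists2 d : R, 0 < d &
    forall y, a <= y <= b -> `|y - x| < d ->
      rnorm (F y - F x - (y - x)%:C *: f x) <= e * `|y - x|.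

Lemma antideriv_straddle V a b (F f : R -> V) : antideriv a b F f ->
  forall c, a <= c <= b -> forall e : R, 0 < e -> exists2 d : R, 0 < d &
    forall x y, a <= x -> x <= c -> c <= y -> y <= b -> y - x < d ->
      rnorm (F y - F x - (y - x)%:C *: f c) <= e * (y - x).
Proof.
move=> Ff c cab e e0; have [d d0 hd] := Ff c cab e e0; exists d => // x y.
move=> ax xc cy yb yx.
have := hd x; rewrite ler0_norm; last lra.
move=> /(_ ltac:(lra) ltac:(lra)) h1.
have := hd y; rewrite ger0_norm; last lra.
move=> /(_ ltac:(lra) ltac:(lra)) h2.
have -> : F y - F x - (y - x)%:C *: f c =
  (F y - F c - (y - c)%:C *: f c) - (F x - F c - (x - c)%:C *: f c).
  by lcomb_eq R[i].
apply: le_trans (rnormB _ _) _.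
by have -> : e * (y - x) = e * (y - c) + e * (- (x - c)); [ring | lra].
Qed.

Lemma antideriv_sub V a b a' b' (F f : R -> V) : a <= a' -> b' <= b ->
  antideriv a b F f -> antideriv a' b' F f.
Proof.
move=> aa bb Ff x xab e e0; have [|d d0 hd] := Ff x _ e e0; first between.
by exists d => // y yab; apply: hd; between.
Qed.

Lemma antideriv_lin V a b (F f G g : R -> V) (c : R[i]) :
  antideriv a b F f -> antideriv a b G g ->
  antideriv a b (fun x => c *: F x + G x) (fun x => c *: f x + g x).
Proof.
move=> Ff Gg x xab e e0.
set C := complex.Re `|c|.
have C0 : 0 <= C by have := rnorm_ge0 (c : R[i]^o).
have [|d d0 hd] := Ff x xab (e / 2 / (C + 1)).
  by rewrite !divr_gt0 //; lra.
have [|d' d'0 hd'] := Gg x xab (e / 2); first lra.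
exists (Num.min d d'); first by rewrite lt_min d0 d'0.
move=> y yab; rewrite lt_min => /andP[yx yx'].
have -> : c *: F y + G y - (c *: F x + G x) - (y - x)%:C *: (c *: f x + g x) =
   c *: (F y - F x - (y - x)%:C *: f x) + (G y - G x - (y - x)%:C *: g x).
  by lcomb_eq R[i].
apply: le_trans (rnormD _ _) _; rewrite rnormZ -/C.
have -> : e * `|y - x| = C / (C + 1) * (e / 2 * `|y - x|) +
    (1 / (C + 1)) * (e / 2 * `|y - x|) + e / 2 * `|y - x|.
  by field; apply/eqP; lra.
have h2 := hd' y yab yx'.
have h1 : C * rnorm (F y - F x - (y - x)%:C *: f x) <=
    C / (C + 1) * (e / 2 * `|y - x|).
  rewrite -!mulrA ler_wpM2l //; apply: le_trans (hd y yab yx) _.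
  by rewrite le_eqVlt; apply/orP; left; apply/eqP; field; apply/eqP; lra.
have h3 : 0 <= 1 / (C + 1) * (e / 2 * `|y - x|).
  by rewrite !mulr_ge0 ?invr_ge0 //; lra.
lra.
Qed.

Lemma antideriv_op V W (L : V -> W) a b (F f : R -> V) : rbounded L ->
  antideriv a b F f -> antideriv a b (L \o F) (L \o f).
Proof.
move=> [lL [C C0 hC]] Ff x xab e e0; have [L0 LD LB LZ _] := additive_lin lL.
have [|d d0 hd] := Ff x xab (e / (C + 1)); first by rewrite !divr_gt0 //; lra.
exists d => // y yab yx /=; rewrite -LB -LZ -LB.
apply: le_trans (hC _) _; apply: le_trans (ler_wpM2l C0 (hd y yab yx)) _.
rewrite !mulrA ler_wpM2r // ler_pdivrMr; [nra | lra].
Qed.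

Lemma antideriv_ext V a b (F f g : R -> V) :
  (forall x, a <= x <= b -> f x = g x) ->
  antideriv a b F f -> antideriv a b F g.
Proof. by move=> fg Ff x xab; rewrite -(fg x xab); apply: Ff. Qed.

(** The mean value inequality, in the form that lets the bound on the integrand
vary: [k] plays the role of the integral of [r], which is only required to
dominate it from below near each point. *)
Lemma antideriv_le_gen V (F f : R -> V) (r : R -> R) (k : R -> R -> R) a b :
  a <= b -> antideriv a b F f ->
  (forall x y z, a <= x -> x <= y -> y <= z -> z <= b ->
     k x y + k y z <= k x z) ->
  (forall c, a <= c <= b -> rnorm (f c) <= r c) ->
  (forall c, a <= c <= b -> forall e, 0 < e -> exists2 d : R, 0 < d &
     forall x y, a <= x -> x <= c -> c <= y -> y <= b -> y - x < d ->
       (y - x) * r c <= k x y + e * (y - x)) ->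
  rnorm (F b - F a) <= k a b.
Proof.
move=> ab Ff kadd fr rk; apply: increment_le => // c cab e e0.
have e20 : 0 < e / 2 by lra.
have [d d0 hd] := antideriv_straddle Ff cab e20.
have [d' d'0 hd'] := rk c cab _ e20.
exists (Num.min d d'); first by rewrite lt_min d0 d'0.
move=> x y ax xc cy yb; rewrite lt_min => /andP[yx yx'].
have h1 := hd x y ax xc cy yb yx; have h2 := hd' x y ax xc cy yb yx'.
have := rnorm_trans ((y - x)%:C *: f c) (F y - F x) 0.
rewrite !subr0 rnormZr ger0_norm; last lra.
have : (y - x) * rnorm (f c) <= (y - x) * r c.
  by rewrite ler_wpM2l ?fr //; lra.
have -> : e * (y - x) = e / 2 * (y - x) + e / 2 * (y - x) by field.
lra.
Qed.

Lemma antideriv_le V (F f : R -> V) (K : R) a b :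
  a <= b -> antideriv a b F f ->
  (forall c, a <= c <= b -> rnorm (f c) <= K) ->
  rnorm (F b - F a) <= K * (b - a).
Proof.
move=> ab Ff fK.
apply: (antideriv_le_gen (r := fun=> K) (k := fun x y => K * (y - x)) ab Ff) => //.
  by move=> x y z _ _ _ _; rewrite le_eqVlt; apply/orP; left; apply/eqP; ring.
move=> c cab e e0; exists 1 => // x y _ xc cy _ _.
by rewrite mulrC lerDl mulr_ge0; lra.
Qed.

Lemma antideriv_uniq V (F G f : R -> V) a b : a <= b ->
  antideriv a b F f -> antideriv a b G f -> F b - F a = G b - G a.
Proof.
move=> ab Ff Gf; apply/eqP; rewrite -subr_eq0; apply/eqP/rnorm_eq0.
apply/eqP; rewrite eq_le rnorm_ge0 andbT.
have := antideriv_lin (-1) Gf Ff.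
move=> /(antideriv_le (K := 0) ab); rewrite mul0r => /(_ _).
rewrite (_ : _ - _ = F b - F a - (G b - G a)); last by lcomb_eq R[i].
by apply=> c _; rewrite scaleN1r addNr rnorm0.
Qed.

End Antiderivative.

(** * Existence of antiderivatives *)

Section Existence.
Context {R : realType}.

(** Heine's theorem, for oscillations below a fixed [e]; that the property is additive
uses continuity at the common endpoint. *)
Lemma uniformly_continuous (V : normedModType R[i]) (a b : R) (f : R -> V) :
  a <= b -> cont_on [set x | a <= x <= b] f ->
  forall e : R, 0 < e -> exists2 d : R, 0 < d &
    forall u v, a <= u <= b -> a <= v <= b -> `|u - v| < d ->
      rnorm (f u - f v) < e.
Proof.
move=> ab cf e e0.
have e20 : 0 < e / 2 by lra.
pose P x y := exists2 d : R, 0 < d &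
    forall u v, x <= u <= y -> x <= v <= y -> `|u - v| < d ->
      rnorm (f u - f v) < e.
apply: (cousin (P := P)) => //; last first.
  move=> c cab; have [d d0 hd] := cf c cab _ e20; exists d => // x y ax xc cy yb yx.
  exists d => // u v xuy xvy _.
  have near_c w : x <= w <= y -> rnorm (f w - f c) < e / 2.
    by move=> xwy; apply: hd; [move=> /=; lra | rewrite ltr_norml; lra].
  have := rnorm_trans (f c) (f u) (f v); rewrite (rnormBC (f c)).
  have := near_c u xuy; have := near_c v xvy; lra.
move=> x y z ax xy yz zb [d1 d10 h1] [d2 d20 h2].
have [|d d0 hd] := cf y _ _ e20; first by move=> /=; between.
exists (Num.min d (Num.min d1 d2)); first by rewrite !lt_min d0 d10 d20.
have across u v : x <= u <= y -> y <= v <= z -> `|u - v| < d ->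
    rnorm (f u - f v) < e.
  move=> hu hv; rewrite ltr_norml => /andP[uv1 uv2].
  have := rnorm_trans (f y) (f u) (f v); rewrite (rnormBC (f y)).
  have hu' : rnorm (f u - f y) < e / 2.
    by apply: hd; [move=> /=; lra | rewrite ltr_norml; lra].
  have hv' : rnorm (f v - f y) < e / 2.
    by apply: hd; [move=> /=; lra | rewrite ltr_norml; lra].
  lra.
move=> u v hu hv; rewrite !lt_min => /and3P[uv uv1 uv2].
have [uy|yu] := leP u y; have [vy|yv] := leP v y.
- by apply: h1 => //; between.
- by apply: across => //; between.
- by rewrite rnormBC; apply: across; rewrite 1?distrC //; between.
- by apply: h2 => //; between.
Qed.

(** The grid overshoots [b] so that its half-open cells cover [[a, b]] and have
positive length even when [a = b]. *)
Definition mesh (a b : R) (n : nat) : R := (b - a + 1) / n.+1%:R.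
Definition grid (a b : R) (n i : nat) : R := a + mesh a b n * i%:R.

Lemma mesh_gt0 (a b : R) n : a <= b -> 0 < mesh a b n.
Proof. by move=> ab; rewrite divr_gt0 //; lra. Qed.

Lemma mesh_small (a b e : R) : a <= b -> 0 < e ->
  exists N, forall n, (N <= n)%N -> mesh a b n < e.
Proof.
move=> ab e0.
have ba : 0 <= (b - a + 1) / e by rewrite divr_ge0 //; lra.
exists (Num.bound ((b - a + 1) / e)) => n Nn.
rewrite ltr_pdivrMr // -ltr_pdivrMl // mulrC.
apply: lt_le_trans (archi_boundP ba) _.
by rewrite ler_nat (leq_trans Nn).
Qed.

Lemma gridS (a b : R) n k : grid a b n k.+1 = grid a b n k + mesh a b n.
Proof. by rewrite /grid -natr1; ring. Qed.

Lemma grid_ge (a b : R) n k : a <= b -> a <= grid a b n k.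
Proof. by move=> ab; rewrite lerDl mulr_ge0 // ltW // mesh_gt0. Qed.

Lemma grid_last (a b : R) n : grid a b n n.+1 = b + 1.
Proof. by rewrite /grid /mesh divfK ?pnatr_eq0 //; ring. Qed.

Section Sums.
Variable V : normedModType R[i].
Implicit Types f : R -> V.

Lemma min_increment_ge0 (x y p q : R) : x <= y -> p <= q ->
  0 <= (Num.min y q - Num.min y p) - (Num.min x q - Num.min x p).
Proof. by rewrite /Num.min => xy pq; do !case: ltP => ? //; lra. Qed.

Definition grid_val (a b : R) n f (k : nat) : V := f (Num.min (grid a b n k) b).

Definition grid_sum (a b : R) n f (x : R) : V :=
  \sum_(k < n.+1)
    (Num.min x (grid a b n k.+1) - Num.min x (grid a b n k))%:C *:
    grid_val a b n f k.

(** [grid_sum] is the integral from [a] to [x] of a step function.  Its increments over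
a short interval around [c] are close to those of [f c]; as the estimate does not
involve the number of cells, two grid sums are close to each other as well. *)
Lemma grid_sum_straddle (a b : R) n f (e d : R) : a <= b -> 0 <= e ->
  (forall u v, a <= u <= b -> a <= v <= b -> `|u - v| < d ->
     rnorm (f u - f v) < e) ->
  mesh a b n < d / 2 ->
  forall x c y, a <= x -> x <= c -> c <= y -> y <= b -> y - x < d / 2 ->
  rnorm (grid_sum a b n f y - grid_sum a b n f x - (y - x)%:C *: f c) <=
    e * (y - x).
Proof.
move=> ab e0 uc md x c y ax xc cy yb yx.
have m0 := mesh_gt0 n ab.
pose w (k : nat) := (Num.min y (grid a b n k.+1) - Num.min y (grid a b n k)) -
   (Num.min x (grid a b n k.+1) - Num.min x (grid a b n k)).
have w0 k : 0 <= w k.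
  by apply: min_increment_ge0; [lra | rewrite gridS; lra].
have wE : \sum_(k < n.+1) w k = y - x.
  rewrite -(big_mkord xpredT w) sumrB !telescope_sumr // grid_last /grid mulr0.
  rewrite addr0 (min_l (y := b + 1)) 1?(min_l (x := x) (y := b + 1)); [|lra..].
  by rewrite !min_r; lra.
have -> : grid_sum a b n f y - grid_sum a b n f x - (y - x)%:C *: f c =
    \sum_(k < n.+1) (w k)%:C *: (grid_val a b n f k - f c).
  rewrite -wE rmorph_sum scaler_suml -!sumrB; apply: eq_bigr => k _.
  by rewrite /w; lcomb_eq R[i].
apply: le_trans (rnorm_sum _ _ _) _; rewrite -wE mulr_sumr.
apply: ler_sum => k _; rewrite rnormZr ger0_norm // mulrC.
have [->|wn0] := eqVneq (w k) 0; first by rewrite !mulr0.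
rewrite ler_wpM2r //.
have gy : grid a b n k <= y.
  rewrite leNgt; apply: contraNN wn0 => yg.
  by rewrite /w gridS !min_l ?subrr //; lra.
have xg : x <= grid a b n k + mesh a b n.
  rewrite leNgt; apply: contraNN wn0 => gx.
  by rewrite /w gridS !min_r ?subrr //; lra.
have ga := grid_ge n k ab.
rewrite /grid_val min_l; last between.
by apply/ltW/uc; rewrite ?ltr_norml; lra.
Qed.

Lemma antideriv_grid (a b : R) n f F (e d : R) : a <= b -> 0 <= e ->
  (forall u v, a <= u <= b -> a <= v <= b -> `|u - v| < d ->
     rnorm (f u - f v) < e) ->
  mesh a b n < d / 2 -> antideriv a b F f ->
  rnorm (F b - F a - (grid_sum a b n f b - grid_sum a b n f a)) <= e * (b - a).
Proof.
move=> ab e0 uc md Ff.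
pose G x := F x - grid_sum a b n f x.
have := increment_le (F := G) (k := fun x y => e * (y - x)) ab.
have -> : G b - G a = F b - F a - (grid_sum a b n f b - grid_sum a b n f a).
  by rewrite /G; lcomb_eq R[i].
apply; first by move=> x y z *; rewrite -mulrDr; lra.
move=> c cab e' e'0.
have [d' d'0 hd'] := antideriv_straddle Ff cab e'0.
have d0 : 0 < d / 2 by have := mesh_gt0 n ab; lra.
exists (Num.min (d / 2) d'); first by rewrite lt_min d0.
move=> x y ax xc cy yb; rewrite lt_min => /andP[yx yx'].
have h1 := grid_sum_straddle ab e0 uc md ax xc cy yb yx.
have h2 := hd' x y ax xc cy yb yx'.
have -> : G y - G x = (F y - F x - (y - x)%:C *: f c) -
   (grid_sum a b n f y - grid_sum a b n f x - (y - x)%:C *: f c).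
  by rewrite /G; lcomb_eq R[i].
by apply: le_trans (rnormB _ _) _; rewrite addrC lerD.
Qed.

End Sums.

(** The grid sums converge: by [grid_sum_straddle] the difference of two of them has
locally small increments, hence is small. *)
Theorem antideriv_exists (V : completeNormedModType R[i]) (a b : R)
    (f : R -> V) : a <= b -> cont_on [set x | a <= x <= b] f ->
  exists F, antideriv a b F f.
Proof.
move=> ab cf; have ucf := uniformly_continuous ab cf.
pose G n x := grid_sum a b n f x.
have straddle e : 0 < e -> exists2 d : R, 0 < d & exists N, forall n, (N <= n)%N ->
    forall x c y, a <= x -> x <= c -> c <= y -> y <= b -> y - x < d ->
    rnorm (G n y - G n x - (y - x)%:C *: f c) <= e * (y - x).
  move=> e0; have [d d0 hd] := ucf e e0.
  have d20 : 0 < d / 2 by lra.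
  have [N hN] := mesh_small ab d20; exists (d / 2) => //; exists N => n Nn x c y.
  exact: grid_sum_straddle (ltW e0) hd (hN n Nn) _ _ _.
have G0 n : G n a = 0.
  rewrite /G /grid_sum big1 // => k _.
  by rewrite !min_l ?grid_ge // subrr scale0r.
have cauchyG x : a <= x <= b -> forall e : R, 0 < e -> exists N, forall n m,
    (N <= n)%N -> (N <= m)%N -> rnorm (G n x - G m x) < e.
  move=> xab e e0.
  have e0' : 0 < e / 2 / (b - a + 1) by rewrite !divr_gt0 //; lra.
  have [d d0 [N hN]] := straddle _ e0'; exists N => n m Nn Nm.
  have ax : a <= x by between.
  have := increment_le (F := fun x => G n x - G m x)
    (k := fun x y => 2 * (e / 2 / (b - a + 1)) * (y - x)) ax.
  rewrite !G0 !subr0 => h.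
  apply: le_lt_trans (h _ _) _.
  - by move=> u v w *; rewrite -mulrDr; lra.
  - move=> c cax e' e'0; exists d => // u y au uc cy yx yu.
    have -> : G n y - G m y - (G n u - G m u) = (G n y - G n u - (y - u)%:C *: f c) -
      (G m y - G m u - (y - u)%:C *: f c) by lcomb_eq R[i].
    apply: le_trans (rnormB _ _) _.
    have h1 := hN n Nn u c y au uc cy ltac:(between) yu.
    have h2 := hN m Nm u c y au uc cy ltac:(between) yu.
    have h3 : 0 <= e' * (y - u) by rewrite mulr_ge0; lra.
    by rewrite -mulrA mulr_natl mulr2n; lra.
  - have -> : 2 * (e / 2 / (b - a + 1)) * (x - a) = e * (x - a) / (b - a + 1).
      by field; apply/eqP; lra.
    by rewrite ltr_pdivrMr ?ltr_pM2l; lra.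
have /choice[F hF] : forall x, exists l, a <= x <= b -> forall e : R, 0 < e ->
    exists N, forall n, (N <= n)%N -> rnorm (G n x - l) < e.
  move=> x; have [xab|] := boolP (a <= x <= b); last by exists 0.
  by have [l hl] := rcauchy_cvg (cauchyG x xab); exists l.
exists F => x xab e e0; have [d d0 [N hN]] := straddle e e0.
exists d => // y yab yx; apply/ler_addgt0Pr => e' e'0.
have e'2 : 0 < e' / 2 by lra.
have [Nx hx] := hF x xab _ e'2; have [Ny hy] := hF y yab _ e'2.
pose n := maxn N (maxn Nx Ny).
have {}hx : rnorm (G n x - F x) < e' / 2 by apply: hx; rewrite /n !leq_max leqnn ?orbT.
have {}hy : rnorm (G n y - F y) < e' / 2 by apply: hy; rewrite /n !leq_max leqnn ?orbT.
have {}hN : rnorm (G n y - G n x - (y - x)%:C *: f x) <= e * `|y - x|.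
  have [xy|xy] := leP x y.
    rewrite ger0_norm in yx *; [|lra..].
    by apply: hN; rewrite ?leq_maxl //; between.
  rewrite ltr0_norm in yx *; [|lra..].
  have -> : G n y - G n x - (y - x)%:C *: f x =
     - (G n x - G n y - (x - y)%:C *: f x) by lcomb_eq R[i].
  by rewrite rnormN opprB; apply: hN; rewrite ?leq_maxl //; lra.
have -> : F y - F x - (y - x)%:C *: f x =
  (G n y - G n x - (y - x)%:C *: f x) + ((G n x - F x) - (G n y - F y)).
  by lcomb_eq R[i].
apply: le_trans (rnormD _ _) _; apply: lerD hN _.
by apply: le_trans (rnormB _ _) _; lra.
Qed.

End Existence.

(** * Bochner integrals of continuous functions *)

Section BochnerRiemann.
Context {R : realType}.
Local Notation mu := (@lebesgue_measure R).
Variable V : normedModType R[i].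
Implicit Types f : R -> V.

(** Holds for arbitrary functions, since the integral of a nonnegative function is a
supremum over the simple functions below it. *)
Lemma ge0_integral_mono (D : set R) (f g : R -> \bar R) :
  (forall x, D x -> (0 <= f x)%E) -> (forall x, D x -> (f x <= g x)%E) ->
  (\int[mu]_(x in D) f x <= \int[mu]_(x in D) g x)%E.
Proof.
move=> f0 fg; rewrite !ge0_integralE //; last first.
  by move=> x Dx; apply: le_trans (fg x Dx); apply: f0.
apply: le_ereal_sup => _ [h /= hf <-]; exists h => // x.
apply: le_trans (hf x) _; rewrite /patch; case: ifPn => // /set_mem; exact: fg.
Qed.

Definition grid_cell (a b : R) n k : set R :=
  [set` `[grid a b n k, grid a b n k.+1[].

Lemma measurable_grid_cell (a b : R) n k : measurable (grid_cell a b n k).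
Proof. exact: measurable_itv. Qed.

Definition grid_fun (a b : R) n f : simple_fun V :=
  @SimpleFun R V n.+1 (grid_cell a b n) (grid_val a b n f)
    (measurable_grid_cell a b n).

Lemma measure_grid_cell (a b : R) n k : a <= b ->
  fine (mu (grid_cell a b n k `&` `[a, b])) =
  Num.min b (grid a b n k.+1) - Num.min b (grid a b n k).
Proof.
move=> ab; have ga := grid_ge n k ab; have m0 := mesh_gt0 n ab.
have gS := gridS a b n k.
have [gb|bg] := leP (grid a b n k) b; last first.
  rewrite [X in mu X](_ : _ = set0) ?measure0 ?subrr /=; last first.
    by rewrite -subset0 => x []; rewrite /grid_cell /= !in_itv /=; lra.
  by rewrite min_l ?subrr //; lra.
have [gb'|bg'] := leP (grid a b n k.+1) b.
  rewrite [X in mu X](_ : _ = [set` `[grid a b n k, grid a b n k.+1[]); last first.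
    apply/seteqP; split=> x; rewrite /grid_cell /= !in_itv /=; first by case.
    by move=> h; split; lra.
  by rewrite lebesgue_measure_itv /= lte_fin ifT //; lra.
rewrite [X in mu X](_ : _ = [set` `[grid a b n k, b]]); last first.
  apply/seteqP; split=> x; rewrite /grid_cell /= !in_itv /=; first by case; lra.
  by move=> h; split; lra.
rewrite lebesgue_measure_itv /= lte_fin; case: ifP => //= /negbT.
by rewrite -leNgt; lra.
Qed.

Lemma grid_fun_integral (a b : R) n f : a <= b ->
  sf_integral `[a, b] (grid_fun a b n f) = grid_sum a b n f b.
Proof.
move=> ab; apply: eq_bigr => k _ /=.
by rewrite measure_grid_cell.
Qed.

Lemma grid_fun_close (a b : R) n f (e d : R) : a <= b ->
  (forall u v, a <= u <= b -> a <= v <= b -> `|u - v| < d ->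
     rnorm (f u - f v) < e) ->
  mesh a b n < d -> forall x, a <= x <= b ->
  rnorm (f x - sf_app (grid_fun a b n f) x) <= e.
Proof.
move=> ab uc md x xab.
have m0 := mesh_gt0 n ab.
pose w (k : nat) : R := \1_(grid_cell a b n k) x.
have wE k : w k = (grid a b n k <= x)%R%:R - (grid a b n k.+1 <= x)%R%:R.
  rewrite /w indicE /grid_cell mem_setE in_itv /= gridS.
  by case: leP => h1; case: leP => h2 /=; lra.
have w1 : \sum_(k < n.+1) w k = 1.
  rewrite -(big_mkord xpredT w) (eq_bigr _ (fun k _ => wE k)).
  rewrite -[LHS]opprK -sumrN (eq_bigr _ (fun k _ => opprB _ _)).
  rewrite telescope_sumr // grid_last /grid mulr0 addr0.
  by case: leP => h1; case: leP => h2 /=; lra.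
have -> : f x - sf_app (grid_fun a b n f) x =
   \sum_(k < n.+1) (w k)%:C *: (f x - grid_val a b n f k).
  rewrite -[f x in LHS]scale1r -[1](rmorph1 (real_complex R)) -w1 rmorph_sum.
  rewrite scaler_suml /sf_app /= -sumrB; apply: eq_bigr => k _.
  by rewrite scalerBr.
apply: le_trans (rnorm_sum _ _ _) _.
have -> : e = \sum_(k < n.+1) w k * e by rewrite -mulr_suml w1 mul1r.
apply: ler_sum => k _; rewrite rnormZr /w indicE.
have [/set_mem|_] := boolP (x \in _); last by rewrite normr0 !mul0r.
rewrite /grid_cell /= in_itv /= gridS normr1 !mul1r => hx.
have ga := grid_ge n k ab.
by rewrite /grid_val min_l; [apply/ltW/uc; rewrite ?ltr_norml|]; lra.
Qed.

(** The grid step functions converge uniformly to [f], hence in mean, and their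
integrals are the grid sums. *)
Theorem bochner_antideriv (a b : R) (F f : R -> V) : a <= b ->
  cont_on [set x | a <= x <= b] f -> antideriv a b F f ->
  has_bochner_integral `[a, b] f (F b - F a).
Proof.
move=> ab cf Ff; have uc := uniformly_continuous ab cf.
have close e : 0 < e -> exists N, forall n, (N <= n)%N ->
    forall x, a <= x <= b -> rnorm (f x - sf_app (grid_fun a b n f) x) <= e.
  move=> e0; have [d d0 hd] := uc e e0.
  have [N hN] := mesh_small ab d0; exists N => n Nn x xab.
  exact: grid_fun_close hd (hN n Nn) _ xab.
exists (fun n => grid_fun a b n f); split.
- apply: aeW => x; rewrite /= in_itv /= => xab.
  apply/rcvg_seqP => e e0; have e20 : 0 < e / 2 by lra.
  have [N hN] := close _ e20; exists N => n Nn.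
  by rewrite rnormBC; have := hN n Nn x xab; lra.
- apply/fine_cvgP.
  have bound e : 0 < e -> exists N, forall n, (N <= n)%N ->
    (0 <= \int[mu]_(x in `[a, b]) (rnorm (f x - sf_app (grid_fun a b n f) x))%:E
       <= (e * (b - a))%:E)%E.
    move=> e0; have [N hN] := close _ e0; exists N => n Nn.
    apply/andP; split.
      by apply: integral_ge0 => x _; rewrite lee_fin rnorm_ge0.
    have -> : (e * (b - a))%:E = (\int[mu]_(x in `[a, b]) (cst e%:E x))%E.
      rewrite integral_cst //= lebesgue_measure_itv /= lte_fin EFinM.
      case: ltP => // ba; congr (_ * _)%E; congr (_%:E); lra.
    apply: ge0_integral_mono => x.
      by move=> _; rewrite lee_fin rnorm_ge0.
    by rewrite /= in_itv /= lee_fin => xab; exact: hN.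
  have fine_ x (r : R) : (0 <= x <= r%:E)%E -> x \is a fin_num.
    case/andP=> x0 xr; rewrite ge0_fin_numE //; apply: le_lt_trans xr _.
    exact: ltry.
  split.
    by have [N hN] := bound 1 ltr01; exists N => // n /hN /fine_.
  apply/cvgrPdist_le => e e0.
  have e'0 : 0 < e / (b - a + 1) by rewrite divr_gt0 //; lra.
  have [N hN] := bound _ e'0; exists N => // n /hN h.
  have fi := fine_ _ _ h; rewrite sub0r normrN /=.
  move: h; rewrite -(fineK fi) !lee_fin => /andP[h0 h1].
  rewrite ger0_norm //; apply: le_trans h1 _.
  by rewrite mulrAC ler_pdivrMr; [nra | lra].
- apply/rcvg_seqP => e e0.
  have e'0 : 0 < e / (b - a + 1) by rewrite divr_gt0 //; lra.
  have [d d0 hd] := uc _ e'0; have d20 : 0 < d / 2 by lra.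
  have [N hN] := mesh_small ab d20; exists N => n Nn.
  have := antideriv_grid ab (ltW e'0) hd (hN n Nn) Ff.
  rewrite grid_fun_integral // rnormBC.
  have -> : grid_sum a b n f a = 0.
    rewrite /grid_sum big1 // => k _.
    by rewrite !min_l ?grid_ge // subrr scale0r.
  rewrite subr0 => /le_lt_trans; apply.
  by rewrite mulrAC ltr_pdivrMr; [nra | lra].
Qed.

End BochnerRiemann.

(** * The Favard seminorm *)

Section Favard.
Context {R : realType}.
Variables X Z : completeNormedModType R[i].
Variable j : X -> Z.
Hypothesis j_bounded : rbounded j.
Variable P : nat -> Z -> X.
Hypothesis P_bounded : forall n, rbounded (P n).
Hypothesis P_jK : forall x (e : R), 0 < e ->
  exists N, forall n, (N <= n)%N -> rnorm (P n (j x) - x) < e.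
Hypothesis j_PK : forall z (e : R), 0 < e ->
  exists N, forall n, (N <= n)%N -> rnorm (j (P n z) - z) < e.

(** When the [P n] are difference quotients of a semigroup, this is the bound [r] on
the Favard norm of [w], measured in [X] along a sequence of step sizes. *)
Definition fav (r : R) (w : Z) := forall n, rnorm (P n w) <= r.

Lemma favP_lim (u : nat -> R) (l C : R) :
  (forall e, 0 < e -> exists N, forall n, (N <= n)%N -> l <= u n + e) ->
  (forall n, u n <= C) -> l <= C.
Proof.
move=> ul uC; apply/ler_addgt0Pr => e e0; have [N hN] := ul e e0.
by apply: le_trans (hN N (leqnn _)) _; rewrite lerD2r.
Qed.

Lemma fav_bound : exists2 C : R, 0 <= C &
  forall x, fav (C * rnorm x) (j x).
Proof.
have [||C C0 hC] := @uniform_boundedness R X X nat (fun n x => P n (j x)).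
- move=> n; have [lj [C C0 hC]] := j_bounded.
  have [lP [D D0 hD]] := P_bounded n; split.
    by move=> a x y; rewrite lj lP.
  exists (D * C); first exact: mulr_ge0.
  move=> x; apply: le_trans (hD _) _; rewrite -mulrA.
  exact: ler_wpM2l.
- move=> x; have [N hN] := P_jK x ltr01.
  pose B := \sum_(n < N) rnorm (P n (j x)).
  exists (B + (rnorm x + 1)) => n; have [nN|Nn] := ltnP n N.
    apply: (@le_trans _ _ B); last first.
      by rewrite lerDl addr_ge0 ?rnorm_ge0.
    rewrite /B (bigD1 (Ordinal nN)) //= lerDl sumr_ge0 // => k _.
    exact: rnorm_ge0.
  have B0 : 0 <= B by apply: sumr_ge0 => k _; exact: rnorm_ge0.
  have := rnorm_trans x (P n (j x)) 0; have := hN n Nn; rewrite !subr0; lra.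
by exists C => // x n.
Qed.

(** [P n (j x)] converges to [x] in [X]. *)
Lemma fav_norm r x : fav r (j x) -> rnorm x <= r.
Proof.
move=> fx; apply: favP_lim fx => e e0; have [N hN] := P_jK x e0.
exists N => n Nn; have := rnorm_trans (P n (j x)) x 0.
by rewrite !subr0 (rnormBC x); have := hN n Nn; lra.
Qed.

Lemma fav_le r s w : r <= s -> fav r w -> fav s w.
Proof. by move=> rs fw n; apply: le_trans (fw n) rs. Qed.

Lemma favD r s w v : fav r w -> fav s v -> fav (r + s) (w + v).
Proof.
move=> fw fv n; have [lP _] := P_bounded n; have [_ -> _ _ _] := additive_lin lP.
exact: le_trans (rnormD _ _) (lerD (fw n) (fv n)).
Qed.

Lemma favN r w : fav r w -> fav r (- w).
Proof.
move=> fw n; have [lP _] := P_bounded n; have [_ _ _ _ ->] := additive_lin lP.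
by rewrite rnormN.
Qed.

Lemma favB r s w v : fav r w -> fav s v -> fav (r + s) (w - v).
Proof. by move=> fw fv; apply: favD => //; apply: favN. Qed.

Lemma fav_lim r w : (forall e, 0 < e -> exists2 v, fav r v & rnorm (w - v) < e) ->
  fav r w.
Proof.
move=> wv n; have [lP [C C0 hC]] := P_bounded n.
have [_ _ PB _ _] := additive_lin lP.
apply/ler_addgt0Pr => e e0.
have [|v fv hv] := wv (e / (C + 1)); first by rewrite divr_gt0 //; lra.
have := rnorm_trans (P n v) (P n w) 0; rewrite !subr0 -PB.
have := hC (w - v); have := fv n.
have : C * rnorm (w - v) <= e.
  have : C * rnorm (w - v) <= C * (e / (C + 1)) by rewrite ler_wpM2l // ltW.
  by move/le_trans; apply; rewrite mulrA ler_pdivrMr; [nra | lra].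
lra.
Qed.

(** [w] is the limit in [Z] of the [j (P n w)]. *)
Lemma fav0_eq0 w : (forall e, 0 < e -> fav e w) -> w = 0.
Proof.
have [lj _] := j_bounded; have [j0 _ _ _ _] := additive_lin lj.
move=> fw; have P0 n : P n w = 0.
  apply/rnorm_eq0/eqP; rewrite eq_le rnorm_ge0 andbT.
  by apply/ler_addgt0Pr => e e0; rewrite add0r; apply: fw.
apply/rnorm_eq0/eqP; rewrite eq_le rnorm_ge0 andbT.
apply/ler_addgt0Pr => e e0; have [N hN] := j_PK w e0.
by have := hN N (leqnn _); rewrite P0 j0 sub0r rnormN; lra.
Qed.

Lemma j_inj x y : j x = j y -> x = y.
Proof.
have [lj _] := j_bounded; have [j0 _ jB _ _] := additive_lin lj.
move=> xy; apply/eqP; rewrite -subr_eq0; apply/eqP/rnorm_eq0/eqP.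
rewrite eq_le rnorm_ge0 andbT; apply: fav_norm => n.
have [lP _] := P_bounded n; have [P0 _ _ _ _] := additive_lin lP.
by rewrite jB xy subrr P0 rnorm0.
Qed.

(** The image of [X] is closed for the Favard seminorm, because that seminorm
is equivalent to the norm of the complete space [X] there. *)
Lemma fav_closed w : (forall e, 0 < e -> exists u, fav e (w - j u)) ->
  exists u, w = j u.
Proof.
have [lj [Cj Cj0 hCj]] := j_bounded; have [j0 _ jB _ _] := additive_lin lj.
move=> wu; have [C C0 hC] := fav_bound.
have /choice[u hu] : forall n : nat, exists u, fav (1 / 2 ^+ n) (w - j u).
  by move=> n; apply: wu; rewrite divr_gt0 ?exprn_gt0.
have near_ n m : rnorm (u n - u m) <= 1 / 2 ^+ n + 1 / 2 ^+ m.
  apply: fav_norm; rewrite jB addrC.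
  have -> : j (u n) - j (u m) = (w - j (u m)) - (w - j (u n)) by lcomb_eq R[i].
  exact: favB.
have half_mono n m : (n <= m)%N -> 1 / 2 ^+ m <= 1 / 2 ^+ n :> R.
  by move=> nm; rewrite ler_pM2l // lef_pV2 ?posrE ?exprn_gt0 // ler_eXn2l // ltr1n.
have [|l hl] := @rcauchy_cvg R X u.
  move=> e e0; have e2 : 0 < e / 2 by lra.
  have [N hN] := half_lt (@ler01 R) e2.
  exists N => n m Nn Nm; have := near_ n m.
  have := half_mono _ _ Nn; have := half_mono _ _ Nm; lra.
exists l; apply/eqP; rewrite -subr_eq0; apply/eqP/fav0_eq0 => e e0.
have e2 : 0 < e / 2 by lra.
have [N hN] := half_lt (@ler01 R) e2.
have e2C : 0 < e / 2 / (C + 1) by rewrite divr_gt0 //; lra.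
have [M hM] := hl _ e2C; pose n := maxn N M.
have -> : w - j l = (w - j (u n)) + j (u n - l) by rewrite jB; lcomb_eq R[i].
apply: fav_le (favD (hu n) (hC _)).
have h1 : 1 / 2 ^+ n < e / 2 by apply: le_lt_trans hN; apply: half_mono; exact: leq_maxl.
have h2 : C * rnorm (u n - l) <= e / 2.
  have h3 : rnorm (u n - l) < e / 2 / (C + 1) by apply: hM; exact: leq_maxr.
  apply: le_trans (ler_wpM2l C0 (ltW h3)) _.
  by rewrite mulrA ler_pdivrMr; [nra | lra].
lra.
Qed.

(** [V1 w] is a limit in [Z] of the vectors [V1 (j (P n w)) = j (V (P n w))], which are
bounded in [X]. *)
Lemma fav_op (V : X -> X) (V1 : Z -> Z) (C M : R) :
  0 <= C -> (forall x, fav (C * rnorm x) (j x)) ->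
  (forall x, rnorm (V x) <= M * rnorm x) -> 0 <= M ->
  rbounded V1 -> (forall x, V1 (j x) = j (V x)) ->
  forall r w, fav r w -> fav (C * M * r) (V1 w).
Proof.
move=> C0 hC hM M0 [lV1 [D D0 hD]] V1j r w fw.
have [_ _ VB _ _] := additive_lin lV1.
apply: fav_lim => e e0.
have [|N hN] := j_PK w (_ : 0 < e / (D + 1)); first by rewrite divr_gt0 //; lra.
exists (V1 (j (P N w))).
  rewrite V1j; apply: fav_le (hC _); rewrite -mulrA ler_wpM2l //.
  by apply: le_trans (hM _) _; rewrite ler_wpM2l.
rewrite -VB; apply: le_lt_trans (hD _) _; rewrite rnormBC.
have := hN N (leqnn _); rewrite ltr_pdivlMr; last lra.
by have := rnorm_ge0 (j (P N w) - w); nra.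
Qed.

(** The bound on an integral in the Favard seminorm: apply the mean value
inequality to the [X]-valued functions [P n \o F]. *)
Lemma fav_integral (F f : R -> Z) (r : R -> R) (k : R -> R -> R) a b :
  a <= b -> antideriv a b F f ->
  (forall x y z, a <= x -> x <= y -> y <= z -> z <= b ->
     k x y + k y z <= k x z) ->
  (forall c, a <= c <= b -> fav (r c) (f c)) ->
  (forall c, a <= c <= b -> forall e, 0 < e -> exists2 d : R, 0 < d &
     forall x y, a <= x -> x <= c -> c <= y -> y <= b -> y - x < d ->
       (y - x) * r c <= k x y + e * (y - x)) ->
  fav (k a b) (F b - F a).
Proof.
move=> ab Ff kadd fr rk n.
have [lP _] := P_bounded n; have [_ _ -> _ _] := additive_lin lP.
apply: (antideriv_le_gen (F := P n \o F) (f := P n \o f) (r := r) (k := k)) => //.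
  exact: antideriv_op.
by move=> c cab; apply: fr.
Qed.

Lemma fav_integral_le (F f : R -> Z) (K : R) a b :
  a <= b -> antideriv a b F f -> (forall c, a <= c <= b -> fav K (f c)) ->
  fav (K * (b - a)) (F b - F a).
Proof.
move=> ab Ff fK.
apply: (fav_integral (r := fun=> K) (k := fun x y => K * (y - x)) ab Ff) => //.
  by move=> x y z *; rewrite le_eqVlt; apply/orP; left; apply/eqP; ring.
move=> c cab e e0; exists 1 => // x y _ xc cy _ _.
by rewrite mulrC lerDl mulr_ge0; lra.
Qed.

End Favard.

(** * Evolution families *)

Section EvolutionFamily.
Context {R : realType}.
Variables (V : completeNormedModType R[i]) (T : R) (U : R -> R -> V -> V).
Hypothesis evolU : evolution_family T U.

Lemma Delta_compact (t : R) : compact (Delta t).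
Proof.
apply: (@subclosed_compact _ _ (`[0, t]%classic `*` `[0, t]%classic)).
- have -> : Delta t = [set p | 0 <= p.2] `&`
      ([set p | 0 <= p.1 - p.2] `&` [set p | p.1 <= t]).
    apply/seteqP; split=> -[x y]; rewrite /Delta /= subr_ge0.
      by move=> [-> /andP[-> ->]].
    by move=> [-> [-> ->]].
  apply: closedI; last apply: closedI.
  + apply: (@closed_comp _ _ (fun p : R * R => p.2) [set y | 0 <= y]).
      by move=> p _; exact: cvg_snd.
    exact: closed_ge.
  + apply: (@closed_comp _ _ (fun p : R * R => p.1 - p.2) [set y | 0 <= y]).
      by move=> p _; apply: cvgB; [exact: cvg_fst | exact: cvg_snd].
    exact: closed_ge.
  + apply: (@closed_comp _ _ (fun p : R * R => p.1) [set y | y <= t]).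
      by move=> p _; exact: cvg_fst.
    exact: closed_le.
- by apply: compact_setX; exact: segment_compact.
- by move=> [x y] [/= ? /andP[? ?]]; split; rewrite /= in_itv /=; between.
Qed.

Lemma evol_cont x t s : 0 <= s -> s <= t -> t <= T ->
  forall e : R, 0 < e -> exists2 d : R, 0 < d &
    forall t' s', 0 <= s' -> s' <= t' -> t' <= T ->
      `|t' - t| < d -> `|s' - s| < d -> rnorm (U t' s' x - U t s x) < e.
Proof.
move=> s0 st tT e e0; have [_ _ _ /(_ x)/within2_cont cU] := evolU.
have Dts : Delta T (t, s) by split=> //=; rewrite st.
have [d d0 hd] := cU t s Dts e e0.
exists d => // t' s' ? ? ? tt ss; apply: hd => //; split=> //=.
by apply/andP; split.
Qed.

Lemma evol_lin t s : 0 <= s -> s <= t -> t <= T -> linear (U t s).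
Proof. by move=> s0 st tT; have [/(_ t s s0 st tT)[]] := evolU. Qed.

Lemma evol_id s x : 0 <= s -> s <= T -> U s s x = x.
Proof. by have [_ + _ _] := evolU; apply. Qed.

Lemma evol_comp t s r x : 0 <= r -> r <= s -> s <= t -> t <= T ->
  U t r x = U t s (U s r x).
Proof. by have [_ _ + _] := evolU; apply. Qed.

Lemma evol_bounded : exists2 M : R, 0 <= M & forall t s x,
  0 <= s -> s <= t -> t <= T -> rnorm (U t s x) <= M * rnorm x.
Proof.
pose I := {p : R * R | Delta T p}.
have [bU _ _ cU] := evolU.
have [||M M0 hM] := @uniform_boundedness R V V I
  (fun p => U (sval p).1 (sval p).2).
- move=> [[t s] [/= s0 /andP[st tT]]] /=; apply/bounded_opP.
  exact: bU.
- move=> x; have [D0|D0] := pselect (Delta T !=set0); last first.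
    by exists 0 => -[p Dp]; case: D0; exists p.
  have [|c Dc hc] := compact_EVT_max (f := fun p => rnorm (U p.1 p.2 x)) D0
    (@Delta_compact T).
    apply/subspace_continuousP => -[t s] Dts.
    apply/cvgrPdist_lt => e e0.
    have /within2_cont/(_ t s Dts e e0)[d d0 hd] := cU x.
    apply/nbhs_ballP; exists d => //= -[t' s'] [/=].
    rewrite -!ball_normE /= ![`|t - _|]distrC ![`|s - _|]distrC => tt ss Dy.
    apply: le_lt_trans (hd t' s' Dy tt ss).
    rewrite ler_norml /=.
    have := rnorm_trans (U t' s' x) (U t s x) 0.
    have := rnorm_trans (U t s x) (U t' s' x) 0.
    by rewrite !subr0 (rnormBC (U t s x)); lra.
  by exists (rnorm (U c.1 c.2 x)) => -[p Dp] /=; apply: hc; apply/mem_set.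
exists M => // t s x s0 st tT.
have Dts : Delta T (t, s) by split=> //=; rewrite st.
exact: (hM (exist _ (t, s) Dts)).
Qed.

(** Joint strong continuity and uniform boundedness give continuity of the
integrands of all variation of constants integrals. *)
Lemma evol_cont_on (t a b : R) (v : R -> V) : 0 <= a -> b <= t -> t <= T ->
  cont_on [set x | a <= x <= b] v ->
  cont_on [set x | a <= x <= b] (fun r => U t r (v r)).
Proof.
move=> a0 bt tT cv r /= rab e e0.
have [M M0 hM] := evol_bounded.
have e2 : 0 < e / 2 by lra.
have eM : 0 < e / 2 / (M + 1) by rewrite divr_gt0 //; lra.
have [|||d d0 hd] := @evol_cont (v r) t r _ _ _ _ e2; [between..|].
have [d' d'0 hd'] := cv r rab _ eM.
exists (Num.min d d'); first by rewrite lt_min d0.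
move=> y /= yab; rewrite lt_min => /andP[yr yr'].
have := rnorm_trans (U t y (v r)) (U t y (v y)) (U t r (v r)).
have [_ _ <- _ _] := additive_lin (@evol_lin t y ltac:(between) ltac:(between) ltac:(between)).
have h1 := hM t y (v y - v r) ltac:(between) ltac:(between) ltac:(between).
have h2 : M * rnorm (v y - v r) <= e / 2.
  apply: le_trans (ler_wpM2l M0 (ltW (hd' y yab yr'))) _.
  by rewrite mulrA ler_pdivrMr; [nra | lra].
have := hd t y ltac:(between) ltac:(between) ltac:(between).
rewrite subrr normr0 => /(_ d0 yr); lra.
Qed.

Lemma evol_rbounded t s : 0 <= s -> s <= t -> t <= T -> rbounded (U t s).
Proof. by move=> s0 st tT; apply/bounded_opP; have [+ _ _ _] := evolU; apply. Qed.

End EvolutionFamily.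

(** * Constant integrands *)

Section ConstantIntegrand.
Context {R : realType}.
Variables X Z : completeNormedModType R[i].
Variable j : X -> Z.
Hypothesis j_bounded : rbounded j.
Variable P : nat -> Z -> X.
Hypothesis P_bounded : forall n, rbounded (P n).
Hypothesis P_jK : forall x (e : R), 0 < e ->
  exists N, forall n, (N <= n)%N -> rnorm (P n (j x) - x) < e.
Hypothesis j_PK : forall z (e : R), 0 < e ->
  exists N, forall n, (N <= n)%N -> rnorm (j (P n z) - z) < e.
Variables (T : R) (U : R -> R -> X -> X) (U1 : R -> R -> Z -> Z).
Hypotheses (evolU : evolution_family T U) (evolU1 : evolution_family T U1).
Hypothesis U1_j : forall t s x, 0 <= s -> s <= t -> t <= T ->
  U1 t s (j x) = j (U t s x).

Lemma fav_evol : exists2 C : R, 0 <= C & forall t s r w,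
  0 <= s -> s <= t -> t <= T -> fav P r w -> fav P (C * r) (U1 t s w).
Proof.
have [C C0 hC] := fav_bound j_bounded P_bounded P_jK.
have [M M0 hM] := evol_bounded evolU.
exists (C * M); first exact: mulr_ge0.
move=> t s r w s0 st tT.
apply: (fav_op P_bounded j_PK C0 hC (V := U t s)) => //.
- by move=> x; apply: hM.
- exact: (evol_rbounded evolU1).
- by move=> x; apply: U1_j.
Qed.

Variable a : R -> X -> Z.
Variables kappa L : R.
Hypotheses (kappa_ge0 : 0 <= kappa) (L_ge0 : 0 <= L).
Hypothesis a_lin : forall t, 0 <= t <= T -> linear (a t).
Hypothesis a_surj : forall t z, 0 <= t <= T -> exists x, a t x = z.
Hypothesis a_le : forall t x, 0 <= t <= T -> rnorm (a t x) <= kappa * rnorm x.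
Hypothesis a_ge : forall t x, 0 <= t <= T -> rnorm x <= kappa * rnorm (a t x).
Hypothesis a_Lip : forall t s x, 0 <= t <= T -> 0 <= s <= T ->
  rnorm (a t x - a s x) <= L * `|t - s| * rnorm x.
Hypothesis U1_deriv : forall t x, 0 <= t <= T ->
  antideriv 0 t (fun s => U1 t s (j x)) (fun s => - U1 t s (a s x)).

(** The identity [a t (y t - y s) = (a s - a t) (y s)], with [y] the preimages of a
fixed [z], turns the Lipschitz bound on [a] into one on its inverses. *)
Lemma inverse_Lip : exists Y : R -> Z -> X,
  [/\ forall t z, 0 <= t <= T -> a t (Y t z) = z,
      forall t z, 0 <= t <= T -> rnorm (Y t z) <= kappa * rnorm z
    & forall t s z, 0 <= t <= T -> 0 <= s <= T ->
       rnorm (Y t z - Y s z) <= kappa * L * kappa * `|t - s| * rnorm z].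
Proof.
have /choice[Y hY] : forall tz : R * Z, exists x, 0 <= tz.1 <= T -> a tz.1 x = tz.2.
  move=> [t z] /=; have [tT|] := boolP (0 <= t <= T); last by exists 0.
  by have [x hx] := a_surj z tT; exists x.
exists (fun t z => Y (t, z)).
have aY t z : 0 <= t <= T -> a t (Y (t, z)) = z by exact: (hY (t, z)).
have Yle t z : 0 <= t <= T -> rnorm (Y (t, z)) <= kappa * rnorm z.
  by move=> tT; rewrite -{2}(aY t z tT); exact: a_ge.
split=> // t s z tT sT; apply: le_trans (a_ge _ tT) _.
have [_ _ aB _ _] := additive_lin (a_lin tT).
rewrite aB aY // -{1}(aY s z sT) -!mulrA ler_wpM2l //.
apply: le_trans (a_Lip _ sT tT) _; rewrite distrC -mulrA ler_wpM2l //.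
by rewrite mulrCA ler_wpM2l ?normr_ge0 //; exact: Yle.
Qed.

(** With [y s] the preimage of [z] under [a s], the integrand is
[U1 t s (a s (y s))], and on a short interval where [y] is nearly constant its
integral is nearly [j (U t s (y s) - U t s' (y s))].  Summing by parts, these
approximations stay bounded in [X], since [y] is Lipschitz in [X]; only the norm
of [z] in [Z] enters the bound. *)
Lemma const_integral_bound : exists2 C : R, 0 <= C & forall t x y z F,
  0 <= x -> x <= y -> y <= t -> t <= T ->
  antideriv x y F (fun s => U1 t s z) -> fav P (C * rnorm z) (F y - F x).
Proof.
have [Y [aY Y_le Y_Lip]] := inverse_Lip.
have [C C0 hC] := fav_bound j_bounded P_bounded P_jK.
have [M M0 hM] := evol_bounded evolU.
have [M1 M10 hM1] := evol_bounded evolU1.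
have [lj _] := j_bounded; have [j0 jD jB _ _] := additive_lin lj.
move: (kappa * L * kappa) (mulr_ge0 (mulr_ge0 kappa_ge0 L_ge0) kappa_ge0) Y_Lip.
move=> Lam Lam0 Y_Lip.
pose B t := M * (2 * kappa + Lam * t).
exists (C * B `|T|).
  by rewrite mulr_ge0 // mulr_ge0 // addr_ge0 // mulr_ge0.
move=> t x y z F x0 xy yt tT Ff.
have T0 : `|T| = T by rewrite ger0_norm; lra.
rewrite T0; pose w := rnorm z; have w0 : 0 <= w := rnorm_ge0 z.
(* [Rs N] is the telescoping sum over [N] cells of equal length. *)
pose s (N k : nat) : R := x + (y - x) / N%:R * k%:R.
pose Rs N : X := \sum_(k < N) (U t (s N k) (Y (s N k) z) -
   U t (s N k.+1) (Y (s N k) z)).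
have sS N k : s N k.+1 = s N k + (y - x) / N%:R.
  by rewrite /s -natr1; ring.
have s_in N k : (k <= N)%N -> x <= s N k <= y.
  case: N => [|N] kN; first by move: kN; rewrite leqn0 => /eqP ->; rewrite /s mulr0 addr0 lexx.
  have h0 : 0 <= (y - x) / N.+1%:R * k%:R by rewrite !mulr_ge0 ?invr_ge0 //; lra.
  have h1 : (y - x) / N.+1%:R * k%:R <= y - x.
    rewrite mulrAC ler_pdivrMr // ler_wpM2l ?ler_nat //; lra.
  by rewrite /s; move: h0 h1; set u := _ * _; lra.
have sN N : s N.+1 N.+1 = y by rewrite /s divfK ?pnatr_eq0 //; ring.
have s0 N : s N 0%N = x by rewrite /s mulr0 addr0.
have s_lt N k : (k < N)%N -> (y - x) / N%:R >= 0 by move=> _; rewrite mulr_ge0 ?invr_ge0 //; lra.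
have Rs_le N : rnorm (Rs N.+1) <= B T * w.
  have -> : Rs N.+1 = U t x (Y x z) - U t y (Y y z) +
     \sum_(k < N.+1) (U t (s N.+1 k.+1) (Y (s N.+1 k.+1) z - Y (s N.+1 k) z)).
    rewrite -[in RHS](s0 N.+1) -(sN N).
    pose g k := U t (s N.+1 k) (Y (s N.+1 k) z).
    rewrite -[U t (s N.+1 0%N) _]/(g 0%N) -[U t (s N.+1 N.+1) _]/(g N.+1).
    rewrite -opprB -(telescope_sumr g (leq0n N.+1)) big_mkord -sumrN -big_split.
    apply: eq_bigr => k _ /=.
    have := s_in N.+1 k.+1 (ltn_ord k) => hs.
    have [_ _ -> _ _] := additive_lin (evol_lin evolU
      (t := t) (s := s N.+1 k.+1) ltac:(between) ltac:(between) ltac:(between)).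
    by rewrite /g; lcomb_eq R[i].
  apply: le_trans (rnormD _ _) _.
  have hx := hM t x (Y x z) ltac:(between) ltac:(between) ltac:(between).
  have hy := hM t y (Y y z) ltac:(between) ltac:(between) ltac:(between).
  have hx' := Y_le x z ltac:(between); have hy' := Y_le y z ltac:(between).
  have h1 : rnorm (U t x (Y x z) - U t y (Y y z)) <= M * (2 * kappa) * w.
    apply: le_trans (rnormB _ _) _.
    have := ler_wpM2l M0 hx'; have := ler_wpM2l M0 hy'; rewrite -/w; nra.
  suff h2 : rnorm (\sum_(k < N.+1)
      (U t (s N.+1 k.+1) (Y (s N.+1 k.+1) z - Y (s N.+1 k) z))) <=
      M * (Lam * (y - x)) * w.
    have h3 : M * (Lam * (y - x)) * w <= M * (Lam * T) * w.
      by rewrite ler_wpM2r // ler_wpM2l // ler_wpM2l //; lra.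
    by rewrite /B; lra.
  apply: le_trans (rnorm_sum _ _ _) _.
  have -> : M * (Lam * (y - x)) * w =
     \sum_(k < N.+1) M * (Lam * ((y - x) / N.+1%:R) * w).
    rewrite sumr_const card_ord -mulr_natr; field.
    by apply/eqP; have := ler0n R N; lra.
  apply: ler_sum => k _.
  have hs := s_in N.+1 k.+1 (ltn_ord k); have hs' := s_in N.+1 k (ltnW (ltn_ord k)).
  apply: le_trans (hM _ _ _ _ _ _) _; [between..|].
  rewrite ler_wpM2l //; apply: le_trans (Y_Lip _ _ _ _ _) _; [between..|].
  rewrite sS [s N.+1 k + _]addrC addrK ger0_norm //; exact: (s_lt N.+1 k).
have Rs_cvg N : rnorm (F y - F x - j (Rs N.+1)) <=
    M1 * kappa * Lam * w * (y - x) * (y - x) / N.+1%:R.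
  have -> : F y - F x = \sum_(k < N.+1) (F (s N.+1 k.+1) - F (s N.+1 k)).
    rewrite -(big_mkord xpredT (fun k => F (s N.+1 k.+1) - F (s N.+1 k))).
    by rewrite (telescope_sumr (fun k => F (s N.+1 k))) // sN s0.
  rewrite (lin_sum _ _ _ lj) -sumrB; apply: le_trans (rnorm_sum _ _ _) _.
  have -> : M1 * kappa * Lam * w * (y - x) * (y - x) / N.+1%:R =
     \sum_(k < N.+1) (M1 * kappa * Lam * w * ((y - x) / N.+1%:R)) * ((y - x) / N.+1%:R).
    rewrite sumr_const card_ord -mulr_natr; field.
    by apply/eqP; have := ler0n R N; lra.
  apply: ler_sum => k _; set h := (y - x) / N.+1%:R.
  have hs := s_in N.+1 k.+1 (ltn_ord k); have hs' := s_in N.+1 k (ltnW (ltn_ord k)).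
  have h0 : 0 <= h := s_lt N.+1 k (ltn_ord k).
  set p := s N.+1 k; set q := s N.+1 k.+1.
  have qE : q = p + h by exact: sS.
  rewrite -/p -/q in hs hs'.
  pose G r := 1 *: F r + U1 t r (j (Y p z)).
  pose g r := 1 *: U1 t r z + - U1 t r (a r (Y p z)).
  have Gg : antideriv p q G g.
    apply: antideriv_lin; first by apply: antideriv_sub Ff; between.
    by apply: antideriv_sub (U1_deriv _ _); between.
  have pq : p <= q by lra.
  have := antideriv_le (K := M1 * kappa * Lam * w * h) pq Gg.
  have -> : G q - G p = F q - F p - j (U t p (Y p z) - U t q (Y p z)).
    by rewrite /G jB -!U1_j; [lcomb_eq R[i]|between..].
  have -> : q - p = h by rewrite qE; ring.
  apply=> r rpq; have r0T : 0 <= r <= T by lra.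
  have lU1 := evol_lin evolU1 (t := t) (s := r) ltac:(between) ltac:(between) ltac:(between).
  have [_ _ U1B _ _] := additive_lin lU1.
  have [_ _ aB _ _] := additive_lin (a_lin r0T).
  rewrite /g scale1r -U1B -{1}(aY r z r0T) -aB.
  apply: le_trans (hM1 _ _ _ _ _ _) _; [between..|].
  rewrite -!mulrA ler_wpM2l //; apply: le_trans (a_le _ r0T) _.
  rewrite ler_wpM2l //; apply: le_trans (Y_Lip r p z r0T _) _; first between.
  have rp : `|r - p| <= h by rewrite ger0_norm; lra.
  rewrite -/w mulrAC [leRHS]mulrA.
  by apply: ler_wpM2l => //; exact: mulr_ge0.
apply: fav_lim => // e e0.
pose K := M1 * kappa * Lam * w * (y - x) * (y - x).
have K0 : 0 <= K by rewrite !mulr_ge0 //; lra.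
exists (j (Rs (Num.bound (K / e)).+1)).
  apply: fav_le (hC _); rewrite -mulrA ler_wpM2l //; exact: Rs_le.
apply: le_lt_trans (Rs_cvg _) _; rewrite -/K.
have Ke : 0 <= K / e by rewrite divr_ge0 // ltW.
rewrite ltr_pdivrMr // -ltr_pdivrMl // mulrC.
by apply: lt_le_trans (archi_boundP Ke) _; rewrite ler_nat.
Qed.

(** Constant integrands from [X] have integrals in [X]; they are dense in [Z], and
the bound above lets the property pass to the limit. *)
Lemma const_integral_range t x y z F :
  0 <= x -> x <= y -> y <= t -> t <= T ->
  antideriv x y F (fun s => U1 t s z) -> exists u, F y - F x = j u.
Proof.
move=> x0 xy yt tT Ff.
have [C C0 hC] := const_integral_bound.
apply: (fav_closed j_bounded P_bounded P_jK j_PK) => e e0.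
have [|N hN] := j_PK z (_ : 0 < e / (C + 1)); first by rewrite divr_gt0 //; lra.
have {hN} := hN N (leqnn _); set v := P N z => hv.
have [|G Gg] := @antideriv_exists R X x y (fun s => U t s v) xy.
  apply: (evol_cont_on evolU) => // r _ e' e'0; exists 1 => // r' _ _.
  by rewrite subrr rnorm0.
have [lj _] := j_bounded; have [_ _ jB _ _] := additive_lin lj.
exists (G y - G x).
have := antideriv_lin (-1) (antideriv_op j_bounded Gg) Ff.
set H := fun r => _; move=> Hh.
have -> : F y - F x - j (G y - G x) = H y - H x.
  by rewrite /H jB /=; lcomb_eq R[i].
apply: (@fav_le _ _ _ _ (C * rnorm (z - j v))).
  move: hv; rewrite rnormBC ltr_pdivlMr; last lra.
  by have := rnorm_ge0 (z - j v); nra.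
apply: (hC _ _ _ _ _ x0 xy yt tT).
apply: antideriv_ext Hh => r rxy /=.
have lU1 := evol_lin evolU1 (t := t) (s := r) ltac:(between) ltac:(between) ltac:(between).
have [_ _ -> _ _] := additive_lin lU1.
by rewrite -U1_j; [lcomb_eq R[i]|between..].
Qed.

End ConstantIntegrand.

(** * Integrands that are almost separably valued *)

Section Measurable.
Context {R : realType}.
Local Notation mu := (@lebesgue_measure R).

(** As a function of intervals this is additive, and it equals the length near every
point outside a closed [K]; so it can serve as the bound in [antideriv_le_gen] for
integrands that are only crudely bounded outside [K]. *)
Definition outside (K : set R) (x y : R) : R := fine (mu (`]x, y] `\` K)).

Lemma outside_fin (K : set R) x y : measurable K -> mu (`]x, y] `\` K) \is a fin_num.
Proof.
move=> mK; rewrite ge0_fin_numE //.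
apply: (@le_lt_trans _ _ (mu `]x, y])).
  by apply: le_measure; rewrite ?inE //; exact: measurableD.
by rewrite lebesgue_measure_itv /=; case: ifP => _; rewrite ltry.
Qed.

Lemma outside_ge0 (K : set R) x y : 0 <= outside K x y.
Proof. exact: fine_ge0. Qed.

Lemma outside_add (K : set R) x y z : measurable K -> x <= y -> y <= z ->
  outside K x y + outside K y z = outside K x z.
Proof.
move=> mK xy yz; rewrite /outside -fineD ?outside_fin // -measureU.
- congr (fine (mu _)); apply/seteqP; split=> r /=; rewrite !in_itv /=.
    by case=> -[h ?]; split=> //; lra.
  by case=> h Kr; have [ry|yr] := leP r y; [left|right]; split=> //; lra.
- exact: measurableD.
- exact: measurableD.
- rewrite -subset0 => r /= []; rewrite !in_itv /= => -[h _] [h' _]; lra.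
Qed.

Lemma outside_free (K : set R) x y : x <= y ->
  (forall r, x <= r <= y -> ~ K r) -> outside K x y = y - x.
Proof.
move=> xy hK; rewrite /outside (_ : _ `\` _ = [set` `]x, y]]).
  rewrite lebesgue_measure_itv /= lte_fin; case: ltP => //= yx; lra.
apply/seteqP; split=> r /=; rewrite in_itv /=; first by case.
by move=> xry; split=> //; apply: hK; between.
Qed.

(** Selecting, among countably many measurable sets that cover almost all of a
segment, one that contains the given point can be done locally constantly off a
set of small measure: this is Lusin's theorem for an integer-valued function. *)
Lemma countable_cover_lusin (a b : R) (C : nat -> set R) (e : R) : 0 < e ->
  (forall n, measurable (C n)) -> (forall n, C n `<=` `[a, b]) ->
  {ae mu, forall r, a <= r <= b -> exists n, C n r} ->
  exists K : set R, [/\ measurable K, closed K, outside K a b <= e &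
    forall c, K c -> exists n, exists2 d : R, 0 < d &
      forall r, K r -> `|r - c| < d -> C n r].
Proof.
move=> e0 mC Cab [N [mN N0 hN]].
pose A := \bigcup_n C n.
have mA : measurable A by apply: bigcup_measurable.
have mD n : measurable (seqDU C n).
  by apply: measurableD => //; exact: bigsetU_measurable.
have /choice[q hq] : forall r, exists n, A r -> seqDU C n r.
  move=> r; have [Ar|] := pselect (A r); last by exists 0%N.
  by move: (Ar); rewrite /A seqDU_bigcup_eq => -[n _ hn]; exists n.
have q_uniq n r : seqDU C n r -> q r = n.
  move=> Dn; have Ar : A r by rewrite /A seqDU_bigcup_eq; exists n.
  have := (@trivIset_seqDU _ C) (q r) n Logic.I Logic.I; apply.
  by exists r; split=> //; exact: hq.
have Aab : A `<=` `[a, b] by move=> r [n _ /Cab].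
have Afin : (mu A < +oo)%E.
  apply: (@le_lt_trans _ _ (mu `[a, b])).
    by apply: le_measure; rewrite ?inE.
  by rewrite lebesgue_measure_itv /=; case: ifP => _; rewrite ltry.
have mq : measurable_fun A (fun r => (q r)%:R : R).
  move=> _ Y mY; rewrite (_ : _ `&` _ = \bigcup_(n in [set n | Y n%:R]) seqDU C n).
    by apply: bigcup_measurable => n _; exact: mD.
  apply/seteqP; split=> r /=.
    by case=> Ar Yr; exists (q r) => //; exact: hq.
  case=> n /= Yn Dn; split; last by rewrite (q_uniq n r).
  by rewrite /A seqDU_bigcup_eq; exists n.
have [K [cK KA AK qK]] := measurable_almost_continuous mA Afin e0 mq.
have clK : closed K by apply: compact_closed => //; exact: Rhausdorff.
have mK : measurable K by exact: measurable_realfun.closed_measurable.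
exists K; split=> //.
  rewrite /outside -lee_fin fineK ?outside_fin //.
  apply: (@le_trans _ _ (mu ((A `\` K) `|` N))).
    apply: le_measure; rewrite ?inE //.
    - exact: measurableD.
    - by apply: measurableU => //; exact: measurableD.
    move=> r /= []; rewrite in_itv /= => abr nKr.
    have [Ar|nAr] := pselect (A r); first by left.
    right; apply: hN => /= h; apply: nAr.
    by have [|n hn] := h; [between | exists n].
  have mAK : measurable (A `\` K) by exact: measurableD.
  have U2 : (mu ((A `\` K) `|` N) <= mu (A `\` K) + mu N)%E by exact: measureU2.
  by apply: le_trans U2 _; rewrite [X in (_ + X)%E]N0 adde0 ltW.
move=> c Kc; exists (q c).
have := (subspace_continuousP _ _).1 qK c Kc.
move=> /cvgrPdist_lt /(_ 1 ltr01) /nbhs_ballP[d /= d0 hd].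
exists d => // r Kr rc.
suff <- : q r = q c by have [] := hq r (KA r Kr).
have := hd r; rewrite -ball_normE /= distrC => /(_ rc Kr).
rewrite ltr_norml => /andP[h1 h2].
have : (q c < q r + 1)%N by rewrite -(ltr_nat R) natrD; lra.
have : (q r < q c + 1)%N by rewrite -(ltr_nat R) natrD; lra.
by lia.
Qed.

End Measurable.

Section Membership.
Context {R : realType}.
Local Notation mu := (@lebesgue_measure R).
Variables X Z : completeNormedModType R[i].
Variable j : X -> Z.
Hypothesis j_bounded : rbounded j.
Variable P : nat -> Z -> X.
Hypothesis P_bounded : forall n, rbounded (P n).
Hypothesis P_jK : forall x (e : R), 0 < e ->
  exists N, forall n, (N <= n)%N -> rnorm (P n (j x) - x) < e.
Hypothesis j_PK : forall z (e : R), 0 < e ->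
  exists N, forall n, (N <= n)%N -> rnorm (j (P n z) - z) < e.
Variables (T : R) (U1 : R -> R -> Z -> Z).
Hypothesis evolU1 : evolution_family T U1.
Variable KU : R.
Hypothesis KU_ge0 : 0 <= KU.
Hypothesis fav_U1 : forall t s r w,
  0 <= s -> s <= t -> t <= T -> fav P r w -> fav P (KU * r) (U1 t s w).
Hypothesis const_range : forall t x y z F,
  0 <= x -> x <= y -> y <= t -> t <= T ->
  antideriv x y F (fun s => U1 t s z) -> exists u, F y - F x = j u.

(** Favard balls are closed in [Z], each [P n] being continuous. *)
Lemma fav_closed_set (a b r : R) (g : R -> Z) :
  cont_on [set x | a <= x <= b] g ->
  closed [set x | a <= x <= b /\ fav P r (g x)].
Proof.
move=> cg x clx.
have near_x (d : R) : 0 < d ->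
    exists y, [/\ a <= y <= b, fav P r (g y) & `|y - x| < d].
  move=> d0; have [y [[yab fy] xy]] := clx (ball x d) (nbhsx_ballx x d d0).
  by exists y; split=> //; move: xy; rewrite -ball_normE /= distrC.
have xab : a <= x <= b.
  apply/andP; split; apply/ler_addgt0Pr => d d0; have [y [yab _]] := near_x d d0;
    by rewrite ltr_norml; lra.
split=> //; apply: (fav_lim P_bounded) => e e0.
have [d d0 hd] := cg x xab e e0; have [y [yab fy yx]] := near_x d d0.
by exists (g y) => //; rewrite rnormBC; exact: hd.
Qed.

(** Off a set of small measure, near each point the integrand is Favard-close to
one of the constants [z n], whose integral is known to lie in [X]; on the small
set the crude Favard bound suffices.  So each short integral, and hence by
additivity the whole one, is Favard-close to the image of [X], which is closed. *)
Theorem integral_range (t s : R) (f F : R -> Z) (z : nat -> Z) (C : R) :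
  0 <= s -> s <= t -> t <= T ->
  cont_on [set r | s <= r <= t] f ->
  antideriv s t F (fun r => U1 t r (f r)) ->
  (forall r, s <= r <= t -> fav P C (f r)) ->
  {ae mu, forall r, s <= r <= t ->
     forall e, 0 < e -> exists n, fav P e (f r - z n)} ->
  exists u, F t - F s = j u.
Proof.
move=> s0 st tT cf Ff fC fz.
have [lj _] := j_bounded; have [j0 jD jB _ _] := additive_lin lj.
apply: (fav_closed j_bounded P_bounded P_jK j_PK) => e e0.
have KU0 : 0 <= KU := KU_ge0.
have C0 : 0 <= C.
  by apply: le_trans (fC s _ 0%N); [exact: rnorm_ge0 | between].
have e20 : 0 < e / 2 by lra.
have KUst : 0 <= KU * (t - s) by rewrite mulr_ge0 //; lra.
have [e1 e10 e1_le] := small_factor KUst e20.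
have [C' C'E] : exists C', C' = C + (C + e1) by eexists.
have C'0 : 0 <= C' by lra.
have KUC' : 0 <= KU * C' by rewrite mulr_ge0.
have [eta eta0 eta_le] := small_factor KUC' e20.
pose Cq n := [set r | s <= r <= t /\ fav P e1 (f r - z n)].
have [n|n r [rst _]||K [mK clK outK locK]] := countable_cover_lusin (a := s) (b := t)
    (C := Cq) eta0.
- apply: measurable_realfun.closed_measurable.
  apply: fav_closed_set => x xst d d0; have [d' d'0 hd'] := cf x xst d d0.
  exists d' => // y yst yx; have := hd' y yst yx.
  by congr (rnorm _ < _); lcomb_eq R[i].
- by rewrite /= in_itv.
- have [N [mN N0 hN]] := fz; exists N; split=> // r nr; apply: hN => hr.
  by apply: nr => rst; have [n hn] := hr rst e1 e10; exists n.
(* [k] integrates the Favard bound on the integrand minus a nearby constant. *)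
pose k x y := KU * (e1 * (y - x) + C' * outside K x y).
have kadd x y v : x <= y -> y <= v -> k x y + k y v = k x v.
  by move=> xy yv; rewrite /k -(outside_add mK xy yv); ring.
have k_out x y : 0 <= C' * outside K x y by rewrite mulr_ge0 ?outside_ge0.
have off_K c : ~ K c -> exists2 d : R, 0 < d &
    forall x y, x <= c -> c <= y -> y - x < d -> outside K x y = y - x.
  move=> nKc; have /nbhs_ballP[d /= d0 hd] : nbhs c (~` K).
    by apply: open_nbhs_nbhs; split=> //; exact: closed_openC.
  exists d => // x y xc cy yx; apply: outside_free; first between.
  move=> r xry; apply: hd; rewrite -ball_normE /= ltr_norml; lra.
have fav_part x y v n (G : R -> Z) : s <= x -> x <= y -> y <= t ->
    (forall r, x <= r <= y -> K r -> Cq n r) -> (exists2 c, x <= c <= y & K c) ->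
    antideriv x y G (fun r => U1 t r (f r - z n)) ->
    v = G y - G x -> fav P (k x y) v.
  move=> sx xy yt nK [c cxy Kc] Gg ->.
  have [cst fcz] := nK c cxy Kc.
  pose r0 r := KU * (if r \in K then e1 else C').
  apply: (fav_integral P_bounded (r := r0) (k := k) xy Gg).
  - by move=> x' y' z' _ h1 h2 _; rewrite kadd.
  - move=> r rxy; apply: fav_U1; [between..|].
    case: ifPn => [/set_mem Kr|_]; first by have [] := nK r rxy Kr.
    have -> : f r - z n = f r - (f c - (f c - z n)) by lcomb_eq R[i].
    rewrite C'E; by apply: favB => //; [apply: fC; between | apply: favB => //; apply: fC; between].
  - move=> r rxy e' e'0; rewrite /r0; case: ifPn => [_|/negP nKr].
      exists 1 => // x' y' _ xr ry _ _; have := mulr_ge0 KU0 (k_out x' y').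
      have := ler_mul_len (ltW e'0) (le_trans xr ry).
      by rewrite /k; lra.
    have [d d0 hd] := off_K r (fun Kr => nKr (mem_set Kr)); exists d => // x' y' _ xr ry _ yx'.
    rewrite /k hd //.
    have := ler_mul_len (ltW e'0) (le_trans xr ry).
    have := mulr_ge0 KU0 (ler_mul_len (ltW e10) (le_trans xr ry)).
    by lra.
have [u hu] : exists u, fav P (k s t) (F t - F s - j u).
  apply: (cousin (P := fun x y => exists u, fav P (k x y) (F y - F x - j u)) st).
    move=> x y v sx xy yv vt [u1 h1] [u2 h2]; exists (u1 + u2).
    rewrite -(kadd x y v) // jD.
    have -> : F v - F x - (j u1 + j u2) = (F y - F x - j u1) + (F v - F y - j u2).
      by lcomb_eq R[i].
    exact: favD.
  move=> c cst; have [Kc|nKc] := pselect (K c); last first.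
    have [d d0 hd] := off_K c nKc; exists d => // x y sx xc cy yt yx; exists 0.
    have xy : x <= y by between.
    rewrite j0 subr0; apply: (fav_le (r := KU * C * (y - x))).
      rewrite /k hd // -mulrA ler_wpM2l // C'E.
      have := ler_mul_len (ltW e10) xy; have := ler_mul_len C0 xy.
      lra.
    apply: (fav_integral_le P_bounded xy (antideriv_sub sx yt Ff)).
    by move=> r rxy; apply: fav_U1; [between..|]; apply: fC; between.
  have [n [d d0 hn]] := locK c Kc; exists d => // x y sx xc cy yt yx.
  have xy : x <= y by between.
  have [|G Gz] := @antideriv_exists R Z x y (fun r => U1 t r (z n)) xy.
    apply: (evol_cont_on evolU1) => //; [between..|].
    by move=> r _ e' e'0; exists 1 => // r' _ _; rewrite subrr rnorm0.
  have x0 : 0 <= x by between.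
  have [u hu] := const_range x0 xy yt tT Gz.
  exists u; apply: (@fav_part x y _ n (fun r => -1 *: G r + F r)) => //.
  - by move=> r rxy Kr; apply: hn => //; rewrite ltr_norml; lra.
  - by exists c => //; between.
  - have := antideriv_lin (-1) Gz (antideriv_sub sx yt Ff).
    apply: antideriv_ext => r rxy.
    have lU1 := evol_lin evolU1 (t := t) (s := r) ltac:(between) ltac:(between) ltac:(between).
    by have [_ _ -> _ _] := additive_lin lU1; lcomb_eq R[i].
  - by rewrite -hu; lcomb_eq R[i].
exists u; apply: fav_le hu; rewrite /k.
have h1 : KU * (C' * outside K s t) <= e / 2.
  by apply: le_trans eta_le; rewrite mulrA ler_wpM2l.
rewrite mulrDr; lra.
Qed.

End Membership.

(** * The Volterra equation *)

Section ContinuousFunctions.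
Context {R : realType}.
Implicit Types V W : normedModType R[i].

Lemma cont_on_sub V (D D' : set R) (f : R -> V) :
  D' `<=` D -> cont_on D f -> cont_on D' f.
Proof.
move=> DD cf x /DD Dx e e0; have [d d0 hd] := cf x Dx e e0.
by exists d => // y /DD Dy; apply: hd.
Qed.

Lemma cont_on_lin V (D : set R) (f g : R -> V) (c : R[i]) :
  cont_on D f -> cont_on D g -> cont_on D (fun x => c *: f x + g x).
Proof.
move=> cf cg x Dx e e0; have e2 : 0 < e / 2 by lra.
have [d' d'0 d'e] := small_factor (rnorm_ge0 (c : R[i]^o)) e2.
have [d1 d10 h1] := cf x Dx _ d'0; have [d2 d20 h2] := cg x Dx _ e2.
exists (Num.min d1 d2); first by rewrite lt_min d10.
move=> y Dy; rewrite lt_min => /andP[yx1 yx2].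
have -> : c *: f y + g y - (c *: f x + g x) = c *: (f y - f x) + (g y - g x).
  by lcomb_eq R[i].
apply: le_lt_trans (rnormD _ _) _; rewrite rnormZ.
have h3 : rnorm (c : R[i]^o) * rnorm (f y - f x) <= e / 2.
  apply: le_trans d'e; apply: ler_wpM2l; first exact: rnorm_ge0.
  exact: ltW (h1 y Dy yx1).
by have := h2 y Dy yx2; rewrite /rnorm in h3 *; lra.
Qed.

Lemma cont_on_bounded V (a b : R) (f : R -> V) : a <= b ->
  cont_on [set x | a <= x <= b] f ->
  exists2 m : R, 0 <= m & forall x, a <= x <= b -> rnorm (f x) <= m.
Proof.
move=> ab cf.
suff [m hm] : exists m : R, forall x, a <= x <= b -> rnorm (f x) <= m.
  by exists m => //; apply: le_trans (hm a _); rewrite ?rnorm_ge0 ?lexx.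
apply: (cousin (P := fun u v => exists m : R, forall x, u <= x <= v ->
  rnorm (f x) <= m) ab).
  move=> x y z _ xy yz _ [m1 h1] [m2 h2]; exists (Num.max m1 m2) => r rxz.
  by rewrite le_max; have [ry|yr] := leP r y; [rewrite h1|rewrite h2 ?orbT]; lra.
move=> c cab; have [d d0 hd] := cf c cab 1 ltr01; exists d => // x y ax xc cy yb yx.
exists (rnorm (f c) + 1) => r rxy.
have := hd r ltac:(move=> /=; lra); rewrite ltr_norml => /(_ ltac:(lra)) h.
by have := rnorm_trans (f c) (f r) 0; rewrite !subr0; lra.
Qed.

(** This makes the exponential an admissible bound in [antideriv_le_gen]; it comes
from [expR h >= 1 + h], applied from [c] to both ends and back. *)
Lemma expR_straddle (w s c e : R) : 0 < w -> 0 < e ->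
  exists2 d : R, 0 < d & forall x y, x <= c -> c <= y -> y - x < d ->
    (y - x) * (w * expR (w * (c - s))) <=
      (expR (w * (y - s)) - expR (w * (x - s))) + e * (y - x).
Proof.
move=> w0 e0; set g := fun r => expR (w * (r - s)).
have [d d0 de] := @small_factor R (w * w * g c) e ltac:(rewrite !mulr_ge0 ?expR_ge0 // ltW //) e0.
exists d => // x y xc cy yx.
have g0 := expR_gt0 (w * (c - s)); rewrite -/(g c) in g0.
have up : g c * (1 + w * (y - c)) <= g y.
  rewrite /g [leRHS](_ : _ = expR (w * (c - s)) * expR (w * (y - c))).
    by rewrite ler_wpM2l ?expR_ge0 ?expR_ge1Dx.
  by rewrite -expRD; congr expR; ring.
have down1 : g c * (1 - w * (c - x)) <= g x.
  rewrite /g [leRHS](_ : _ = expR (w * (c - s)) * expR (- (w * (c - x)))).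
    by rewrite ler_wpM2l ?expR_ge0 ?expR_ge1Dx.
  by rewrite -expRD; congr expR; ring.
have down2 : g x * (1 + w * (c - x)) <= g c.
  rewrite {2}/g [leRHS](_ : _ = expR (w * (x - s)) * expR (w * (c - x))).
    by rewrite ler_wpM2l ?expR_ge0 ?expR_ge1Dx.
  by rewrite -expRD; congr expR; ring.
have h1 : 0 <= w * (c - x) by rewrite mulr_ge0; lra.
have h2 := ler_wpM2r h1 down1.
have h3 : w * w * g c * (c - x) * (c - x) <= e * (c - x).
  rewrite ler_wpM2r; [by []|lra|].
  apply: le_trans de; rewrite ler_wpM2l //; last lra.
  by rewrite !mulr_ge0 // ltW.
have h4 : 0 <= e * (y - c) by rewrite mulr_ge0; lra.
rewrite -/(g c) -/(g y) -/(g x); lra.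
Qed.

End ContinuousFunctions.

Section Volterra.
Context {R : realType}.
Variables X Z : completeNormedModType R[i].
Variable j : X -> Z.
Hypothesis j_bounded : rbounded j.
Variable P : nat -> Z -> X.
Hypothesis P_bounded : forall n, rbounded (P n).
Hypothesis P_jK : forall x (e : R), 0 < e ->
  exists N, forall n, (N <= n)%N -> rnorm (P n (j x) - x) < e.
Variables (T : R) (U : R -> R -> X -> X) (U1 : R -> R -> Z -> Z).
Hypotheses (evolU : evolution_family T U) (evolU1 : evolution_family T U1).
Hypothesis U1_j : forall t s x, 0 <= s -> s <= t -> t <= T ->
  U1 t s (j x) = j (U t s x).
Variable KU : R.
Hypothesis KU_ge0 : 0 <= KU.
Hypothesis fav_U1 : forall t s r w,
  0 <= s -> s <= t -> t <= T -> fav P r w -> fav P (KU * r) (U1 t s w).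
Variables (B : R -> X -> Z) (CB CZ : R).
Hypotheses (CB_ge0 : 0 <= CB) (CZ_ge0 : 0 <= CZ).
Hypothesis B_lin : forall t, 0 <= t <= T -> linear (B t).
Hypothesis B_le : forall t x, 0 <= t <= T -> rnorm (B t x) <= CZ * rnorm x.
Hypothesis B_cont : forall x, cont_on [set t | 0 <= t <= T] (fun t => B t x).
Hypothesis B_fav : forall t x, 0 <= t <= T -> fav P (CB * rnorm x) (B t x).
Hypothesis B_range : forall s t v F, 0 <= s -> s <= t -> t <= T ->
  cont_on [set r | s <= r <= t] v ->
  antideriv s t F (fun r => U1 t r (B r (v r))) -> exists u, F t - F s = j u.

Local Notation integrand t v := (fun r => U1 t r (B r (v r))).

(** From the strong continuity and the uniform boundedness of [B]. *)
Lemma B_cont_on a b v : 0 <= a -> b <= T ->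
  cont_on [set r | a <= r <= b] v -> cont_on [set r | a <= r <= b] (fun r => B r (v r)).
Proof.
move=> a0 bT cv r /= rab e e0; have e2 : 0 < e / 2 by lra.
have [d' d'0 d'e] := small_factor CZ_ge0 e2.
have [d1 d10 h1] := @B_cont (v r) r ltac:(move=> /=; between) _ e2.
have [d2 d20 h2] := cv r rab _ d'0.
exists (Num.min d1 d2); first by rewrite lt_min d10.
move=> y /= yab; rewrite lt_min => /andP[yr1 yr2].
have y0T : 0 <= y <= T by between.
have := rnorm_trans (B y (v r)) (B y (v y)) (B r (v r)).
have [_ _ <- _ _] := additive_lin (B_lin y0T).
have := h1 y y0T yr1.
have := B_le (v y - v r) y0T.
have := ler_wpM2l CZ_ge0 (ltW (h2 y yab yr2)); lra.
Qed.

Lemma integrand_cont t a b v : 0 <= a -> b <= t -> t <= T ->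
  cont_on [set r | a <= r <= b] v -> cont_on [set r | a <= r <= b] (integrand t v).
Proof.
move=> a0 bt tT cv; apply: (evol_cont_on evolU1) => //.
by apply: B_cont_on => //; between.
Qed.

Lemma integrand_antideriv t a b v : 0 <= a -> a <= b -> b <= t -> t <= T ->
  cont_on [set r | a <= r <= b] v -> exists F, antideriv a b F (integrand t v).
Proof.
by move=> a0 ab bt tT cv; apply: antideriv_exists => //; apply: integrand_cont.
Qed.

(** Twice the norm of the kernel, increased so as to be positive. *)
Definition rate := 2 * KU * CB + 1.

Lemma rate_gt0 : 0 < rate.
Proof. by have := mulr_ge0 KU_ge0 CB_ge0; rewrite /rate; lra. Qed.

Lemma integrand_lin t v v' c r : 0 <= r -> r <= t -> t <= T ->
  U1 t r (B r (c *: v r + v' r)) =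
    c *: U1 t r (B r (v r)) + U1 t r (B r (v' r)) :> Z.
Proof.
move=> r0 rt tT; rewrite (B_lin _ : linear (B r)); last between.
exact: (evol_lin evolU1).
Qed.

(** The integrand grows at most like [KU * CB * K * expR (rate * (r - s))], and [rate]
exceeds [2 * KU * CB]: integration in [r] gains the factor [1/2]. *)
Lemma perturbation_contraction s t v v' F F' w w' K :
  0 <= s -> s <= t -> t <= T -> 0 <= K ->
  antideriv s t F (integrand t v) -> antideriv s t F' (integrand t v') ->
  j w = F t - F s -> j w' = F' t - F' s ->
  (forall r, s <= r <= t -> rnorm (v r - v' r) <= K * expR (rate * (r - s))) ->
  rnorm (w - w') <= K / 2 * expR (rate * (t - s)).
Proof.
move=> s0 st tT K0 Fv Fv' jw jw' vv'; have g0 := rate_gt0.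
have [lj _] := j_bounded; have [j0 jD jB _ _] := additive_lin lj.
have [c0 c0E] : exists c0, c0 * rate = KU * CB * K.
  by exists (KU * CB * K / rate); rewrite divfK // gt_eqF.
have KCK : 0 <= c0.
  by rewrite -(pmulr_lge0 _ g0) c0E !mulr_ge0.
pose k x y := c0 * (expR (rate * (y - s)) - expR (rate * (x - s))).
apply: (@le_trans _ _ (k s t)).
  apply: (fav_norm P_jK); rewrite jB jw jw'.
  pose H r := -1 *: F' r + F r.
  have -> : F t - F s - (F' t - F' s) = H t - H s by rewrite /H; lcomb_eq R[i].
  apply: (fav_integral P_bounded (f := fun r => U1 t r (B r (-1 *: v' r + v r)))
    (r := fun r => KU * (CB * (K * expR (rate * (r - s)))))) => //.
  - have := antideriv_lin (-1) Fv' Fv; apply: antideriv_ext => r rst.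
    by rewrite integrand_lin //; between.
  - move=> x y z _ _ _ _; rewrite le_eqVlt; apply/orP; left; apply/eqP.
    by rewrite /k; ring.
  - move=> r rst; apply: fav_U1; [between..|].
    apply: fav_le (B_fav _ _); last between.
    rewrite ler_wpM2l //; apply: le_trans (vv' r rst).
    by rewrite scaleN1r addrC.
  - move=> c cst e e0.
    have [d' d'0 d'e] := small_factor KCK e0.
    have [d d0 hd] := expR_straddle s c g0 d'0.
    exists d => // x y _ xc cy _ yx.
    have := ler_wpM2l KCK (hd x y xc cy yx).
    have h : c0 * d' * (y - x) <= e * (y - x) by rewrite ler_wpM2r //; lra.
    have -> : c0 * ((y - x) * (rate * expR (rate * (c - s)))) =
       (y - x) * (c0 * rate * expR (rate * (c - s))) by ring.
    by rewrite c0E /k; lra.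
have e0 : 0 < expR (rate * (t - s)) := expR_gt0 _.
rewrite /k subrr mulr0 expR0.
apply: (@le_trans _ _ (c0 * expR (rate * (t - s)))).
  by rewrite ler_wpM2l //; lra.
rewrite ler_wpM2r ?(ltW e0) // -(ler_pM2r g0) c0E.
rewrite /rate; lra.
Qed.

Lemma perturbation_small t a b v F u m :
  0 <= a -> a <= b -> b <= t -> t <= T ->
  antideriv a b F (integrand t v) -> F b - F a = j u ->
  (forall r, a <= r <= b -> rnorm (v r) <= m) ->
  rnorm u <= KU * CB * m * (b - a).
Proof.
move=> a0 ab bt tT Fv ju vm; apply: (fav_norm P_jK); rewrite -ju.
apply: (fav_integral_le P_bounded ab Fv) => r rab.
rewrite -mulrA; apply: fav_U1; [between..|]; apply: fav_le (B_fav _ _); last between.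
by rewrite ler_wpM2l // vm.
Qed.

(** By the evolution property, [U1 t r] maps the integrand for the final time [r] to
the one for the final time [t]. *)
Lemma integral_cut s r t v F F' :
  0 <= s -> s <= r -> r <= t -> t <= T ->
  antideriv s r F (integrand r v) -> antideriv s t F' (integrand t v) ->
  F' t - F' s = U1 t r (F r - F s) + (F' t - F' r).
Proof.
move=> s0 sr rt tT Fv F'v; have r0 : 0 <= r by between.
have U1b := evol_rbounded evolU1 r0 rt tT.
have [lU1 _] := U1b; have [_ _ U1B _ _] := additive_lin lU1.
have := antideriv_op U1b Fv.
move=> /(antideriv_ext (g := integrand t v)) /(_ _) h.
have := antideriv_uniq sr (h _) (antideriv_sub (lexx s) rt F'v).
rewrite U1B /= => -> //.
  by lcomb_eq R[i].
by move=> x xsr /=; rewrite -(evol_comp evolU1) //; between.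
Qed.

(** An orbit of [U] up to an error that is linear in the elapsed time is
continuous: to compare two late times, restart the orbit shortly before both. *)
Lemma quasi_orbit_cont s w C : 0 <= s -> s <= T -> 0 <= C ->
  (forall r t, s <= r -> r <= t -> t <= T ->
     rnorm (w t - U t r (w r)) <= C * (t - r)) ->
  cont_on [set t | s <= t <= T] w.
Proof.
move=> s0 sT C0 hw t /= tsT e e0.
have e4 : 0 < e / 4 by lra.
(* [h] bounds the time between the restart at [r] and the times compared. *)
have [h h0 hC] := small_factor C0 e4.
pose r := Num.max s (t - h).
have sr : s <= r by rewrite /r le_max lexx.
have rt : r <= t by rewrite /r ge_max; lra.
have rth : t - r <= h.
  have : t - h <= r by rewrite /r le_max lexx orbT.
  by lra.
have [|||d d0 hd] := evol_cont evolU (w r) (t := t) (s := r) _ _ _ e4; [between..|].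
exists (Num.min d h); first by rewrite lt_min d0.
have near_ y : r <= y -> y <= T -> `|y - t| < d -> y - t < h ->
    rnorm (w y - w t) < e.
  move=> ry yT yt yth.
  have := rnorm_trans (U y r (w r)) (w y) (w t).
  have := rnorm_trans (U t r (w r)) (U y r (w r)) (w t).
  rewrite (rnormBC (U t r (w r)) (w t)).
  have h1 := hw r y sr ry yT.
  have h2 := hw r t sr rt ltac:(between).
  have h3 := hd y r ltac:(lra) ry yT yt ltac:(rewrite subrr normr0; lra).
  have h4 : C * (y - r) <= 2 * (C * h).
    by rewrite mulrCA ler_wpM2l //; lra.
  have h5 : C * (t - r) <= C * h by rewrite ler_wpM2l.
  lra.
move=> y /= ysT; rewrite lt_min => /andP[yt yt'].
have [ry|yr] := leP r y.
  by apply: near_ => //; move: yt'; rewrite ltr_norml; lra.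
exfalso; move: yr yt'; rewrite /r lt_max ltr_norml; case: leP => /=; lra.
Qed.

Lemma perturbation_exists s v : 0 <= s -> s <= T ->
  cont_on [set t | s <= t <= T] v ->
  exists w, cont_on [set t | s <= t <= T] w /\
    forall t, s <= t <= T ->
      exists F, antideriv s t F (integrand t v) /\ j (w t) = F t - F s.
Proof.
move=> s0 sT cv.
have sub a b : s <= a -> b <= T -> cont_on [set r | a <= r <= b] v.
  by move=> sa bT; apply: cont_on_sub cv => r /=; lra.
have /choice[w hw] : forall t, exists w, s <= t <= T ->
    exists F, antideriv s t F (integrand t v) /\ j w = F t - F s.
  move=> t; have [tsT|] := boolP (s <= t <= T); last by exists 0.
  have st : s <= t by between.
  have tT : t <= T by between.
  have cvt := sub s t (lexx s) tT.
  have [F Fv] := integrand_antideriv s0 st (lexx t) tT cvt.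
  have [u hu] := B_range s0 st tT cvt Fv.
  by exists u => _; exists F; split.
have [m m0 hm] := cont_on_bounded sT cv.
have [lj _] := j_bounded; have [j0 jD jB _ _] := additive_lin lj.
exists w; split=> //; apply: (quasi_orbit_cont s0 sT (C := KU * CB * m)).
  by rewrite !mulr_ge0.
move=> r t sr rt tT.
have rsT : s <= r <= T by between.
have tsT : s <= t <= T by between.
have r0 : 0 <= r by between.
have [F [Fv jF]] := hw r rsT; have [F' [Fv' jF']] := hw t tsT.
have cut := integral_cut s0 sr rt tT Fv Fv'.
apply: (perturbation_small r0 rt (lexx t) tT (antideriv_sub sr (lexx t) Fv')).
  by rewrite jB jF' cut -jF U1_j //; lcomb_eq R[i].
by move=> x xrt; apply: hm; between.
Qed.

Definition mild (s : R) (x : X) (v : R -> X) :=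
  cont_on [set t | s <= t <= T] v /\
  forall t, s <= t <= T -> exists F, antideriv s t F (integrand t v) /\
    j (v t) = j (U t s x) + (F t - F s).

Lemma mild_lin s x x' v v' c : 0 <= s ->
  mild s x v -> mild s x' v' -> mild s (c *: x + x') (fun t => c *: v t + v' t).
Proof.
move=> s0 [cv hv] [cv' hv']; split; first exact: cont_on_lin.
move=> t tsT; have [F [Fv jF]] := hv t tsT; have [F' [Fv' jF']] := hv' t tsT.
have st : s <= t by between.
have tT : t <= T by between.
have [lj _] := j_bounded; have lU := evol_lin evolU s0 st tT.
exists (fun r => c *: F r + F' r); split.
  have := antideriv_lin c Fv Fv'; apply: antideriv_ext => r rst.
  by rewrite integrand_lin //; between.
by rewrite lU !lj jF jF'; lcomb_eq R[i].
Qed.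

Lemma expR_rate_ge1 s t : s <= t -> 1 <= expR (rate * (t - s)).
Proof.
move=> st; rewrite -expR0 ler_expR mulr_ge0 ?subr_ge0 // ltW //.
exact: rate_gt0.
Qed.

(** The difference of two solutions is halved, in the weighted norm, by every use of
the equation. *)
Lemma mild_uniq s x v v' : 0 <= s -> s <= T ->
  mild s x v -> mild s x v' -> forall t, s <= t <= T -> v t = v' t.
Proof.
move=> s0 sT [cv hv] [cv' hv'].
have [m m0 hm] := cont_on_bounded sT (cont_on_lin (-1) cv' cv).
have [lj _] := j_bounded; have [_ _ jB _ _] := additive_lin lj.
have bound n t : s <= t <= T ->
    rnorm (v t - v' t) <= m / 2 ^+ n * expR (rate * (t - s)).
  elim: n t => [|n IH] t tsT.
    have := hm t tsT; rewrite scaleN1r addrC => h; rewrite expr0 divr1.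
    by apply: le_trans h _; rewrite ler_peMr // expR_rate_ge1 //; between.
  have st : s <= t by between.
  have tT : t <= T by between.
  have [F [Fv jF]] := hv t tsT; have [F' [Fv' jF']] := hv' t tsT.
  have := @perturbation_contraction s t v v' F F' (v t - U t s x)
    (v' t - U t s x) (m / 2 ^+ n) s0 st tT _ Fv Fv'.
  rewrite !jB jF jF'.
  have -> : v t - U t s x - (v' t - U t s x) = v t - v' t by lcomb_eq R[i].
  have -> : m / 2 ^+ n / 2 = m / 2 ^+ n.+1 by rewrite exprSr invfM mulrA.
  apply.
  - by rewrite divr_ge0 // exprn_ge0.
  - by lcomb_eq R[i].
  - by lcomb_eq R[i].
  - by move=> r rst; apply: IH; between.
move=> t tsT; apply/eqP; rewrite -subr_eq0; apply/eqP/rnorm_eq0/eqP.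
rewrite eq_le rnorm_ge0 andbT; apply/ler_addgt0Pr => e e0; rewrite add0r.
have E0 := expR_gt0 (rate * (t - s)).
have eE : 0 < e / expR (rate * (t - s)) by rewrite divr_gt0.
have [n hn] := half_lt m0 eE; apply: le_trans (bound n t tsT) _.
by rewrite -ler_pdivlMr // ltW.
Qed.

(** Picard iteration from [0]: in the weighted norm, the first step is bounded by [M]
and every further step by half of the previous one. *)
Lemma mild_exists s x M : 0 <= s -> s <= T -> 0 <= M ->
  (forall t, s <= t <= T -> rnorm (U t s x) <= M) ->
  exists v, mild s x v /\
    forall t, s <= t <= T -> rnorm (v t) <= 2 * M * expR (rate * (t - s)).
Proof.
move=> s0 sT M0 hM.
have [lj _] := j_bounded; have [j0 _ jB _ _] := additive_lin lj.
have /choice[Phi hPhi] : forall v : R -> X, exists w,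
    cont_on [set t | s <= t <= T] v -> cont_on [set t | s <= t <= T] w /\
    forall t, s <= t <= T ->
      exists F, antideriv s t F (integrand t v) /\ j (w t) = F t - F s.
  move=> v; have [cv|] := pselect (cont_on [set t | s <= t <= T] v).
    by have [w hw] := perturbation_exists s0 sT cv; exists w.
  by exists (fun=> 0).
have cU : cont_on [set t | s <= t <= T] (fun t => U t s x).
  move=> t /= tsT e e0.
  have [|||d d0 hd] := evol_cont evolU x (t := t) (s := s) _ _ _ e0; [between..|].
  by exists d => // y /= ysT yt; apply: hd => //; [between|between|rewrite subrr normr0].
pose vn := fix vn n : R -> X :=
  if n is m.+1 then fun t => 1 *: U t s x + Phi (vn m) t else fun=> 0.
have cvn n : cont_on [set t | s <= t <= T] (vn n).
  elim: n => [|n IH] /=; first by move=> t _ e e0; exists 1 => // y _ _; rewrite subrr rnorm0.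
  by apply: cont_on_lin => //; case: (hPhi (vn n) IH).
have contr v v' K : cont_on [set t | s <= t <= T] v ->
    cont_on [set t | s <= t <= T] v' -> 0 <= K ->
    (forall r, s <= r <= T -> rnorm (v r - v' r) <= K * expR (rate * (r - s))) ->
    forall t, s <= t <= T ->
      rnorm (Phi v t - Phi v' t) <= K / 2 * expR (rate * (t - s)).
  move=> cv cv' K0 vv' t tsT.
  have [_ /(_ t tsT)[F [Fv jF]]] := hPhi v cv.
  have [_ /(_ t tsT)[F' [Fv' jF']]] := hPhi v' cv'.
  have st : s <= t by between.
  have tT : t <= T by between.
  apply: (perturbation_contraction s0 st tT K0 Fv Fv' jF jF').
  by move=> r rst; apply: vv'; between.
have diff n t : s <= t <= T ->
    rnorm (vn n.+1 t - vn n t) <= M / 2 ^+ n * expR (rate * (t - s)).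
  elim: n t => [|n IH] t tsT; last first.
    have -> : vn n.+2 t - vn n.+1 t = Phi (vn n.+1) t - Phi (vn n) t.
      by rewrite /=; lcomb_eq R[i].
    have -> : M / 2 ^+ n.+1 = M / 2 ^+ n / 2 by rewrite exprSr invfM mulrA.
    by apply: contr => //; rewrite divr_ge0 // exprn_ge0.
  have [_ /(_ t tsT)[F [Fv jF]]] := hPhi (vn 0%N) (cvn 0%N).
  have st : s <= t by between.
  have tT : t <= T by between.
  have : rnorm (Phi (vn 0%N) t) <= 0.
    have := perturbation_small s0 st (lexx t) tT Fv (esym jF) (m := 0).
    by rewrite mulr0 mul0r; apply=> r _; rewrite rnorm0.
  have := rnormD (U t s x) (Phi (vn 0%N) t); have := hM t tsT.
  have : M <= M * expR (rate * (t - s)) by rewrite ler_peMr // expR_rate_ge1.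
  by rewrite /= expr0 divr1 subr0 scale1r; lra.
have tail n k t : s <= t <= T ->
    rnorm (vn (n + k)%N t - vn n t) <=
      2 * (M / 2 ^+ n - M / 2 ^+ (n + k)) * expR (rate * (t - s)).
  move=> tsT; elim: k => [|k IH]; first by rewrite addn0 !subrr mulr0 mul0r rnorm0.
  rewrite addnS; have := diff (n + k)%N t tsT.
  have := rnorm_trans (vn (n + k)%N t) (vn (n + k).+1 t) (vn n t).
  have -> : M / 2 ^+ (n + k).+1 = M / 2 ^+ (n + k) / 2 by rewrite exprSr invfM mulrA.
  lra.
have pow_ge0 n : 0 <= M / 2 ^+ n by rewrite divr_ge0 // exprn_ge0.
have tail' n m t : s <= t <= T -> (n <= m)%N ->
    rnorm (vn m t - vn n t) <= 2 * (M / 2 ^+ n) * expR (rate * (t - s)).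
  move=> tsT /subnKC <-; apply: le_trans (tail _ _ _ tsT) _.
  rewrite ler_wpM2r ?expR_ge0 // ler_wpM2l //.
  by have := pow_ge0 (n + (m - n))%N; lra.
have /choice[v hv] : forall t, exists l, s <= t <= T -> forall e : R, 0 < e ->
    exists N, forall n, (N <= n)%N -> rnorm (vn n t - l) < e.
  move=> t; have [tsT|] := boolP (s <= t <= T); last by exists 0.
  have E0 := expR_gt0 (rate * (t - s)).
  have [|l hl] := @rcauchy_cvg R X (vn^~ t); last by exists l.
  move=> e e0; have eE : 0 < e / expR (rate * (t - s)) by rewrite divr_gt0.
  have M4 : 0 <= 4 * M by lra.
  have [N hN] := half_lt M4 eE; exists N => n m Nn Nm.
  have := rnorm_trans (vn N t) (vn n t) (vn m t).
  rewrite (rnormBC (vn N t)); have := tail' N n t tsT Nn; have := tail' N m t tsT Nm.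
  move: hN; rewrite ltr_pdivlMr //; lra.
have v_near n t : s <= t <= T ->
    rnorm (v t - vn n t) <= 2 * (M / 2 ^+ n) * expR (rate * (t - s)).
  move=> tsT; apply/ler_addgt0Pr => e e0; have [N hN] := hv t tsT e e0.
  have := rnorm_trans (vn (maxn n N) t) (v t) (vn n t).
  have := hN (maxn n N) (leq_maxr _ _); rewrite (rnormBC (v t) (vn (maxn n N) t)).
  have := tail' n (maxn n N) t tsT (leq_maxl _ _); lra.
have cv : cont_on [set t | s <= t <= T] v.
  move=> t /= tsT e e0.
  have M6 : 0 <= 6 * M by lra.
  have E0 := expR_gt0 (rate * (T - s)).
  have eE : 0 < e / expR (rate * (T - s)) by rewrite divr_gt0.
  have [N hN] := half_lt M6 eE.
  have unif y : s <= y <= T -> rnorm (v y - vn N y) < e / 3.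
    move=> ysT; apply: le_lt_trans (v_near N y ysT) _.
    apply: (@le_lt_trans _ _ (2 * (M / 2 ^+ N) * expR (rate * (T - s)))).
      rewrite ler_wpM2l ?mulr_ge0 // ler_expR ler_wpM2l //; last lra.
      exact/ltW/rate_gt0.
    by move: hN; rewrite ltr_pdivlMr //; lra.
  have e3 : 0 < e / 3 by lra.
  have [d d0 hd] := cvn N t tsT _ e3; exists d => // y /= ysT yt.
  have := rnorm_trans (vn N y) (v y) (v t).
  have := rnorm_trans (vn N t) (vn N y) (v t); rewrite (rnormBC (vn N t) (v t)).
  have := unif y ysT; have := unif t tsT; have := hd y ysT yt; lra.
have vE t : s <= t <= T -> v t = U t s x + Phi v t.
  move=> tsT; have E0 := expR_gt0 (rate * (t - s)).
  apply: (@rcvg_unique _ _ (fun n => vn n.+1 t)) => e e0.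
    by have [N hN] := hv t tsT e e0; exists N => n Nn; apply: hN; exact: leqW.
  have eE : 0 < e / expR (rate * (t - s)) by rewrite divr_gt0.
  have [N hN] := half_lt M0 eE; exists N => n Nn.
  have -> : vn n.+1 t - (U t s x + Phi v t) = Phi (vn n) t - Phi v t.
    by rewrite /=; lcomb_eq R[i].
  apply: (@le_lt_trans _ _ (M / 2 ^+ N * expR (rate * (t - s)))); last first.
    by rewrite -ltr_pdivlMr.
  have := contr (vn n) v (2 * (M / 2 ^+ N)) (cvn n) cv.
  have -> : 2 * (M / 2 ^+ N) / 2 = M / 2 ^+ N by field; rewrite expf_neq0.
  apply=> // [|r rsT]; first by rewrite mulr_ge0.
  rewrite rnormBC; apply: le_trans (v_near n r rsT) _.
  rewrite ler_wpM2r ?expR_ge0 // ler_wpM2l // ler_wpM2l //.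
  by rewrite lef_pV2 ?posrE ?exprn_gt0 // ler_eXn2l // ltr1n.
exists v; split; last first.
  by move=> t tsT; have := v_near 0%N t tsT; rewrite /= expr0 divr1 subr0.
split=> // t tsT; have [_ /(_ t tsT)[F [Fv jF]]] := hPhi v cv.
exists F; split=> //; rewrite vE // -jF.
by have [_ -> _ _ _] := additive_lin lj.
Qed.

(** A solution, restarted at a later time, solves the equation again: this is the
evolution property, once solutions are known to be unique. *)
Lemma mild_restart s x v r : 0 <= s -> s <= r -> r <= T ->
  mild s x v -> mild r (v r) v.
Proof.
move=> s0 sr rT [cv hv]; split.
  by apply: cont_on_sub cv => t /=; lra.
move=> t trT; have tsT : s <= t <= T by between.
have rsT : s <= r <= T by between.
have r0 : 0 <= r by between.
have rt : r <= t by between.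
have tT : t <= T by between.
have [F [Fv jF]] := hv r rsT; have [F' [Fv' jF']] := hv t tsT.
exists F'; split; first exact: antideriv_sub Fv'.
have [lj _] := j_bounded; have [_ _ jB _ _] := additive_lin lj.
have [_ _ UB _ _] := additive_lin (evol_lin evolU r0 rt tT).
rewrite jF' (integral_cut s0 sr rt tT Fv Fv').
have -> : F r - F s = j (v r - U r s x) by rewrite jB jF; lcomb_eq R[i].
by rewrite U1_j // UB jB -(evol_comp evolU) //; lcomb_eq R[i].
Qed.

(** Joint continuity follows from the evolution property: a change of initial time
is absorbed by an evolution over a short interval, which is uniformly close to
that of [U]. *)
Theorem perturbed_evolution_family : 0 <= T ->
  exists V : R -> R -> X -> X, evolution_family T V /\
    forall (t s : R) (x : X), 0 <= s -> s <= t -> t <= T ->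
      exists I : Z,
        has_bochner_integral `[s, t] (fun r => U1 t r (B r (V r s x))) I /\
        j (V t s x) = j (U t s x) + I.
Proof.
move=> T0; have [M M0 hM] := evol_bounded evolU.
have g0 := rate_gt0; pose C := 2 * M * expR (rate * T).
have C0 : 0 <= C by rewrite !mulr_ge0 ?expR_ge0.
have /choice[v0 hv0] : forall sx : R * X, exists v, 0 <= sx.1 <= T ->
    mild sx.1 sx.2 v /\
    forall t, sx.1 <= t <= T -> rnorm (v t) <= C * rnorm sx.2.
  move=> [s x] /=; have [sT|] := boolP (0 <= s <= T); last by exists (fun=> 0).
  have s0 : 0 <= s by between.
  have sT' : s <= T by between.
  have [||v [mv vM]] := @mild_exists s x (M * rnorm x) s0 sT'.
  - by rewrite mulr_ge0 ?rnorm_ge0.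
  - by move=> t tsT; apply: hM; between.
  exists v => _; split=> // t tsT; apply: le_trans (vM t tsT) _.
  rewrite /C mulrA mulrAC ler_wpM2r ?rnorm_ge0 // ler_wpM2l ?mulr_ge0 //.
  rewrite ler_expR ler_wpM2l; [by []|exact: ltW|lra].
pose V t s x := v0 (s, x) t.
have mV s x : 0 <= s -> s <= T -> mild s x (fun t => V t s x).
  by move=> s0 sT; have [] := hv0 (s, x) ltac:(move=> /=; between).
have V_le t s x : 0 <= s -> s <= t -> t <= T -> rnorm (V t s x) <= C * rnorm x.
  move=> s0 st tT; have [_ h] := hv0 (s, x) ltac:(move=> /=; between).
  by apply: h => /=; between.
have V_lin t s : 0 <= s -> s <= t -> t <= T -> linear (V t s).
  move=> s0 st tT c x y; have sT : s <= T by between.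
  apply: (mild_uniq s0 sT (mV s _ s0 sT)
    (mild_lin c s0 (mV s x s0 sT) (mV s y s0 sT))); between.
have V_comp t s r x : 0 <= r -> r <= s -> s <= t -> t <= T ->
    V t r x = V t s (V s r x).
  move=> r0 rs st tT; have s0 : 0 <= s by between.
  have sT : s <= T by between.
  have rT : r <= T by between.
  by apply: (mild_uniq s0 sT (mild_restart r0 rs sT (mV r x r0 rT))
    (mV s (V s r x) s0 sT)); between.
have V_id s x : 0 <= s -> s <= T -> V s s x = x.
  move=> s0 sT; have [_ h] := mV s x s0 sT.
  have [|F [_]] := h s; first between.
  rewrite subrr addr0 (evol_id evolU) // => /(j_inj j_bounded P_bounded P_jK) ->.
  by [].
have V_close t s x : 0 <= s -> s <= t -> t <= T ->
    rnorm (V t s x - U t s x) <= KU * CB * C * rnorm x * (t - s).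
  move=> s0 st tT; have sT : s <= T by between.
  have [_ h] := mV s x s0 sT.
  have [|F [Fv jF]] := h t; first between.
  have [lj _] := j_bounded; have [_ _ jB _ _] := additive_lin lj.
  rewrite -[_ * C * rnorm x]mulrA.
  apply: (perturbation_small s0 st (lexx t) tT Fv).
    by rewrite jB jF; lcomb_eq R[i].
  by move=> r rst; apply: V_le; between.
have V_start s x e : 0 <= s -> s <= T -> 0 < e -> exists2 d : R, 0 < d &
    forall m s', 0 <= s' -> s' <= m -> m <= T -> `|m - s| < d -> `|s' - s| < d ->
      rnorm (V m s' x - x) < e.
  move=> s0 sT e0; have e2 : 0 < e / 2 by lra.
  have [d d0 hd] := evol_cont evolU x s0 (lexx s) sT e2.
  have K0 : 0 <= KU * CB * C * rnorm x by rewrite !mulr_ge0 ?rnorm_ge0.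
  have e4 : 0 < e / 4 by lra.
  have [d' d'0 d'e] := small_factor K0 e4.
  exists (Num.min d d'); first by rewrite lt_min d0.
  move=> m s' s'0 s'm mT; rewrite !lt_min => /andP[md md'] /andP[sd sd'].
  have := hd m s' s'0 s'm mT md sd; rewrite (evol_id evolU) // => h1.
  have h2 := V_close m s' x s'0 s'm mT.
  have h3 : KU * CB * C * rnorm x * (m - s') <= 2 * (e / 4).
    apply: (@le_trans _ _ (KU * CB * C * rnorm x * (2 * d'))).
      rewrite ler_wpM2l //; move: md' sd'; rewrite !ltr_norml; lra.
    by rewrite mulrCA ler_wpM2l.
  by have := rnorm_trans (U m s' x) (V m s' x) x; lra.
exists V; split; last first.
  move=> t s x s0 st tT; have sT : s <= T by between.
  have [cv h] := mV s x s0 sT; have [|F [Fv jF]] := h t; first between.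
  exists (F t - F s); split=> //; apply: bochner_antideriv => //.
  apply: integrand_cont => //; apply: cont_on_sub cv => r /=; lra.
split=> //.
  move=> t s s0 st tT; apply/bounded_opP; split; first exact: V_lin.
  by exists C => // x; exact: V_le.
move=> x; apply/within2_cont => t s [/= s0 /andP[st tT]] e e0.
have sT : s <= T by between.
have [st'|ts] := ltP s t; last first.
  have -> : t = s by lra.
  rewrite V_id //; have [d d0 hd] := V_start s x e s0 sT e0.
  by exists d => // t' s' [/= ? /andP[? ?]]; apply: hd.
have e3 : 0 < e / 3 by lra.
have [e' e'0 e'e] := small_factor C0 e3.
have [d d0 hd] := V_start s x e' s0 sT e'0.
have [cv _] := mV s x s0 sT.
have [d1 d10 hd1] := cv t ltac:(move=> /=; between) _ e3.
exists (Num.min (Num.min d d1) ((t - s) / 2)); first by rewrite !lt_min d0 d10; lra.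
move=> t' s' [/= s'0 /andP[s't' t'T]]; rewrite !lt_min.
move=> /andP[/andP[td td1] tts] /andP[/andP[sd sd1] sts].
(* Both orbits are restarted at the later of the two initial times. *)
pose m := Num.max s s'.
have sm : s <= m by rewrite /m le_max lexx.
have s'm : s' <= m by rewrite /m le_max lexx orbT.
have mt' : m <= t'.
  by rewrite /m ge_max s't' andbT; move: tts sts; rewrite !ltr_norml; lra.
have m0 : 0 <= m by between.
have mT : m <= T by between.
have ss : `|s - s| < d by rewrite subrr normr0.
have md : `|m - s| < d.
  have [ss'|/ltW s's] := leP s s'; first by rewrite /m max_r.
  by rewrite /m max_l.
have [_ _ VB _ _] := additive_lin (V_lin t' m m0 mt' t'T).
have shift r : 0 <= r -> r <= m -> `|r - s| < d -> rnorm (V t' r x - V t' m x) <= e / 3.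
  move=> r0 rm rd; rewrite (V_comp t' m r) // -VB; apply: le_trans (V_le _ _ _ _ _ _) _ => //.
  by apply: le_trans e'e; rewrite ler_wpM2l // ltW // hd.
have h1 := shift s' s'0 s'm sd; have h2 := shift s s0 sm ss.
have h3 := hd1 t' ltac:(move=> /=; between) td1.
have := rnorm_trans (V t' m x) (V t' s' x) (V t s x).
have := rnorm_trans (V t' s x) (V t' m x) (V t s x).
rewrite (rnormBC (V t' m x) (V t' s x)); lra.
Qed.

End Volterra.

(** * Extrapolation spaces *)

Section Translation.
Context {R : realType}.
Implicit Types V W : normedModType R[i].

Lemma opnorm_le V W (f : V -> W) (C : R) : 0 <= C ->
  (forall a x, f (a *: x) = a *: f x) -> (opnorm f <= C%:E)%E ->
  forall x, rnorm (f x) <= C * rnorm x.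
Proof.
move=> C0 fZ fC x.
have f1 y : rnorm y <= 1 -> rnorm (f y) <= C.
  move=> y1; rewrite -lee_fin; apply: le_trans fC.
  by apply: ereal_sup_ubound; exists y.
have [/rnorm_eq0 ->|x0] := eqVneq (rnorm x) 0.
  have -> : f 0 = 0 by have := fZ 0 0; rewrite !scale0r.
  by rewrite !rnorm0 mulr0.
have {}x0 : 0 < rnorm x by rewrite lt_neqAle eq_sym x0 rnorm_ge0.
have := f1 ((rnorm x)^-1%:C *: x).
rewrite fZ !rnormZr gtr0_norm ?invr_gt0 // mulVf ?gt_eqF // lexx.
by rewrite ler_pdivrMl // mulrC; apply.
Qed.

Lemma derivative_within_antideriv V a b (F f : R -> V) :
  (forall t, a <= t <= b -> derivative_within `[a, b] F t (f t)) ->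
  antideriv a b F f.
Proof.
move=> dF t tab e e0; have /rcvgP/(_ e e0) := dF t tab.
case/nbhs_ballP => d /= d0 hd; exists d => // y yab yt.
have [->|ty] := eqVneq y t.
  rewrite !subrr scale0r subr0 rnorm0 mulr_ge0 //; exact: ltW.
have yt0 : y - t != 0 by rewrite subr_eq0.
have := hd (y - t); rewrite -ball_normE /= sub0r normrN => /(_ yt yt0).
rewrite /= in_itv /= addrC subrK => /(_ yab) /ltW h.
have -> : F y - F t - (y - t)%:C *: f t =
    - ((y - t)%:C *: (f t - (y - t)^-1%:C *: (F y - F t))).
  have : (y - t)%:C *: ((y - t)^-1%:C *: (F y - F t)) = F y - F t.
    by rewrite scalerA -rmorphM /= divff // scale1r.
  by move: (_^-1%:C *: _) => q <-; lcomb_eq R[i].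
by rewrite rnormN rnormZr mulrC ler_wpM2r.
Qed.

(** The preimages of a Cauchy sequence form a Cauchy sequence, so the range is
closed. *)
Lemma dense_isometry_surj (V : completeNormedModType R[i]) W (f : V -> W) :
  linear f -> (forall x, rnorm (f x) = rnorm x) ->
  dense (range f) -> forall z, exists x, f x = z.
Proof.
move=> lf isof /dense_rnormP df z; have [_ _ fB _ _] := additive_lin lf.
have /choice[u hu] : forall n : nat, exists x, rnorm (z - f x) < 1 / 2 ^+ n.
  move=> n; have [|_ [x _ <-] h] := df z (1 / 2 ^+ n); last by exists x.
  by rewrite divr_gt0 // exprn_gt0.
have half_mono n m : (n <= m)%N -> 1 / 2 ^+ m <= 1 / 2 ^+ n :> R.
  by move=> nm; rewrite ler_pM2l // lef_pV2 ?posrE ?exprn_gt0 // ler_eXn2l // ltr1n.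
have [|l hl] := @rcauchy_cvg R V u.
  move=> e e0; have e2 : 0 < e / 2 by lra.
  have [N hN] := half_lt (@ler01 R) e2; exists N => n m Nn Nm.
  rewrite -isof fB; have := rnorm_trans z (f (u n)) (f (u m)).
  rewrite (rnormBC (f (u n)) z); have := hu n; have := hu m.
  have := half_mono _ _ Nn; have := half_mono _ _ Nm; lra.
exists l; apply: (@rcvg_unique _ _ (fun n => f (u n))) => e e0.
  by have [N hN] := hl e e0; exists N => n Nn; rewrite -fB isof; exact: hN.
have [N hN] := half_lt (@ler01 R) e0; exists N => n Nn; rewrite rnormBC.
by apply: lt_trans (hu n) _; apply: le_lt_trans (half_mono _ _ Nn) hN.
Qed.

Lemma dense_eq V W (f g : V -> W) (D : set V) : rbounded f -> rbounded g ->
  dense D -> (forall x, D x -> f x = g x) -> forall x, f x = g x.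
Proof.
move=> [lf [C C0 hC]] [lg [C' C'0 hC']] /dense_rnormP dD fg x.
have [_ _ fB _ _] := additive_lin lf; have [_ _ gB _ _] := additive_lin lg.
apply/eqP; rewrite -subr_eq0; apply/eqP/rnorm_eq0/eqP.
rewrite eq_le rnorm_ge0 andbT; apply/ler_addgt0Pr => e e0; rewrite add0r.
have [d d0 de] := small_factor (addr_ge0 C0 C'0) e0.
have [y Dy xy] := dD x d d0; apply: le_trans de.
have -> : f x - g x = f (x - y) - g (x - y).
  by rewrite fB gB (fg y Dy); lcomb_eq R[i].
apply: le_trans (rnormB _ _) _.
have := hC (x - y); have := hC' (x - y); have := rnorm_ge0 (x - y); nra.
Qed.

End Translation.

Section Extrapolated.
Context {R : realType}.
Variables (X Z : completeNormedModType R[i]) (A : unbounded_op X) (M : R).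
Variables (S : R -> X -> X) (j A1 : X -> Z) (S1 : R -> Z -> Z).
Hypothesis M_ge0 : 0 <= M.
Hypothesis resA : resolvent_set A 0.
Hypothesis invA : (opnorm (op_inv A) <= M%:E)%E.
Hypothesis denseA : dense (dom A).
Hypothesis extrA : extrapolation A S j A1 S1.

Lemma op_invP x : dom A (op_inv A x) /\ A (op_inv A x) = x.
Proof.
have [[_ injA surA] _] := resA.
have [y Dy yx] := surA (- x) Logic.I.
have Ayx : A y = x by move: yx; rewrite scale0r sub0r => /oppr_inj.
have inj : {in dom A &, injective A}.
  move=> u v Du Dv uv; apply: injA => //; by rewrite /= !scale0r uv.
have <- : y = op_inv A x.
  by rewrite -Ayx /op_inv /inverse_on pinvKV //; exact/mem_set.
by [].
Qed.

Lemma ext_j_bounded : rbounded j.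
Proof.
have [_ [lj jE _] _ _] := extrA; split=> //; exists M => //.
apply: opnorm_le => //; first by have [_ _ _ + _] := additive_lin lj; apply.
apply: le_trans invA; apply: ge_ereal_sup => _ [x x1 <-].
by rewrite jE; apply: ereal_sup_ubound; exists x.
Qed.

(** Hence the range of [A1] contains the dense image of [X]. *)
Lemma A1_op_inv x : A1 (op_inv A x) = j x.
Proof.
have [_ _ [_ _ A1E] _] := extrA; have [Dx Ax] := op_invP x.
by rewrite A1E // Ax.
Qed.

Lemma A1_surj z : exists x, A1 x = z.
Proof.
have [_ [_ _ dj] [lA1 A1n _] _] := extrA.
apply: (dense_isometry_surj lA1 A1n); apply/dense_rnormP => w e e0.
move/dense_rnormP: dj => /(_ w e e0)[_ [x _ <-] h].
by exists (j x) => //; exists (op_inv A x) => //; exact: A1_op_inv.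
Qed.

Lemma A1_inj x y : A1 x = A1 y -> x = y.
Proof.
have [_ _ [lA1 A1n _] _] := extrA; have [_ _ A1B _ _] := additive_lin lA1.
move=> xy; apply/eqP; rewrite -subr_eq0; apply/eqP/rnorm_eq0.
by rewrite -A1n A1B xy subrr rnorm0.
Qed.

Lemma semigroup_bounded h : 0 <= h -> rbounded (S h).
Proof.
by move=> h0; apply/bounded_opP; have [[[_ _ + _] _] _ _ _] := extrA; apply.
Qed.

(** The operator [S h] maps the difference quotients at [x] to those at [S h x]. *)
Lemma semigroup_commute h x : 0 <= h -> dom A x ->
  dom A (S h x) /\ A (S h x) = S h (A x).
Proof.
move=> h0 Dx; have [[[S0 SD Sb Sc] genA] _ _ _] := extrA.
have [lS [C C0 hC]] := semigroup_bounded h0.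
have [_ _ SB SZ _] := additive_lin lS.
apply/genA/rcvgP => e e0.
have e2 : 0 < e / 2 by lra.
have [d d0 de] := small_factor C0 e2.
have := (genA x (A x)).1 (conj Dx erefl) => /rcvgP/(_ d d0).
rewrite /at_right; apply: filter_app; rewrite /within /=.
apply: nearW => k k0 /ltW hk.
have {}k0 : 0 <= k by exact: ltW.
have -> : S k (S h x) = S h (S k x) by rewrite -!SD // addrC.
rewrite -SB -SZ -SB; apply: le_lt_trans (hC _) _.
have := ler_wpM2l C0 hk; lra.
Qed.

(** Both sides are continuous and agree on the domain of [A]. *)
Lemma A1_semigroup h x : 0 <= h -> A1 (S h x) = S1 h (A1 x).
Proof.
move=> h0; have [_ _ [lA1 A1n A1E] extS] := extrA.
have [/bounded_opP S1b S1E] := extS h h0.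
have [lS1 [D D0 hD]] := S1b; have [lS [C C0 hC]] := semigroup_bounded h0.
apply: (@dense_eq _ _ _ (A1 \o S h) (S1 h \o A1) (dom A)) => //=.
- split; first by move=> c u v /=; rewrite lS lA1.
  by exists C => // u; rewrite A1n.
- split; first by move=> c u v /=; rewrite lA1 lS1.
  by exists D => // u; apply: le_trans (hD _) _; rewrite A1n.
- move=> u Du; have [DSu ASu] := semigroup_commute h0 Du.
  by rewrite A1E // ASu -S1E A1E.
Qed.

Definition quotient_step (n : nat) : R := n.+1%:R^-1.
(** With [Y] inverse to [A1], these are approximations of [z] by elements of [X]: in [Z]
they converge to the extrapolated generator at [Y z], that is, to [z]. *)
Definition difference_quotient (Y : Z -> X) (n : nat) (z : Z) : X :=
  (quotient_step n)^-1%:C *: (S (quotient_step n) (Y z) - Y z).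

Lemma quotient_step_gt0 n : 0 < quotient_step n.
Proof. by rewrite invr_gt0. Qed.

Variable Y : Z -> X.
Hypothesis A1Y : forall z, A1 (Y z) = z.
Local Notation P := (difference_quotient Y).

Lemma YA1 x : Y (A1 x) = x.
Proof. by apply: A1_inj; rewrite A1Y. Qed.

Lemma quotient_bounded n : rbounded (P n).
Proof.
have [_ _ [lA1 A1n _] _] := extrA.
have h0 := ltW (quotient_step_gt0 n).
have [lS [C C0 hC]] := semigroup_bounded h0.
have lY : linear Y by move=> c u v; apply: A1_inj; rewrite lA1 !A1Y.
split=> [c u v|].
  by rewrite /difference_quotient lY lS; lcomb_eq R[i].
exists ((quotient_step n)^-1 * (C + 1)).
  by rewrite mulr_ge0 ?invr_ge0 // addr_ge0.
move=> z; rewrite /difference_quotient rnormZr ger0_norm ?invr_ge0 //.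
rewrite -mulrA ler_wpM2l ?invr_ge0 //; apply: le_trans (rnormB _ _) _.
by have := hC (Y z); rewrite -(A1n (Y z)) A1Y; lra.
Qed.

(** The preimage of [j x] is [op_inv A x], where the semigroup is differentiable with
derivative [x]. *)
Lemma quotient_jK x (e : R) : 0 < e ->
  exists N, forall n, (N <= n)%N -> rnorm (P n (j x) - x) < e.
Proof.
move=> e0; have [[_ genA] _ _ _] := extrA; have [Dx Ax] := op_invP x.
have := (genA _ _).1 (conj Dx Ax) => /rcvgP/(_ e e0).
case/nbhs_ballP => d /= d0 hd.
have d1 : 0 <= d^-1 by rewrite invr_ge0 ltW.
exists (Num.bound d^-1) => n Nn.
have sd : quotient_step n < d.
  rewrite /quotient_step -[d]invrK ltf_pV2 ?posrE ?invr_gt0 //.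
  by apply: lt_le_trans (archi_boundP d1) _; rewrite ler_nat leqW.
rewrite rnormBC /difference_quotient -A1_op_inv YA1; apply: hd.
  by rewrite -ball_normE /= sub0r normrN gtr0_norm ?quotient_step_gt0.
exact: quotient_step_gt0.
Qed.

Lemma j_quotient n z : j (P n z) = A1 (P n (j (Y z))).
Proof.
have [_ [lj _ _] [lA1 _ A1E] _] := extrA.
have [_ _ A1B A1Z _] := additive_lin lA1.
have [_ _ jB jZ _] := additive_lin lj.
have h0 := ltW (quotient_step_gt0 n).
have [Dx Ax] := op_invP (Y z).
have [DS AS] := semigroup_commute h0 Dx.
by rewrite /difference_quotient -(A1_op_inv (Y z)) YA1 A1Z A1B !A1E // AS Ax -jB -jZ.
Qed.

(** Convergence in [Z] at [z = A1 y] is convergence in [X] at [y], by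
[j_quotient]. *)
Lemma j_quotientK z (e : R) : 0 < e ->
  exists N, forall n, (N <= n)%N -> rnorm (j (P n z) - z) < e.
Proof.
move=> e0; have [_ _ [lA1 A1n _] _] := extrA.
have [_ _ A1B _ _] := additive_lin lA1.
have [N hN] := quotient_jK (Y z) e0; exists N => n Nn.
by rewrite j_quotient -{2}(A1Y z) -A1B A1n; exact: hN.
Qed.

(** This is the definition of the Favard norm, read through the isometry [A1]. *)
Lemma favard_fav (C : R) z : (favard_norm S1 z <= C%:E)%E -> fav P C z.
Proof.
move=> zC n; have [_ _ [lA1 A1n _] _] := extrA.
have [_ _ A1B A1Z _] := additive_lin lA1.
have h0 := quotient_step_gt0 n.
rewrite -A1n /difference_quotient A1Z A1B A1_semigroup ?A1Y; last exact: ltW.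
rewrite rnormZr gtr0_norm ?invr_gt0 // -lee_fin; apply: le_trans zC.
by apply: ereal_sup_ubound; exists (quotient_step n).
Qed.

End Extrapolated.

(** * The unperturbed evolution family *)

Section Restriction.
Context {R : realType}.
Variables (X Z : completeNormedModType R[i]) (T : R) (j : X -> Z).
Variables (A : R -> unbounded_op X) (a : R -> X -> Z).
Variables (U : R -> R -> X -> X) (U1 : R -> R -> Z -> Z).
Hypothesis j_bounded : rbounded j.
Hypotheses (evolU : evolution_family T U) (evolU1 : evolution_family T U1).
Hypothesis solvU : solved_by T A U.
Hypothesis aE : forall t x, 0 <= t <= T -> dom (A t) x -> a t x = j (A t x).
Hypothesis U1_deriv : forall t x, 0 <= t <= T ->
  antideriv 0 t (fun s => U1 t s (j x)) (fun s => - U1 t s (a s x)).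

(** Along a classical solution [u], the derivative of [U1 t r (j (u r))] in [r]
vanishes: the two terms of the product rule cancel. *)
Lemma pullback_derivative t s u du : 0 <= s -> s <= t -> t <= T ->
  antideriv s t u du ->
  (forall r, s <= r <= t -> dom (A r) (u r) /\ du r = A r (u r)) ->
  antideriv s t (fun r => U1 t r (j (u r))) (fun=> 0).
Proof.
move=> s0 st tT u_du uA r rst e e0.
have [lj [Cj Cj0 hCj]] := j_bounded; have [j0 jD jB jZ _] := additive_lin lj.
have [M M0 hM] := evol_bounded evolU1.
have e3 : 0 < e / 3 by lra.
have r0t : 0 <= r <= t by between.
have t0T : 0 <= t <= T by between.
have [rD rA] := uA r rst.
have [e1 e10 e1e] := small_factor (mulr_ge0 M0 Cj0) e3.
have [d1 d10 h1] := u_du r rst _ e10.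
have [d2 d20 h2] := U1_deriv (u r) t0T r0t e3.
have [|||d3 d30 h3] := evol_cont evolU1 (j (du r)) (t := t) (s := r) _ _ _ e3; [between..|].
exists (Num.min d1 (Num.min d2 d3)); first by rewrite !lt_min d10 d20.
move=> y yst; rewrite !lt_min => /and3P[yr1 yr2 yr3].
have y0 : 0 <= y by between.
have yt : y <= t by between.
have [_ _ UB UZ _] := additive_lin (evol_lin evolU1 y0 yt tT).
have [_ _ _ UrZ _] := additive_lin (evol_lin evolU1 (t := t) (s := r) ltac:(between) ltac:(between) tT).
pose h := (y - r)%:C.
have -> : U1 t y (j (u y)) - U1 t r (j (u r)) - (y - r)%:C *: 0 =
  U1 t y (j (u y - u r - h *: du r)) +
  h *: (U1 t y (j (du r)) - U1 t r (j (du r))) +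
  (U1 t y (j (u r)) - U1 t r (j (u r)) - h *: (- U1 t r (a r (u r)))).
  have rT : 0 <= r <= T by between.
  by rewrite aE // -rA !jB jZ !UB UZ; lcomb_eq R[i].
have n1 := h1 y yst yr1.
have n2 := h2 y ltac:(between) yr2.
have n3 := h3 t y y0 yt tT ltac:(rewrite subrr normr0) yr3.
have a0 := normr_ge0 (y - r).
apply: le_trans (rnormD _ _) _.
have m1 : rnorm (U1 t y (j (u y - u r - h *: du r))) <= e / 3 * `|y - r|.
  apply: le_trans (hM _ _ _ y0 yt tT) _.
  apply: le_trans (ler_wpM2l M0 (hCj _)) _.
  rewrite mulrA; apply: le_trans (ler_wpM2l (mulr_ge0 M0 Cj0) n1) _.
  by rewrite mulrA ler_wpM2r.
have m3 : rnorm (h *: (U1 t y (j (du r)) - U1 t r (j (du r)))) <= e / 3 * `|y - r|.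
  rewrite rnormZr [leLHS]mulrC; apply: ler_wpM2r => //.
  exact: ltW (n3 d30).
have := rnormD (U1 t y (j (u y - u r - h *: du r)))
  (h *: (U1 t y (j (du r)) - U1 t r (j (du r)))).
have -> : e * `|y - r| = e / 3 * `|y - r| + e / 3 * `|y - r| + e / 3 * `|y - r| by field.
rewrite -/h in n2; lra.
Qed.

Lemma evolution_restriction t s x : 0 <= s -> s <= t -> t <= T ->
  U1 t s (j x) = j (U t s x).
Proof.
move=> s0 st tT; have [Y [Yd YU YA Ysol]] := solvU.
have sT : 0 <= s <= T by between.
have [_ dY] := Yd s sT.
have [lj [Cj Cj0 hCj]] := j_bounded.
have [lU1 [M M0 hM]] := evol_rbounded evolU1 s0 st tT.
have [lU [M' M'0 hM']] := evol_rbounded evolU s0 st tT.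
apply: (@dense_eq _ _ _ (U1 t s \o j) (j \o U t s) (Y s)) => //=.
- split; first by move=> c u v /=; rewrite lj lU1.
  exists (M * Cj) => [|u]; first exact: mulr_ge0.
  by apply: le_trans (hM _) _; rewrite -mulrA ler_wpM2l.
- split; first by move=> c u v /=; rewrite lU lj.
  exists (Cj * M') => [|u]; first exact: mulr_ge0.
  by apply: le_trans (hCj _) _; rewrite -mulrA ler_wpM2l.
move=> y Yy; have [[du [cu cdu hdu]] us] := Ysol s y sT Yy.
have uu : antideriv s t (fun r => U r s y) du.
  apply: (antideriv_sub (lexx s) tT); apply: derivative_within_antideriv.
  by move=> r rsT; have [] := hdu r rsT.
have uA r : s <= r <= t -> dom (A r) (U r s y) /\ du r = A r (U r s y).
  by move=> rst; have [|] := hdu r; first between.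
have := pullback_derivative s0 st tT uu uA.
move=> /(antideriv_le (K := 0) st) h.
have {h} : rnorm (U1 t t (j (U t s y)) - U1 t s (j (U s s y))) <= 0.
  by rewrite -[leRHS](mul0r (t - s)); apply: h => r _; rewrite rnorm0.
rewrite us (evol_id evolU1) //; last between.
move=> h; apply/eqP; rewrite eq_sym -subr_eq0; apply/eqP/rnorm_eq0/eqP.
by rewrite eq_le rnorm_ge0 h.
Qed.

End Restriction.

(** * The perturbation *)

Section Perturbation.
Context {R : realType}.
Local Notation mu := (@lebesgue_measure R).

(** Every neighbourhood of a point of [[a, b]] meets the segment in a set of positive
length. *)
Lemma closed_full (a b : R) (C : set R) : a < b -> closed C ->
  {ae mu, forall r, a <= r <= b -> C r} -> forall r, a <= r <= b -> C r.
Proof.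
move=> ab clC [N [mN N0 hN]] r rab; apply: clC => V /nbhs_ballP[d /= d0 hd].
pose p := Num.max a (r - d / 2); pose q := Num.min b (r + d / 2).
have pq : p < q by rewrite lt_min !gt_max; lra.
have ap : a <= p by rewrite le_max lexx.
have qb : q <= b by rewrite ge_min lexx.
have pr : r - d / 2 <= p by rewrite le_max lexx orbT.
have qr : q <= r + d / 2 by rewrite ge_min lexx orbT.
have [|nC] := pselect ([set` `[p, q]] `&` C !=set0).
  move=> [x [/=]]; rewrite in_itv /= => xpq Cx; exists x; split=> //.
  by apply: hd; rewrite -ball_normE /= ltr_norml; lra.
have : (mu `[p, q] <= mu N)%E.
  apply: le_measure; rewrite ?inE //.
  move=> x; rewrite /= in_itv /= => xpq; apply: hN => /= h; apply: nC.
  exists x; split; first by rewrite /= in_itv.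
  by apply: h; between.
rewrite [X in (_ <= X)%E]N0 lebesgue_measure_itv /= lte_fin pq -EFinB lee_fin.
by lra.
Qed.

Variables (X Z : completeNormedModType R[i]) (P : nat -> Z -> X).
Hypothesis P_bounded : forall n, rbounded (P n).
Variables (S1 : R -> Z -> Z) (T : R) (B : R -> X -> Z).
Hypothesis T_gt0 : 0 < T.
Hypothesis favard_fav : forall (C : R) z, (favard_norm S1 z <= C%:E)%E -> fav P C z.
Hypothesis B_Linfty : Linfty_strong S1 T B.
Hypothesis B_Lip : Lip_strong T B.

Lemma Lip_cont x : cont_on [set t | 0 <= t <= T] (fun t => B t x).
Proof.
move=> t /= tT e e0; have [_ /(_ x)[C hC]] := B_Lip.
have C0 : 0 <= `|C| := normr_ge0 C.
have e2 : 0 < e / 2 by lra.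
have [d d0 de] := small_factor C0 e2; exists d => // y yT yt.
apply: le_lt_trans (hC y t yT tT) _.
have := ler_wpM2l C0 (ltW yt).
have : C * `|y - t| <= `|C| * `|y - t| by rewrite ler_wpM2r // ler_norm.
by lra.
Qed.

Let I := {t : R | 0 <= t <= T}.

Lemma B_uniform : exists2 C : R, 0 <= C & forall t x, 0 <= t <= T ->
  rnorm (B t x) <= C * rnorm x.
Proof.
have [||C C0 hC] := @uniform_boundedness R X Z I (fun t => B (sval t)).
- by move=> [t tT]; apply/bounded_opP; have [+ _] := B_Lip; apply.
- move=> x; have [m _ hm] := cont_on_bounded (ltW T_gt0) (@Lip_cont x).
  by exists m => -[t tT]; apply: hm.
by exists C => // t x tT; exact: (hC (exist _ t tT)).
Qed.

(** The essential bound holds at every time, because the Favard balls are closed in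
[Z] and [B] is strongly continuous there; it is uniform by the uniform
boundedness principle. *)
Lemma B_fav_uniform : exists2 C : R, 0 <= C & forall t x, 0 <= t <= T ->
  fav P (C * rnorm x) (B t x).
Proof.
have [||C C0 hC] := @uniform_boundedness R X X (I * nat)%type
  (fun tn x => P tn.2 (B (sval tn.1) x)).
- move=> [[t tT] n] /=.
  have [/(_ t tT)/bounded_opP[lB [D D0 hD]] _] := B_Lip.
  have [lP [D' D'0 hD']] := P_bounded n; split.
    by move=> c u v; rewrite lB lP.
  exists (D' * D) => [|u]; first exact: mulr_ge0.
  by apply: le_trans (hD' _) _; rewrite -mulrA ler_wpM2l.
- move=> x; have [_ /(_ x)[_ _ [C hC]]] := B_Linfty; exists C => -[[t tT] n] /=.
  have clE := fav_closed_set P_bounded (r := C) (@Lip_cont x).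
  have [|_] := @closed_full 0 T _ T_gt0 clE _ t tT; last exact.
  have [N [mN N0 hN]] := hC; exists N; split=> // r nr; apply: hN => h.
  apply: nr => rT; split=> //; apply: favard_fav; apply: h.
  by rewrite /= in_itv.
by exists C => // t x tT n; exact: (hC (exist _ t tT, n)).
Qed.

(** Countably many values suffice: the partial sums of the values of the simple
functions that approximate [B x] for [x] in a countable dense set. *)
Lemma countable_values : separable_space X ->
  exists z : nat -> Z, forall s t v, 0 <= s -> t <= T ->
    cont_on [set r | s <= r <= t] v ->
    {ae mu, forall r, s <= r <= t -> forall e, 0 < e ->
       exists n, fav P e (B r (v r) - z n)}.
Proof.
move=> [D /pcard_leP/unsquash f /dense_rnormP dD].
have [CB CB0 B_fav] := B_fav_uniform.
have /choice[x hx] : forall k : nat, exists x, (exists2 y, D y & f y = k) ->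
    D x /\ f x = k.
  move=> k; have [[y Dy fy]|] := pselect (exists2 y, D y & f y = k).
    by exists y.
  by exists 0.
have /choice[phi hphi] : forall k, exists phi : nat -> simple_fun Z,
    {ae mu, forall t, `[0, T]%classic t ->
      favard_norm S1 (B t (x k) - sf_app (phi n) t) @[n --> \oo] --> 0%E}.
  move=> k; have [_ /(_ (x k))[_ [phi [_ hphi]] _]] := B_Linfty.
  by exists phi.
pose value (q : nat * nat * seq bool) : Z :=
  \sum_(i < sf_size (phi q.1.1 q.1.2))
    ((nth false q.2 i)%:R : R)%:C *: @sf_val _ _ (phi q.1.1 q.1.2) i.
exists (fun m => if unpickle m is Some q then value q else 0).
move=> s t v s0 tT cv.
have [N [mN N0 hN]] := ae_foralln hphi.
exists N; split=> // r nr; apply: hN => hr; apply: nr => rst e e0.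
have e2 : 0 < e / 2 by lra.
have rT : 0 <= r <= T by between.
have [d d0 de] := small_factor CB0 e2.
have [y Dy vy] := dD (v r) d d0.
have [Dx fx] := hx (f y) (ex_intro2 _ _ y Dy erefl).
have xy : x (f y) = y.
  by apply: (inj (f := f)) => //; rewrite inE.
have := hr (f y) ltac:(rewrite /= in_itv /=; between).
move=> /fine_cvgP[fin /cvgrPdist_lt/(_ _ e2) small].
have [n _ /(_ n (leqnn n)) [fin_n]] := filterI fin small.
rewrite sub0r normrN /= => small_n.
pose sf := phi (f y) n.
(* [bits] records which of the sets of the simple function contain [r]. *)
pose bits := mkseq (fun i => if insub i is Some k then r \in @sf_set _ _ sf k else false)
  (sf_size sf).
exists (pickle (f y, n, bits)); rewrite pickleK.
have -> : value (f y, n, bits) = sf_app sf r.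
  rewrite /value /sf_app /=; apply: eq_bigr => k _; congr (_%:C *: _).
  by rewrite nth_mkseq // (valK k) indicE.
have -> : B r (v r) - sf_app sf r = B r (v r - y) + (B r (x (f y)) - sf_app sf r).
  have [/(_ r rT)[lB _] _] := B_Lip; have [_ _ -> _ _] := additive_lin lB.
  by rewrite xy; lcomb_eq R[i].
have -> : e = e / 2 + e / 2 by field.
apply: (favD P_bounded).
  apply: fav_le (B_fav r _ rT).
  by have := ler_wpM2l CB0 (ltW vy); lra.
apply: favard_fav; rewrite -(fineK fin_n) lee_fin ltW //.
by apply: le_lt_trans small_n; exact: ler_norm.
Qed.

End Perturbation.

(** * The perturbed evolution family *)

Theorem theorem3p10 (R : realType) (X : completeNormedModType R[i])
    (sepX : separable_space X)
    (T : R) (T_gt0 : 0 < T)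
    (A : R -> unbounded_op X)
    (clA : forall t : R, 0 <= t <= T -> closed_op (A t) /\ dense (dom (A t)))
    (sectA : sectorial_family T A)
    (* the semigroups generated by the [A t], and the spaces [X_{-1}(A t)] *)
    (S : R -> R -> X -> X)
    (Z : R -> completeNormedModType R[i])
    (j : forall t, X -> Z t)
    (A1 : forall t, X -> Z t)
    (S1 : forall t, R -> Z t -> Z t)
    (extrA : forall t : R, 0 <= t <= T ->
       extrapolation (A t) (S t) (j t) (A1 t) (S1 t))
    (* [iota t] identifies [X_{-1}(A t)] with [X_{-1} = X_{-1}(A 0)] *)
    (iota : forall t, Z t -> Z 0)
    (iotaP : forall t : R, 0 <= t <= T ->
       [/\ linear (iota t), bijective (iota t)
         & forall x, iota t (j t x) = j 0 x])
    (iota_norm : exists kappa : R, 0 < kappa /\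
       forall (t : R) (z : Z t), 0 <= t <= T ->
         kappa^-1 * rnorm (iota t z) <= rnorm z /\
         rnorm z <= kappa * rnorm (iota t z))
    (* [iota t \o A1 t] is [A_{-1}(t)] as an operator in [X_{-1}] *)
    (lipA : Lip_generators T (fun t => iota t \o A1 t))
    (U : R -> R -> X -> X)
    (evolU : evolution_family T U)
    (solvU : solved_by T A U)
    (U1 : R -> R -> Z 0 -> Z 0)
    (extrU : extrapolated_evolution_family T (j 0) (fun t => iota t \o A1 t) U1)
    (B : R -> X -> Z 0)
    (BLinfty : Linfty_strong (S1 0) T B)
    (BLip : Lip_strong T B) :
  exists V : R -> R -> X -> X,
    evolution_family T V /\
    forall (t s : R) (x : X), 0 <= s -> s <= t -> t <= T ->
      exists I : Z 0,
        has_bochner_integral `[s, t]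
          (fun r => U1 t r (B r (V r s x))) I /\
        j 0 (V t s x) = j 0 (U t s x) + I.
Proof.
have [theta [M [theta_gt theta_lt M1 secA]]] := sectA.
have M0 : 0 <= M by lra.
have t00 : 0 <= (0 : R) <= T by rewrite lexx ltW.
have resA t : 0 <= t <= T -> resolvent_set (A t) 0.
  move=> tT; have [sub _ _] := secA t tT; apply: sub.
  exists 0, 0; split=> //; last by rewrite !mul0r.
  by rewrite normr0; have := pi_gt0 R; lra.
have invA t : 0 <= t <= T -> (opnorm (op_inv (A t)) <= M%:E)%E.
  by move=> /secA[].
have denseA t : 0 <= t <= T -> dense (dom (A t)) by move=> /clA[].
have j_b : rbounded (j 0) := ext_j_bounded M0 (invA 0 t00) (extrA 0 t00).
have /choice[Y A1Y] := A1_surj (resA 0 t00) (extrA 0 t00).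
pose P := difference_quotient (S 0) Y.
have P_b n : rbounded (P n) := quotient_bounded (extrA 0 t00) A1Y n.
have P_jK := quotient_jK (resA 0 t00) (extrA 0 t00) A1Y : forall x e, 0 < e ->
  exists N, forall n, (N <= n)%N -> rnorm (P n (j 0 x) - x) < e.
have j_PK := j_quotientK (resA 0 t00) (extrA 0 t00) A1Y : forall z e, 0 < e ->
  exists N, forall n, (N <= n)%N -> rnorm (j 0 (P n z) - z) < e.
have fav_P := favard_fav (denseA 0 t00) (extrA 0 t00) A1Y :
  forall (C : R) z, (favard_norm (S1 0%R) z <= C%:E)%E -> fav P C z.
pose a t : X -> Z 0 := iota t \o A1 t.
have [kappa [kappa_gt0 hkappa]] := iota_norm.
have A1P t : 0 <= t <= T -> linear (A1 t) /\ forall x, rnorm (A1 t x) = rnorm x.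
  by move=> /extrA[_ _ []].
have a_lin t : 0 <= t <= T -> linear (a t).
  move=> tT c x y; have [li _ _] := iotaP t tT; have [lA _] := A1P t tT.
  by rewrite /a /= lA li.
have a_le t x : 0 <= t <= T -> rnorm (a t x) <= kappa * rnorm x.
  move=> tT; have [_ <-] := A1P t tT; have [h _] := hkappa t (A1 t x) tT.
  by rewrite -ler_pdivrMl.
have a_ge t x : 0 <= t <= T -> rnorm x <= kappa * rnorm (a t x).
  by move=> tT; have [_ <-] := A1P t tT; have [_ h] := hkappa t (A1 t x) tT.
have a_surj t z : 0 <= t <= T -> exists x, a t x = z.
  move=> tT; have [_ [g _ gK] _] := iotaP t tT.
  have [x hx] := A1_surj (resA t tT) (extrA t tT) (g z).
  by exists x; rewrite /a /= hx gK.
have a_E t x : 0 <= t <= T -> dom (A t) x -> a t x = j 0 (A t x).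
  move=> tT Dx; have [_ _ ij] := iotaP t tT; have [_ _ [_ _ A1E] _] := extrA t tT.
  by rewrite /a /= A1E.
have a_inj t : 0 <= t <= T -> injective (a t).
  move=> tT x y xy; have [_ _ aB _ _] := additive_lin (a_lin t tT).
  apply/eqP; rewrite -subr_eq0; apply/eqP/rnorm_eq0/eqP.
  rewrite eq_le rnorm_ge0 andbT; apply: le_trans (a_ge t _ tT) _.
  by rewrite aB xy subrr rnorm0 mulr0.
have [L [L_gt0 hL]] := lipA.
have a_Lip t s x : 0 <= t <= T -> 0 <= s <= T ->
    rnorm (a t x - a s x) <= L * kappa * `|t - s| * rnorm x.
  move=> tT sT; have inv y : inverse_on setT (a s) (a s y) = y.
    by rewrite /inverse_on pinvKV ?inE // => u v _ _; exact: a_inj.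
  have := opnorm_le (f := fun z => z - a t (inverse_on setT (a s) z)) _ _ (hL t s tT sT).
  move=> /(_ _ _ (a s x)); rewrite inv rnormBC => h.
  apply: (@le_trans _ _ (L * `|t - s| * rnorm (a s x))).
    apply: h; first by rewrite mulr_ge0 // ltW.
    move=> c z; have [y <-] := a_surj s z sT.
    have [_ _ _ asZ _] := additive_lin (a_lin s sT).
    have [_ _ _ atZ _] := additive_lin (a_lin t tT).
    by rewrite -asZ !inv asZ atZ scalerBr.
  rewrite -!mulrA ler_wpM2l ?(ltW L_gt0) // [leRHS]mulrCA ler_wpM2l //.
  exact: a_le.
have [evolU1 _ dU1 _] := extrU.
have U1_deriv t x : 0 <= t <= T ->
    antideriv 0 t (fun s => U1 t s (j 0 x)) (fun s => - U1 t s (a s x)).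
  by move=> tT; apply: derivative_within_antideriv => s st; apply: dU1; between.
have U1_j t s x : 0 <= s -> s <= t -> t <= T -> U1 t s (j 0 x) = j 0 (U t s x).
  exact: (evolution_restriction j_b evolU evolU1 solvU a_E U1_deriv).
have [KU KU0 fav_U1] := fav_evol j_b P_b P_jK j_PK evolU evolU1 U1_j.
have const_range t x y z F : 0 <= x -> x <= y -> y <= t -> t <= T ->
    antideriv x y F (fun s => U1 t s z) -> exists u, F y - F x = j 0 u.
  apply: (const_integral_range j_b P_b P_jK j_PK evolU evolU1 U1_j (ltW kappa_gt0)
    _ a_lin a_surj a_le a_ge a_Lip U1_deriv).
  by rewrite mulr_ge0 ?ltW.
have [CZ CZ0 B_le] := B_uniform T_gt0 BLip.
have [CB CB0 B_fav] := B_fav_uniform P_b T_gt0 fav_P BLinfty BLip.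
have B_lin t : 0 <= t <= T -> linear (B t) by move=> tT; have [/(_ t tT)[]] := BLip.
have B_cont x := @Lip_cont _ _ _ _ _ BLip x.
have [z hz] := countable_values P_b T_gt0 fav_P BLinfty BLip sepX.
apply: (perturbed_evolution_family j_b P_b P_jK evolU evolU1 U1_j KU0 fav_U1
  CB0 CZ0 B_lin B_le B_cont B_fav _ (ltW T_gt0)).
move=> s t v F s0 st tT cv Fv.
have [m m0 hm] := cont_on_bounded st cv.
apply: (integral_range j_b P_b P_jK j_PK evolU1 KU0 fav_U1 const_range
  (z := z) (C := CB * m) s0 st tT _ Fv).
- exact: (B_cont_on CZ0 B_lin B_le B_cont).
- move=> r rst; have rT : 0 <= r <= T by between.
  by apply: fav_le (B_fav r _ rT); rewrite ler_wpM2l ?hm.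
- exact: hz.
Qed.
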